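(* Writing $A\le B$ for ''the search problem $A$ is polynomial-time reducible to the search problem $B$'', one has $$\text{weak-Pigeon}\ \le\ \text{Ward-Szabo-Collisions}\ \le\ \text{Ward-Szabo-Colorful-Collisions}\ \le\ \text{Ward-Szabo}.$$
   Context: Search problems. A search problem is a binary relation $R\subseteq\{0,1\}^*\times\{0,1\}^*$; $s$ is a solution of instance $x$ if $(x,s)\in R$. Problems are specified by their valid (polynomial-time recognizable) instances; for an invalid instance every string is a solution by convention. $R$ is (polynomial-time) reducible to $S$ if there are polynomial-time functions $f,g$ such that for all $x,s$: if $s$ is a solution of $f(x)$ for $S$ then $g(x,s)$ is a solution of $x$ for $R$. weak-Pigeon: an instance is a Boolean circuit $C:\{0,1\}^n\to\{0,1\}^{n-1}$; a solution is a pair $x_1\ne x_2$ with $C(x_1)=C(x_2)$. The three problems Ward-Szabo, Ward-Szabo-Collisions and Ward-Szabo-Colorful-Collisions have the same instances: a Boolean circuit $C:\{0,1\}^{2n}\times\{0,1\}^{2n}\to\{0,1\}^n$ together with distinct $a,b,c\in\{0,1\}^{2n}$ ($n$ a positive integer, part of the instance). Ward-Szabo: a solution is one of: (i) the symbol $0$, if $C(a,b)=C(a,c)$; (ii) $x,y$ such that $C(x,y)\ne C(y,x)$; (iii) distinct $x,y,z$ such that $C(x,y)=C(y,z)\neq C(x,z)$. Ward-Szabo-Collisions: a solution is one of (i), (ii), (iii) above, or: (iv) two triples $(x,y,z),(x',y',z')$, each with 3 distinct elements, such that $\{x,y,z\}\ne\{x',y',z'\}$ and $C(x,y)=C(x',y')$,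 $C(x,z)=C(x',z')$, $C(y,z)=C(y',z')$. Ward-Szabo-Colorful-Collisions: a solution is one of (i), (ii), (iii) above, or: (iv') two triples as in (iv) for which moreover the triangle $(x,y,z)$ is trichromatic, i.e. $C(x,y),C(x,z),C(y,z)$ are pairwise distinct. *)

(* Defs.v *)
From mathcomp Require Import all_boot all_order all_algebra.

Set Implicit Arguments.
Unset Strict Implicit.
Unset Printing Implicit Defensive.

(* The tape alphabet over [A] consists of the blank [None], the two bits
   [Some (inl b)] and the auxiliary symbols [Some (inr a)]. *)
Definition sym (A : finType) : finType := option (bool + A).

Definition blank (A : finType) : sym A := None.
Definition bit (A : finType) (b : bool) : sym A := Some (inl b).

Inductive move := MLeft | MStay | MRight.

(* A two-way infinite tape: the cells to the left of the head (nearest first),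
   the scanned cell, the cells to its right; every cell that is not listed is
   blank. *)
Record tape (A : finType) := Tape {
  tleft : seq (sym A);
  tcur : sym A;
  tright : seq (sym A)
}.

Definition tape_of (A : finType) (w : seq (sym A)) : tape A :=
  Tape [::] (head (blank A) w) (behead w).

Definition tape_write (A : finType) (s : sym A) (t : tape A) : tape A :=
  Tape (tleft t) s (tright t).

Definition tape_move (A : finType) (d : move) (t : tape A) : tape A :=
  match d with
  | MLeft => Tape (behead (tleft t)) (head (blank A) (tleft t))
                  (tcur t :: tright t)
  | MStay => t
  | MRight => Tape (tcur t :: tleft t) (head (blank A) (tright t))
                   (behead (tright t))
  end.

Fixpoint leading_bits (A : finType) (w : seq (sym A)) : seq bool :=
  match w with
  | Some (inl b) :: w' => b :: leading_bits w'
  | _ => [::]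
  end.

Record TM := MkTM {
  tm_state : finType;
  tm_aux : finType;
  tm_tapes : nat; (* the number of tapes minus one *)
  tm_start : tm_state;
  tm_halt : pred tm_state;
  tm_delta : tm_state -> {ffun 'I_tm_tapes.+1 -> sym tm_aux} ->
             tm_state * {ffun 'I_tm_tapes.+1 -> sym tm_aux * move}
}.

Record config (M : TM) := Config {
  cstate : tm_state M;
  ctapes : {ffun 'I_(tm_tapes M).+1 -> tape (tm_aux M)}
}.

(* The input is on tape 0, with the head on its first symbol. *)
Definition tm_init (M : TM) (x : seq bool) : config M :=
  Config (tm_start M)
    [ffun i => tape_of (if i == ord0 then map (bit (tm_aux M)) x else [::])].

(* Halted configurations are fixed points. *)
Definition tm_step (M : TM) (c : config M) : config M :=
  if tm_halt (cstate c) then c else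
  let: (q, act) := tm_delta (cstate c) [ffun i => tcur (ctapes c i)] in
  Config q
    [ffun i => tape_move (act i).2 (tape_write (act i).1 (ctapes c i))].

(* The output is the string of bits that starts at the head of the last
   tape. *)
Definition tm_output (M : TM) (c : config M) : seq bool :=
  let t := ctapes c ord_max in leading_bits (tcur t :: tright t).

Definition polytime (f : seq bool -> seq bool) : Prop :=
  exists (M : TM) (p : {poly nat}), forall x : seq bool,
    let c := iter (p.[size x])%R (@tm_step M) (tm_init M x) in
    tm_halt (cstate c) /\ tm_output c = f x.

(* Unary, self-delimiting.  The numbers encoded below are wire indices and
   numbers of inputs, all bounded by the number of inputs, outputs and gates of
   the circuit at hand, so this is polynomially equivalent to binary. *)
Definition enc_nat (n : nat) : seq bool := rcons (nseq n true) false.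

Fixpoint enc_list (T : Type) (enc : T -> seq bool) (s : seq T) : seq bool :=
  if s is a :: s' then true :: enc a ++ enc_list enc s' else [:: false].

Definition enc_bits (x : seq bool) : seq bool :=
  enc_list (fun b => [:: b]) x.

Definition pairing (x s : seq bool) : seq bool := enc_bits x ++ enc_bits s.

Definition polytime2 (g : seq bool -> seq bool -> seq bool) : Prop :=
  exists h : seq bool -> seq bool,
    polytime h /\ forall x s, h (pairing x s) = g x s.

Definition search_problem := seq bool -> seq bool -> Prop.

Definition reducible (R S : search_problem) : Prop :=
  exists (f : seq bool -> seq bool) (g : seq bool -> seq bool -> seq bool),
    [/\ polytime f, polytime2 g
      & forall x s : seq bool, S (f x) s -> R x (g x s)].

(* The search problem given by valid instances in [I] and solutions in [T].
   A string that encodes no valid instance has every string as a solution. *)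
Definition encoded_problem (I T : Type)
    (encI : I -> seq bool) (encT : T -> seq bool)
    (valid : I -> Prop) (solution : I -> T -> Prop) : search_problem :=
  fun x s => forall i : I, valid i -> x = encI i ->
    exists t : T, s = encT t /\ solution i t.

(* Wires are numbered: first the inputs, then the gates in order. *)
Inductive gate :=
  | GConst of bool
  | GNot of nat
  | GAnd of nat & nat
  | GOr of nat & nat.

Record circuit := Circuit {
  gates : seq gate;
  outputs : seq nat
}.

Definition gate_wires (g : gate) : seq nat :=
  match g with
  | GConst _ => [::]
  | GNot i => [:: i]
  | GAnd i j | GOr i j => [:: i; j]
  end.

Fixpoint wf_gates (k : nat) (gs : seq gate) : bool :=
  if gs is g :: gs' then
    all (fun i => i < k) (gate_wires g) && wf_gates k.+1 gs'
  else true.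

(* [C] is a circuit {0,1}^n -> {0,1}^m. *)
Definition is_circuit (n m : nat) (C : circuit) : bool :=
  [&& wf_gates n (gates C),
      all (fun i => i < n + size (gates C)) (outputs C)
    & size (outputs C) == m].

Definition gate_value (v : seq bool) (g : gate) : bool :=
  match g with
  | GConst b => b
  | GNot i => ~~ nth false v i
  | GAnd i j => nth false v i && nth false v j
  | GOr i j => nth false v i || nth false v j
  end.

Definition wire_values (gs : seq gate) (x : seq bool) : seq bool :=
  foldl (fun v g => rcons v (gate_value v g)) x gs.

Definition ceval (C : circuit) (x : seq bool) : seq bool :=
  [seq nth false (wire_values (gates C) x) i | i <- outputs C].

Definition enc_gate (g : gate) : seq bool :=
  match g with
  | GConst b => enc_nat 0 ++ [:: b]
  | GNot i => enc_nat 1 ++ enc_nat i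
  | GAnd i j => enc_nat 2 ++ enc_nat i ++ enc_nat j
  | GOr i j => enc_nat 3 ++ enc_nat i ++ enc_nat j
  end.

Definition enc_circuit (C : circuit) : seq bool :=
  enc_list enc_gate (gates C) ++ enc_list enc_nat (outputs C).

Record wp_instance := WPInstance {
  wp_n : nat;
  wp_C : circuit
}.

Definition wp_valid (I : wp_instance) : Prop :=
  0 < wp_n I /\ is_circuit (wp_n I) (wp_n I).-1 (wp_C I).

Definition wp_solution (I : wp_instance) (t : seq bool * seq bool) : Prop :=
  [/\ size t.1 = wp_n I, size t.2 = wp_n I, t.1 <> t.2
    & ceval (wp_C I) t.1 = ceval (wp_C I) t.2].

Definition enc_wp_instance (I : wp_instance) : seq bool :=
  enc_nat (wp_n I) ++ enc_circuit (wp_C I).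

Definition enc_wp_solution (t : seq bool * seq bool) : seq bool :=
  enc_bits t.1 ++ enc_bits t.2.

Definition weak_Pigeon : search_problem :=
  encoded_problem enc_wp_instance enc_wp_solution wp_valid wp_solution.

Record ws_instance := WSInstance {
  ws_n : nat;
  ws_C : circuit;
  ws_a : seq bool;
  ws_b : seq bool;
  ws_c : seq bool
}.

Definition ws_vertex (I : ws_instance) (x : seq bool) : Prop :=
  size x = 2 * ws_n I.

Definition ws_color (I : ws_instance) (x y : seq bool) : seq bool :=
  ceval (ws_C I) (x ++ y).

Definition ws_valid (I : ws_instance) : Prop :=
  [/\ 0 < ws_n I,
      is_circuit (2 * ws_n I + 2 * ws_n I) (ws_n I) (ws_C I),
      [/\ ws_vertex I (ws_a I), ws_vertex I (ws_b I) & ws_vertex I (ws_c I)]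
    & [/\ ws_a I <> ws_b I, ws_a I <> ws_c I & ws_b I <> ws_c I]].

Inductive ws_answer :=
  | WSZero
  | WSPair of seq bool & seq bool
  | WSTriple of seq bool & seq bool & seq bool
  | WSTwoTriples of seq bool & seq bool & seq bool
                  & seq bool & seq bool & seq bool.

Definition ws_triangle (I : ws_instance) (x y z : seq bool) : Prop :=
  [/\ ws_vertex I x, ws_vertex I y & ws_vertex I z]
  /\ [/\ x <> y, x <> z & y <> z].

Definition ws_collision (I : ws_instance) (x y z x' y' z' : seq bool) : Prop :=
  [/\ ws_triangle I x y z, ws_triangle I x' y' z',
      ~ [:: x; y; z] =i [:: x'; y'; z']
    & [/\ ws_color I x y = ws_color I x' y',
          ws_color I x z = ws_color I x' z'
        & ws_color I y z = ws_color I y' z']].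

Definition ws_trichromatic (I : ws_instance) (x y z : seq bool) : Prop :=
  [/\ ws_color I x y <> ws_color I x z,
      ws_color I x y <> ws_color I y z
    & ws_color I x z <> ws_color I y z].

Definition ws_solution (I : ws_instance) (t : ws_answer) : Prop :=
  match t with
  | WSZero => ws_color I (ws_a I) (ws_b I) = ws_color I (ws_a I) (ws_c I)
  | WSPair x y =>
      [/\ ws_vertex I x, ws_vertex I y & ws_color I x y <> ws_color I y x]
  | WSTriple x y z =>
      [/\ ws_triangle I x y z, ws_color I x y = ws_color I y z
        & ws_color I y z <> ws_color I x z]
  | WSTwoTriples _ _ _ _ _ _ => False
  end.

Definition wsc_solution (I : ws_instance) (t : ws_answer) : Prop :=
  match t with
  | WSTwoTriples x y z x' y' z' => ws_collision I x y z x' y' z'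
  | _ => ws_solution I t
  end.

Definition wscc_solution (I : ws_instance) (t : ws_answer) : Prop :=
  match t with
  | WSTwoTriples x y z x' y' z' =>
      ws_collision I x y z x' y' z' /\ ws_trichromatic I x y z
  | _ => ws_solution I t
  end.

Definition enc_ws_instance (I : ws_instance) : seq bool :=
  enc_nat (ws_n I) ++ enc_circuit (ws_C I) ++
  enc_bits (ws_a I) ++ enc_bits (ws_b I) ++ enc_bits (ws_c I).

Definition enc_ws_answer (t : ws_answer) : seq bool :=
  match t with
  | WSZero => enc_nat 0
  | WSPair x y => enc_nat 1 ++ enc_bits x ++ enc_bits y
  | WSTriple x y z => enc_nat 2 ++ enc_bits x ++ enc_bits y ++ enc_bits z
  | WSTwoTriples x y z x' y' z' =>
      enc_nat 3 ++ enc_bits x ++ enc_bits y ++ enc_bits z ++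
      enc_bits x' ++ enc_bits y' ++ enc_bits z'
  end.

Definition Ward_Szabo : search_problem :=
  encoded_problem enc_ws_instance enc_ws_answer ws_valid ws_solution.

Definition Ward_Szabo_Collisions : search_problem :=
  encoded_problem enc_ws_instance enc_ws_answer ws_valid wsc_solution.

Definition Ward_Szabo_Colorful_Collisions : search_problem :=
  encoded_problem enc_ws_instance enc_ws_answer ws_valid wscc_solution.

Definition prefix_free (T : Type) (enc : T -> seq bool) : Prop :=
  forall a b u v, enc a ++ u = enc b ++ v -> a = b /\ u = v.

Lemma enc_nat_prefix_free : prefix_free enc_nat.
Proof.
elim=> [|m IHm] [|n] u v //=; rewrite /enc_nat /=; first by case.
by case=> /IHm[-> ->].
Qed.

Lemma enc_list_prefix_free (T : Type) (enc : T -> seq bool) :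
  prefix_free enc -> prefix_free (enc_list enc).
Proof.
move=> encP; elim=> [|a s IHs] [|b r] u v //=; first by case.
by rewrite -!catA => -[] /encP[-> /IHs[-> ->]].
Qed.

Lemma enc_bits_prefix_free : prefix_free enc_bits.
Proof. by apply: enc_list_prefix_free => a b u v [-> ->]. Qed.

Lemma enc_gate_prefix_free : prefix_free enc_gate.
Proof.
move=> [b|i|i j|i j] [b'|i'|i' j'|i' j'] u v;
  rewrite /enc_gate -!catA => /enc_nat_prefix_free[] //= _.
- by case=> -> ->.
- by move=> /enc_nat_prefix_free[-> ->].
- by move=> /enc_nat_prefix_free[-> /enc_nat_prefix_free[-> ->]].
- by move=> /enc_nat_prefix_free[-> /enc_nat_prefix_free[-> ->]].
Qed.

Lemma enc_circuit_prefix_free : prefix_free enc_circuit.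
Proof.
move=> [gs os] [gs' os'] u v; rewrite /enc_circuit /= -!catA.
move=> /(enc_list_prefix_free enc_gate_prefix_free)[->].
by move=> /(enc_list_prefix_free enc_nat_prefix_free)[-> ->].
Qed.

Lemma pairing_inj x s x' s' : pairing x s = pairing x' s' -> x = x' /\ s = s'.
Proof.
move=> /enc_bits_prefix_free[->].
by rewrite -[LHS]cats0 -[RHS]cats0 => /enc_bits_prefix_free[->].
Qed.

Lemma enc_wp_instance_inj : injective enc_wp_instance.
Proof.
move=> [n C] [n' C'] /enc_nat_prefix_free[/= ->].
by rewrite -[LHS]cats0 -[RHS]cats0 => /enc_circuit_prefix_free[->].
Qed.

Lemma enc_wp_solution_inj : injective enc_wp_solution.
Proof. by move=> [x s] [x' s'] /pairing_inj[/= -> ->]. Qed.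

Lemma enc_ws_instance_inj : injective enc_ws_instance.
Proof.
move=> [n C a b c] [n' C' a' b' c'] /enc_nat_prefix_free[/= ->].
move=> /enc_circuit_prefix_free[->].
move=> /enc_bits_prefix_free[-> /enc_bits_prefix_free[->]].
by rewrite -[LHS]cats0 -[RHS]cats0 => /enc_bits_prefix_free[->].
Qed.

Lemma enc_ws_answer_inj : injective enc_ws_answer.
Proof.
move=> t t' E.
have {E} : enc_ws_answer t ++ [::] = enc_ws_answer t' ++ [::] by rewrite E.
case: t t' => [|x y|x y z|x y z x1 y1 z1] [|? ?|? ? ?|? ? ? ? ? ?];
  rewrite /enc_ws_answer -?catA => /enc_nat_prefix_free[] //= _;
  by do ?[move=> /enc_bits_prefix_free[->]].
Qed.

(* Main.v *)
(* Every solution of Ward-Szabo is a solution of Ward-Szabo-Colorful-Collisions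
   of the same instance, and likewise for the next step, so only the reduction
   from weak-Pigeon is not the identity.

   For C : {0,1}^n -> {0,1}^(n-1), colour the pair {x, y} of strings of length
   2n by a Merkle-Damgard hash.  For all i, j < 2n let
     q_ij = (x_i and not y_j) or (y_i and not x_j);
   these bits are symmetric in x and y, and they determine the unordered pair
   {x, y} if x <> y.  Starting from u = 0^n, replace u by q_ij C(u) for all
   (i, j) in turn; the colour is 0 C(u).  Two different pairs with the same
   colour give a collision of C in one of the steps, and each kind of solution
   of Ward-Szabo-Collisions provides two such pairs.

   For the time bound, the two maps of the reduction are loop programs on stacks
   of bits in which every loop runs exactly |input|^k times, idling once its
   work is done.  Such a program runs in polynomial time for syntactic reasons,
   on every input, so that its effect needs to be studied on valid inputs
   only. *)

From mathcomp Require Import all_boot all_order all_algebra.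
From Stdlib Require Import FunctionalExtensionality.
From mathcomp Require Import zify.
Require Import Defs.

Set Implicit Arguments.
Unset Strict Implicit.
Unset Printing Implicit Defensive.

(** * Turing machines for control-flow graphs on stacks *)

(** Why a colour collision yields a collision of C: equal colours say that C agrees on the two final
    states. If those states differ, they are a solution of weak-Pigeon. If they are equal, their
    first bits q_ij agree and C agrees on the previous two states, so the argument can be repeated
    one step earlier. If no step gives a solution, all q_ij agree and the two unordered pairs
    coincide. Each state q_ij C(u) has 1 + (n-1) = n bits, so C can be applied again; the leading 0
    of the colour likewise brings its length to the required n. A solution of kind (ii) cannot
    occur, because every q_ij is symmetric. In kind (iv), three edges that agree as unordered pairs
    would force equal vertex sets. The second map does not branch on the kind of solution. It
    compares five fixed pairs of chains and keeps any genuine collision that it meets; chains of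
    meaningless strings do no harm, since every state has length n whatever the strings are. The
    obstacle is [polytime], which demands a concrete machine that has halted after an explicit
    polynomial number of steps on every string. Hence the layers: stack programs with fixed loops,
    while programs, control-flow graphs, machines. *)

Definition store := nat -> seq bool.

Definition upd (s : store) (r : nat) (w : seq bool) : store :=
  fun r' => if r' == r then w else s r'.

Inductive instr (T : Type) :=
  | IPush of nat & bool & T
  | IPop of nat & T
  | ICase of nat & T & T & T.

Definition imap (T U : Type) (f : T -> U) (i : instr T) : instr U :=
  match i with
  | IPush r b t => IPush r b (f t)
  | IPop r t => IPop r (f t)
  | ICase r t0 t1 t2 => ICase r (f t0) (f t1) (f t2)
  end.

Definition ireg (T : Type) (i : instr T) : nat :=
  match i with IPush r _ _ | IPop r _ | ICase r _ _ _ => r end.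

Definition gstep (Q : Type) (code : Q -> instr (option Q))
    (c : option Q * store) : option Q * store :=
  if c.1 is Some q then
    match code q with
    | IPush r b t => (t, upd c.2 r (b :: c.2 r))
    | IPop r t => (t, upd c.2 r (behead (c.2 r)))
    | ICase r t0 t1 t2 =>
        (match c.2 r with [::] => t0 | true :: _ => t1 | false :: _ => t2 end,
         c.2)
    end
  else c.

Definition input_store (x : seq bool) : store :=
  fun r => if r == 0 then x else [::].

(** The top of the stack is under the head and everything to the left is blank, so a push steps left
    onto a blank cell and a pop erases and steps right. The trailing blanks absorb cells that were
    visited and are still listed. *)
Definition represents (t : tape void) (w : seq bool) : Prop :=
  tleft t = nseq (size (tleft t)) (blank void) /\
  exists m, tcur t :: tright t = map (bit void) w ++ nseq m (blank void).

Lemma represents_tape_of w : represents (tape_of (map (bit void) w)) w.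
Proof.
split=> //; case: w => [|b w] /=; first by exists 1.
by exists 0; rewrite cats0.
Qed.

Lemma represents_push t w b : represents t w ->
  represents (tape_write (bit void b) (tape_move MLeft t)) (b :: w).
Proof.
case: t => [l c r] [/= El [m E]]; split=> /=; last by exists m; rewrite /= E.
by rewrite El; case: (size l) => //= k; rewrite size_nseq.
Qed.

Lemma represents_pop t w : represents t w ->
  represents (tape_move MRight (tape_write (blank void) t)) (behead w).
Proof.
case: t => [l c r] [/= El [m E]]; split=> /=; first by congr (_ :: _).
case: w E => [|b w] /=.
  case: m => [|m] //= [_ ->]; case: m => [|m] /=; first by exists 1.
  by exists m.+1.
case=> _ ->; case: w => [|b' w] /=; last by exists m.
case: m => [|m] /=; first by exists 1.
by exists m.+1.
Qed.

Lemma represents_cur t w : represents t w ->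
  tcur t = if w is b :: _ then bit void b else blank void.
Proof.
case: t => [l c r] [_ [m /=]]; case: w => [|b w] /=; last by case.
by case: m => //= m [].
Qed.

Lemma represents_output t w : represents t w ->
  leading_bits (tcur t :: tright t) = w.
Proof.
case=> _ [m ->]; elim: w => [|b w IHw]; last by rewrite /= IHw.
by case: m.
Qed.

Section GraphMachine.

Variables (Q : finType) (code : Q -> instr (option Q)) (start : Q) (out : nat).

Definition graph_tapes : nat := (maxn out (\max_q ireg (code q))).+1.

(* The last tape is a second copy of the tape of the register [out]. *)
Definition tape_reg (i : 'I_graph_tapes.+1) : nat :=
  if i == graph_tapes :> nat then out else i.

(** A machine writes before it moves, whereas a push has to move before it writes, so a push takes
    two steps. The Boolean in the state is the phase; the other instructions are padded to two
    steps, which makes the time exactly twice the number of instructions. An instruction on [out]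
    acts on both of its tapes. *)
Definition graph_delta (q : option Q * bool)
    (rd : {ffun 'I_graph_tapes.+1 -> sym void}) :
    option Q * bool * {ffun 'I_graph_tapes.+1 -> sym void * move} :=
  let stay := [ffun i => (rd i, MStay)] in
  if q.1 isn't Some p then (q, stay) else
  match code p, q.2 with
  | IPush r b t, false =>
      (Some p, true,
       [ffun i => (rd i, if tape_reg i == r then MLeft else MStay)])
  | IPush r b t, true =>
      (t, false,
       [ffun i => (if tape_reg i == r then bit void b else rd i, MStay)])
  | IPop r t, false =>
      (Some p, true,
       [ffun i => if tape_reg i == r then (blank void, MRight)
                  else (rd i, MStay)])
  | IPop r t, true => (t, false, stay)
  | ICase r t0 t1 t2, false => (Some p, true, stay)
  | ICase r t0 t1 t2, true =>
      (match rd (inord r) with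
       | Some (inl true) => t1
       | Some (inl false) => t2
       | _ => t0
       end, false, stay)
  end.

Definition graph_TM : TM :=
  @MkTM (option Q * bool)%type void graph_tapes (Some start, false)
        (fun q => ~~ isSome q.1) graph_delta.

Definition simulates (c : config graph_TM) (d : option Q * store) : Prop :=
  cstate c = (d.1, false) /\
  forall i, represents (ctapes c i) (d.2 (tape_reg i)).

Lemma tape_reg_inord r :
  r < graph_tapes -> tape_reg (inord r) = r.
Proof.
move=> lt_r; rewrite /tape_reg inordK ?(ltn_trans lt_r) //.
by rewrite ltn_eqF.
Qed.

Lemma ireg_lt q : ireg (code q) < graph_tapes.
Proof.
rewrite ltnS leq_max; apply/orP; right.
exact: (leq_bigmax (F := fun p => ireg (code p))).
Qed.

Lemma tape_write_cur (t : tape void) : tape_write (tcur t) t = t.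
Proof. by case: t. Qed.

Lemma simulates_step c d :
  simulates c d -> simulates (tm_step (tm_step c)) (gstep code d).
Proof.
case: c d => [st tp] [q s] [/= -> rep_s] {st}.
case: q => [p|]; last by rewrite /tm_step /=.
rewrite /gstep /=; have := ireg_lt p.
case Ep: (code p) => [r b t|r t|r t0 t1 t2] /= lt_r.
- rewrite {2}/tm_step /= /graph_delta /= Ep /tm_step /= /graph_delta /= Ep /=.
  split=> //= i; rewrite !ffunE /= /upd tape_write_cur.
  case: (tape_reg i =P r) => [<-|_]; first exact: represents_push.
  by rewrite /= !tape_write_cur.
- rewrite {2}/tm_step /= /graph_delta /= Ep /tm_step /= /graph_delta /= Ep /=.
  split=> //= i; rewrite !ffunE /= /upd tape_write_cur.
  case: (tape_reg i =P r) => [<-|_]; first exact: represents_pop.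
  by rewrite /= tape_write_cur.
- rewrite {2}/tm_step /= /graph_delta /= Ep /tm_step /= /graph_delta /= Ep /=.
  split=> /= [|i]; last by rewrite !ffunE /= !tape_write_cur.
  do !rewrite ffunE /=; rewrite (represents_cur (rep_s _)).
  by rewrite tape_reg_inord //; case: (s r) => [|[] ?].
Qed.

Lemma simulates_iter n c d : simulates c d ->
  simulates (iter n.*2 (@tm_step _) c) (iter n (gstep code) d).
Proof. by elim: n => //= n IHn /IHn; apply: simulates_step. Qed.

(** The output register must not be 0: the input is written on tape 0 only, so a copy of register 0
    on the last tape would start out wrong. *)
Lemma simulates_init x :
  out != 0 -> simulates (tm_init graph_TM x) (Some start, input_store x).
Proof.
move=> out_neq0; split=> //= i; rewrite ffunE /input_store /tape_reg.
have [->|i_neq0] := eqVneq i ord0; first exact: represents_tape_of.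
have -> : (if i == graph_tapes :> nat then out else i) == 0 = false.
  by case: ifP => _; apply: negbTE.
exact: (represents_tape_of [::]).
Qed.

(** Halted configurations are fixed points, so any larger number of steps gives the same result;
    [polytime] inspects the machine after exactly p(|x|) steps. *)
Lemma graph_TM_correct x n m s : out != 0 ->
  iter n (gstep code) (Some start, input_store x) = (None, s) ->
  n.*2 <= m ->
  let c := iter m (@tm_step graph_TM) (tm_init graph_TM x) in
  tm_halt (cstate c) /\ tm_output c = s out.
Proof.
move=> out_neq0 En le_nm; have := simulates_iter n (simulates_init x out_neq0).
rewrite En -(subnK le_nm) iterD.
set c := iter n.*2 _ _ => -[/= Ec rep_s].
have halt_c : tm_step c = c by rewrite /tm_step Ec.
have -> : iter (m - n.*2) (@tm_step _) c = c.
  by elim: (m - n.*2) => //= k ->.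
split; first by rewrite Ec.
rewrite /tm_output (represents_output (rep_s _)) /tape_reg.
by rewrite eqxx.
Qed.

End GraphMachine.

(** * While programs *)

Inductive cmd :=
  | CSkip
  | CPush of nat & bool
  | CPop of nat
  | CCase of nat & cmd & cmd & cmd
  | CSeq of cmd & cmd
  | CWhile of nat & cmd.

(** The states of the control-flow graph. The test of a [CCase] or [CWhile] has its own state
    [None], in front of the states of the subcommands. *)
Fixpoint pos (c : cmd) : finType :=
  match c with
  | CSkip | CPush _ _ | CPop _ => unit
  | CCase _ c0 c1 c2 => option (pos c0 + pos c1 + pos c2)%type
  | CSeq c1 c2 => (pos c1 + pos c2)%type
  | CWhile _ c => option (pos c)
  end.

Fixpoint entry (c : cmd) : pos c :=
  match c with
  | CSkip | CPush _ _ | CPop _ => tt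
  | CCase _ _ _ _ => None
  | CSeq c1 c2 => inl (entry c1)
  | CWhile _ _ => None
  end.

(* The target [None] is the exit of the command. *)
Fixpoint code (c : cmd) : pos c -> instr (option (pos c)) :=
  match c with
  | CSkip => fun _ => ICase 0 None None None
  | CPush r b => fun _ => IPush r b None
  | CPop r => fun _ => IPop r None
  | CCase r c0 c1 c2 => fun p =>
      match p with
      | None => ICase r (Some (Some (inl (inl (entry c0)))))
                        (Some (Some (inl (inr (entry c1)))))
                        (Some (Some (inr (entry c2))))
      | Some (inl (inl q)) =>
          imap (omap (fun q => Some (inl (inl q)))) (code q)
      | Some (inl (inr q)) =>
          imap (omap (fun q => Some (inl (inr q)))) (code q)
      | Some (inr q) => imap (omap (fun q => Some (inr q))) (code q)
      end
  | CSeq c1 c2 => fun p =>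
      match p with
      | inl q => imap (fun t => Some (oapp inl (inr (entry c2)) t)) (code q)
      | inr q => imap (omap inr) (code q)
      end
  | CWhile r c => fun p =>
      match p with
      | None => ICase r None (Some (Some (entry c))) (Some (Some (entry c)))
      | Some q => imap Some (code q)
      end
  end.

(** The time is an upper bound, so that branches of different length can share one cost. *)
Definition takes (c : cmd) (s : store) (t : nat) (s' : store) : Prop :=
  exists2 n, n <= t &
    iter n (gstep (@code c)) (Some (entry c), s) = (None, s').

Lemma takes_weaken c s t t' s' : t <= t' -> takes c s t s' -> takes c s t' s'.
Proof. by move=> le_t [n le_n E]; exists n => //; apply: leq_trans le_t. Qed.

Lemma gstep_None (Q : Type) (cd : Q -> instr (option Q)) n s :
  iter n (gstep cd) (None, s) = (None, s).
Proof. by elim: n => //= n ->. Qed.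

(** Code of a subcommand inside a larger graph: [phi None] is the place where the larger command
    goes on. The given run may idle at its exit, while the larger graph would already proceed from
    there; hence only [n' <= n]. *)
Lemma gstep_embed (Q Q' : Type) (cd : Q -> instr (option Q))
    (cd' : Q' -> instr (option Q')) (emb : Q -> Q')
    (phi : option Q -> option Q') :
  (forall q, phi (Some q) = Some (emb q)) ->
  (forall q, cd' (emb q) = imap phi (cd q)) ->
  forall n p s s', iter n (gstep cd) (p, s) = (None, s') ->
  exists2 n', n' <= n & iter n' (gstep cd') (phi p, s) = (phi None, s').
Proof.
move=> phiS cdE; elim=> [|n IHn] p s s'; first by case=> -> ->; exists 0.
case: p => [q|]; last by rewrite gstep_None => -[<-]; exists 0.
rewrite iterSr; case E: (gstep _ _) => [p1 s1] /IHn [n' le_n' E'].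
exists n'.+1 => //; rewrite iterSr phiS.
suff -> : gstep cd' (Some (emb q), s) = (phi p1, s1) by [].
move: E; rewrite /gstep /= cdE; case: (cd q) => [r b t|r t|r t0 t1 t2] /=.
- by case=> <- <-.
- by case=> <- <-.
- by case=> <- <-; case: (s r) => [|[] ?].
Qed.

Lemma takes_skip s : takes CSkip s 1 s.
Proof. by exists 1 => //=; rewrite /gstep /=; case: (s 0) => [|[] ?]. Qed.

Lemma takes_push r b s : takes (CPush r b) s 1 (upd s r (b :: s r)).
Proof. by exists 1. Qed.

Lemma takes_pop r s : takes (CPop r) s 1 (upd s r (behead (s r))).
Proof. by exists 1. Qed.

Lemma takes_seq c1 c2 s t1 s1 t2 s2 :
  takes c1 s t1 s1 -> takes c2 s1 t2 s2 -> takes (CSeq c1 c2) s (t1 + t2) s2.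
Proof.
case=> [n1 le1 E1] [n2 le2 E2].
have [n1' le1' E1'] := gstep_embed (cd' := @code (CSeq c1 c2))
  (phi := fun t => Some (oapp inl (inr (entry c2)) t))
  (fun _ => erefl) (fun _ => erefl) E1.
have [n2' le2' E2'] := gstep_embed (cd' := @code (CSeq c1 c2))
  (phi := omap inr) (fun _ => erefl) (fun _ => erefl) E2.
exists (n2' + n1'); last by rewrite iterD E1'.
by rewrite addnC leq_add // (leq_trans _ le1, leq_trans _ le2).
Qed.

Lemma takes_case r c0 c1 c2 s t s' :
  takes (match s r with [::] => c0 | true :: _ => c1 | false :: _ => c2 end)
    s t s' ->
  takes (CCase r c0 c1 c2) s t.+1 s'.
Proof.
move=> [n le_n En].
have [n' le_n' En'] : exists2 n', n' <= n &
  iter n' (gstep (@code (CCase r c0 c1 c2)))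
    (gstep (@code (CCase r c0 c1 c2)) (Some None, s)) = (None, s').
  rewrite /gstep -/(gstep _) /=; case: (s r) En => [|[] _] En.
  - exact: (gstep_embed (cd' := @code (CCase r c0 c1 c2))
      (phi := omap (fun q => Some (inl (inl q)))) _ _ En).
  - exact: (gstep_embed (cd' := @code (CCase r c0 c1 c2))
      (phi := omap (fun q => Some (inl (inr q)))) _ _ En).
  - exact: (gstep_embed (cd' := @code (CCase r c0 c1 c2))
      (phi := omap (fun q => Some (inr q))) _ _ En).
by exists n'.+1; [exact: leq_trans le_n | rewrite iterSr].
Qed.

Lemma takes_while_nil r c s : s r = [::] -> takes (CWhile r c) s 1 s.
Proof. by move=> E; exists 1 => //=; rewrite /gstep /= E. Qed.

Lemma takes_while_cons r c s t1 s1 t2 s2 : s r != [::] ->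
  takes c s t1 s1 -> takes (CWhile r c) s1 t2 s2 ->
  takes (CWhile r c) s (t1 + t2).+1 s2.
Proof.
move=> r_neq0 [n1 le1 E1] [n2 le2 E2].
have [n1' le1' E1'] := gstep_embed (cd' := @code (CWhile r c))
  (phi := Some) (fun _ => erefl) (fun _ => erefl) E1.
exists (n2 + n1').+1; last first.
  rewrite iterSr; set x := gstep _ _.
  have -> : x = (Some (Some (entry c)), s).
    by rewrite /x /gstep /=; case: (s r) r_neq0 => [|[] ?].
  by rewrite iterD E1'.
by rewrite ltnS addnC leq_add // (leq_trans _ le1).
Qed.

(** * Loop programs with a fixed number of iterations *)

Inductive prog :=
  | PSkip
  | PPush of nat & bool
  | PPop of nat
  | PMove of nat & nat
  | PCase of nat & prog & prog & prog
  | PSeq of prog & prog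
  | PLoop of prog.

Fixpoint run (S : nat) (c : prog) (s : store) : store :=
  match c with
  | PSkip => s
  | PPush r b => upd s r (b :: s r)
  | PPop r => upd s r (behead (s r))
  | PMove r1 r2 =>
      if r1 == r2 then s
      else upd (upd s r2 (catrev (s r1) (s r2))) r1 [::]
  | PCase r c0 c1 c2 =>
      match s r with
      | [::] => run S c0 s
      | true :: _ => run S c1 s
      | false :: _ => run S c2 s
      end
  | PSeq c1 c2 => run S c2 (run S c1 s)
  | PLoop c => iter S (run S c) s
  end.

Fixpoint regs_bound (c : prog) : nat :=
  match c with
  | PSkip => 0
  | PPush r _ | PPop r => r.+1
  | PMove r1 r2 => maxn r1.+1 r2.+1
  | PCase r c0 c1 c2 =>
      maxn r.+1 (maxn (regs_bound c0) (maxn (regs_bound c1) (regs_bound c2)))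
  | PSeq c1 c2 => maxn (regs_bound c1) (regs_bound c2)
  | PLoop c => regs_bound c
  end.

Fixpoint depth (c : prog) : nat :=
  match c with
  | PSkip | PPush _ _ | PPop _ | PMove _ _ => 0
  | PCase _ c0 c1 c2 => maxn (depth c0) (maxn (depth c1) (depth c2))
  | PSeq c1 c2 => maxn (depth c1) (depth c2)
  | PLoop c => (depth c).+1
  end.

(** Bounds the growth of the total register size; a move only redistributes symbols. Branches are
    added rather than maximised, which keeps the bound visibly polynomial in [S]. *)
Fixpoint pushes (c : prog) (S : nat) : nat :=
  match c with
  | PSkip | PPop _ | PMove _ _ => 0
  | PPush _ _ => 1
  | PCase _ c0 c1 c2 => pushes c0 S + (pushes c1 S + pushes c2 S)
  | PSeq c1 c2 => pushes c1 S + pushes c2 S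
  | PLoop c => S * pushes c S
  end.

(* [M] bounds the total size of all registers, hence the time of a [PMove]. *)
Fixpoint cost (c : prog) (S M : nat) : nat :=
  match c with
  | PSkip | PPop _ | PPush _ _ => 1
  | PMove _ _ => 4 * M + 1
  | PCase _ c0 c1 c2 => 1 + (cost c0 S M + (cost c1 S M + cost c2 S M))
  | PSeq c1 c2 => cost c1 S M + cost c2 S M
  | PLoop c => S * (cost c S M + 3) + 1 + (4 * S + 1)
  end.

Definition cmove (a b : nat) : cmd :=
  CWhile a (CCase a CSkip (CSeq (CPop a) (CPush b true))
                          (CSeq (CPop a) (CPush b false))).

(* Registers of the program become even registers; the odd ones hold the loop
   counters. *)
Fixpoint compile (c : prog) : cmd :=
  match c with
  | PSkip => CSkip
  | PPush r b => CPush r.*2 b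
  | PPop r => CPop r.*2
  | PMove r1 r2 => if r1 == r2 then CSkip else cmove r1.*2 r2.*2
  | PCase r c0 c1 c2 => CCase r.*2 (compile c0) (compile c1) (compile c2)
  | PSeq c1 c2 => CSeq (compile c1) (compile c2)
  | PLoop c =>
      let a := (depth c).*2.*2.+1 in
      let a' := (depth c).*2.+1.*2.+1 in
      CSeq (CWhile a (CSeq (CPop a) (CSeq (CPush a' true) (compile c))))
           (cmove a' a)
  end.

(** The machine-level store interleaves the program registers [s] with the counters [cl], so that
    the latter are invisible to the program. *)
Definition low (s cl : store) : store :=
  fun r => if odd r then cl r./2 else s r./2.

Lemma upd_same s r : upd s r (s r) = s.
Proof.
by apply: functional_extensionality => r'; rewrite /upd; case: eqP => [->|].
Qed.

Lemma upd_upd s r v w : upd (upd s r v) r w = upd s r w.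
Proof.
by apply: functional_extensionality => r'; rewrite /upd; case: eqP.
Qed.

Lemma updC s r r' v w :
  r != r' -> upd (upd s r v) r' w = upd (upd s r' w) r v.
Proof.
move=> neq; apply: functional_extensionality => q; rewrite /upd.
by case: (q =P r') => // ->; rewrite eq_sym (negbTE neq).
Qed.

Lemma upd_eq s r v : upd s r v r = v.
Proof. by rewrite /upd eqxx. Qed.

Lemma upd_neq s r v r' : r' != r -> upd s r v r' = s r'.
Proof. by rewrite /upd => /negbTE->. Qed.

Lemma low_even s cl r : low s cl r.*2 = s r.
Proof. by rewrite /low odd_double doubleK. Qed.

Lemma low_odd s cl r : low s cl r.*2.+1 = cl r.
Proof. by rewrite /low /= odd_double uphalf_double. Qed.

Lemma upd_low_even s cl r w : upd (low s cl) r.*2 w = low (upd s r w) cl.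
Proof.
apply: functional_extensionality => q; rewrite /upd /low.
case: (q =P r.*2) => [->|neq]; first by rewrite odd_double doubleK eqxx.
case Eo: (odd q) => //; case: eqP => // Eq; case: neq.
by rewrite -[LHS]odd_double_half Eo Eq.
Qed.

Lemma upd_low_odd s cl r w : upd (low s cl) r.*2.+1 w = low s (upd cl r w).
Proof.
apply: functional_extensionality => q; rewrite /upd /low.
case: (q =P r.*2.+1) => [->|neq].
  by rewrite /= odd_double uphalf_double eqxx.
case Eo: (odd q) => //; case: eqP => // Eq; case: neq.
by rewrite -[LHS]odd_double_half Eo Eq.
Qed.

(** Four steps per bit (loop test, case, pop, push) and one final test. *)
Lemma takes_move a b s : a != b ->
  takes (cmove a b) s (4 * size (s a) + 1)
    (upd (upd s b (catrev (s a) (s b))) a [::]).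
Proof.
move=> neq; move Ew: (s a) => w; elim: w s Ew => [|x w IHw] s Ew.
  by rewrite /= upd_same -Ew upd_same; apply: takes_while_nil.
pose s1 := upd (upd s a w) b (x :: s b).
apply: (@takes_weaken _ _ (3 + (4 * size w + 1)).+1); first by rewrite /=; lia.
apply: (@takes_while_cons _ _ _ _ s1); first by rewrite Ew.
- apply: takes_case; rewrite Ew.
  have st y : takes (CSeq (CPop a) (CPush b y)) s 2
                (upd (upd s a w) b (y :: s b)).
    have := takes_seq (takes_pop a s) (takes_push b y _).
    by rewrite Ew /= [upd _ _ _ b]upd_neq // eq_sym.
  by rewrite /s1; case: x {Ew s1}; apply: st.
have E1 : s1 a = w by rewrite /s1 upd_neq // upd_eq.
have := IHw _ E1; rewrite {2 3}/s1 upd_eq upd_upd.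
by rewrite (updC _ _ _ neq) upd_upd.
Qed.

(** Each nesting depth owns two counters: a full clock and an empty spare that receives its ticks. A
    loop uses the counters of its body's depth; loops inside the body have smaller depth and hence
    other counters. *)
Definition ready (d S : nat) (cl : store) : Prop :=
  forall e, e < d -> cl e.*2 = nseq S true /\ cl e.*2.+1 = [::].

Definition total (K : nat) (s : store) : nat := \sum_(r < K) size (s r).

Lemma total_upd K s r w :
  r < K -> total K (upd s r w) + size (s r) = total K s + size w.
Proof.
move=> lt_rK; rewrite /total.
rewrite (bigD1 (Ordinal lt_rK)) //= [in RHS](bigD1 (Ordinal lt_rK)) //=.
rewrite upd_eq [X in _ + X + _](eq_bigr (fun i : 'I_K => size (s i))); first lia.
by move=> i /negbTE neq; rewrite upd_neq //; apply/negP => /eqP E;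
  move: neq; rewrite -val_eqE /= E eqxx.
Qed.

Lemma size_total K s r : r < K -> size (s r) <= total K s.
Proof.
by move=> lt_rK; rewrite /total (bigD1 (Ordinal lt_rK)) //= leq_addr.
Qed.

Lemma total_run K S c s :
  regs_bound c <= K -> total K (run S c s) <= total K s + pushes c S.
Proof.
elim: c s => [|r b|r|r1 r2|r c0 IH0 c1 IH1 c2 IH2|c1 IH1 c2 IH2|c IH] s /=;
  rewrite ?geq_max.
- by lia.
- by move=> lt_r; have := total_upd s (b :: s r) lt_r; rewrite /=; lia.
- move=> lt_r; have := total_upd s (behead (s r)) lt_r.
  by rewrite size_behead; lia.
- case/andP=> lt1 lt2; case: eqP => [_|/eqP neq]; first by lia.
  have := total_upd s (catrev (s r1) (s r2)) lt2.
  have := total_upd (upd s r2 (catrev (s r1) (s r2))) [::] lt1.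
  by rewrite upd_neq // catrevE size_cat size_rev /=; lia.
- case/and4P=> _ /(IH0 s) {}IH0 /(IH1 s) {}IH1 /(IH2 s) {}IH2.
  by case: (s r) => [|[] _]; lia.
- by case/andP=> /(IH1 s) {}IH1 /(IH2 (run S c1 s)) {}IH2; lia.
- move=> leK; elim: {1 3}S => //= [|n IHn]; first by lia.
  by have := IH (iter n (run S c) s) leK; rewrite mulSn; lia.
Qed.

Lemma takes_comp K S M c s cl : regs_bound c <= K -> ready (depth c) S cl ->
  total K s + pushes c S <= M ->
  takes (compile c) (low s cl) (cost c S M) (low (run S c s) cl).
Proof.
elim: c s cl => [|r b|r|r1 r2|r c0 IH0 c1 IH1 c2 IH2|c1 IH1 c2 IH2|c IH] s cl
  /=; rewrite ?geq_max.
- by move=> _ _ _; apply: takes_skip.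
- by move=> _ _ _; rewrite -upd_low_even -(low_even s cl); apply: takes_push.
- by move=> _ _ _; rewrite -upd_low_even -(low_even s cl); apply: takes_pop.
- case/andP=> lt1 lt2 _ leM; case: eqP => [_|/eqP neq].
    by apply: takes_weaken (takes_skip _); lia.
  rewrite -!upd_low_even -(low_even s cl r1) -(low_even s cl r2).
  apply: takes_weaken (takes_move _ _); last first.
    by apply/negP=> /eqP /double_inj E; rewrite E eqxx in neq.
  by rewrite low_even; have := size_total s lt1; lia.
- case/and4P=> _ le0 le1 le2 rd leM; apply: takes_case; rewrite low_even.
  have rdW d : d <= maxn (depth c0) (maxn (depth c1) (depth c2)) ->
      ready d S cl.
    by move=> le_d e lt_e; apply: rd; apply: leq_trans le_d.
  case: (s r) => [|[] _].
  + apply: takes_weaken (IH0 _ _ le0 (rdW _ _) _); lia.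
  + apply: takes_weaken (IH1 _ _ le1 (rdW _ _) _); lia.
  + apply: takes_weaken (IH2 _ _ le2 (rdW _ _) _); lia.
- case/andP=> le1 le2 rd leM.
  have rdW d : d <= maxn (depth c1) (depth c2) -> ready d S cl.
    by move=> le_d e lt_e; apply: rd; apply: leq_trans le_d.
  apply: takes_seq (IH1 _ _ le1 (rdW _ _) _) (IH2 _ _ le2 (rdW _ _) _); try lia.
  by have := total_run S s le1; lia.
- move=> leK rd leM; set d := depth c in rd *.
  set W := CWhile _ _.
  (* Here m rounds remain and k are done. The size budget covers only the remaining rounds, so
     [total_run] re-establishes it after each round. *)
  have loop m k s0 cl0 : total K s0 + m * pushes c S <= M ->
      ready d S cl0 -> cl0 d.*2 = nseq m true -> cl0 d.*2.+1 = nseq k true ->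
      takes W (low s0 cl0) (m * (cost c S M + 3) + 1)
        (low (iter m (run S c) s0)
             (upd (upd cl0 d.*2 [::]) d.*2.+1 (nseq (m + k) true))).
    elim: m k s0 cl0 => [|m IHm] k s0 cl0 leM0 rd0 E1 E2.
      rewrite -[[::]]/(nseq 0 true) -E1 upd_same add0n -E2 upd_same.
      by apply: takes_while_nil; rewrite low_odd.
    pose cl1 := upd (upd cl0 d.*2 (nseq m true)) d.*2.+1 (nseq k.+1 true).
    have rd1 : ready d S cl1.
      move=> e lt_e; rewrite /cl1; have [<- <-] := rd0 e lt_e.
      by split; rewrite !upd_neq //; lia.
    have neq : d.*2 != d.*2.+1 by lia.
    apply: (@takes_weaken _ _
      ((cost c S M + 2) + (m * (cost c S M + 3) + 1)).+1); first lia.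
    apply: (@takes_while_cons _ _ _ _ (low (run S c s0) cl1)).
    + by rewrite low_odd E1.
    + rewrite [_ + 2]addnC -(addn1 1) -addnA.
      apply: takes_seq (takes_pop _ _) _; rewrite low_odd upd_low_odd E1 /=.
      apply: takes_seq (takes_push _ _ _) _; rewrite low_odd upd_low_odd.
      rewrite upd_neq; last by lia.
      by rewrite E2; apply: IH => //; lia.
    + have := total_run S s0 leK => le_total.
      have -> : upd (upd cl0 d.*2 [::]) d.*2.+1 (nseq (m.+1 + k) true) =
                upd (upd cl1 d.*2 [::]) d.*2.+1 (nseq (m + k.+1) true).
        apply: functional_extensionality => q; rewrite addnS /cl1 /upd.
        by do 2 case: (q =P _) => // _.
      rewrite iterSr; apply: IHm rd1 _ _; first by lia.
        by rewrite /cl1 upd_neq // upd_eq.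
      by rewrite /cl1 upd_eq.
  have [E1 E2] : cl d.*2 = nseq S true /\ cl d.*2.+1 = nseq 0 true by apply: rd.
  have rdW : ready d S cl by move=> e lt_e; apply: rd; apply: ltnW.
  apply: takes_seq (loop S 0 s cl _ rdW E1 E2) _; first by lia.
  rewrite addn0; set cl1 := upd _ _ _.
  (* The closing move refills the clock from the spare. The counters thus leave the loop as they
     entered it, which lets an enclosing loop run the same code again. *)
  have -> : cl = upd (upd cl1 d.*2 (nseq S true)) d.*2.+1 [::].
    apply: functional_extensionality => q; rewrite /cl1 /upd.
    by do 2 case: (q =P _) => [->|_] //.
  have := @takes_move d.*2.+1.*2.+1 d.*2.*2.+1
    (low (iter S (run S c) s) cl1).
  have F1 : cl1 d.*2.+1 = nseq S true by rewrite /cl1 upd_eq.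
  have F2 : cl1 d.*2 = [::] by rewrite /cl1 upd_neq ?upd_eq //; lia.
  rewrite !low_odd !upd_low_odd F1 F2 size_nseq.
  have -> : catrev (nseq S true) [::] = nseq S true.
    by rewrite catrevE cats0 rev_nseq.
  by apply; lia.
Qed.

(** * Polynomial iteration counts, clocks, and the time bound *)

Fixpoint ploops (k : nat) (c : prog) : prog :=
  if k is k'.+1 then PLoop (ploops k' c) else c.

(** Nesting each loop k-fold gives |x|^k rounds while every clock has only |x| ticks, so that clocks
    can be filled by a single scan of the input. *)
Fixpoint expand (k : nat) (c : prog) : prog :=
  match c with
  | PSkip | PPush _ _ | PPop _ | PMove _ _ => c
  | PCase r c0 c1 c2 => PCase r (expand k c0) (expand k c1) (expand k c2)
  | PSeq c1 c2 => PSeq (expand k c1) (expand k c2)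
  | PLoop c => ploops k (expand k c)
  end.

Lemma iter_ext (T : Type) (f g : T -> T) n x : f =1 g -> iter n f x = iter n g x.
Proof. by move=> E; elim: n => //= n ->. Qed.

Lemma iter_mul (T : Type) (f : T -> T) m n x :
  iter m (iter n f) x = iter (m * n) f x.
Proof. by elim: m => //= m ->; rewrite mulSn iterD. Qed.

Lemma run_expand S k c s : run S (expand k c) s = run (S ^ k) c s.
Proof.
elim: c s => //= [r c0 IH0 c1 IH1 c2 IH2|c1 IH1 c2 IH2|c IH] s.
- by rewrite IH0 IH1 IH2.
- by rewrite IH1 IH2.
- rewrite (iter_ext _ _ (fun x => esym (IH x))).
  elim: k {IH} (expand k c) s => [|k IHk] c' s //=.
  by rewrite (iter_ext _ _ (IHk c')) iter_mul expnS.
Qed.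

Definition poly_bounded (h : nat -> nat) : Prop :=
  exists p : {poly nat}, forall n, h n <= p.[n]%R.

Lemma poly_bounded_const k : poly_bounded (fun=> k).
Proof. by exists (k%:P)%R => n; rewrite hornerC. Qed.

Lemma poly_bounded_id : poly_bounded id.
Proof. by exists ('X)%R => n; rewrite hornerX. Qed.

Lemma poly_bounded_add f g :
  poly_bounded f -> poly_bounded g -> poly_bounded (fun n => f n + g n).
Proof.
move=> [p le_p] [q le_q]; exists (p + q)%R => n.
by rewrite hornerD; apply: leq_add.
Qed.

Lemma poly_bounded_mul f g :
  poly_bounded f -> poly_bounded g -> poly_bounded (fun n => f n * g n).
Proof.
move=> [p le_p] [q le_q]; exists (p * q)%R => n.
by rewrite hornerM; apply: leq_mul.
Qed.

Lemma poly_bounded_pushes c f :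
  poly_bounded f -> poly_bounded (fun n => pushes c (f n)).
Proof.
move=> pf; elim: c => *; do ?[exact: poly_bounded_const
  | apply: poly_bounded_add => // | apply: poly_bounded_mul => //].
Qed.

Lemma poly_bounded_cost c f g : poly_bounded f -> poly_bounded g ->
  poly_bounded (fun n => cost c (f n) (g n)).
Proof.
move=> pf pg; elim: c => *; do ?[assumption | exact: poly_bounded_const
  | apply: poly_bounded_add => // | apply: poly_bounded_mul => //].
Qed.

Definition ctally (a b d : nat) : cmd :=
  CWhile a (CCase a CSkip
    (CSeq (CPop a) (CSeq (CPush b true) (CPush d true)))
    (CSeq (CPop a) (CSeq (CPush b false) (CPush d true)))).

Lemma takes_tally a b d s : a != b -> a != d -> b != d ->
  takes (ctally a b d) s (5 * size (s a) + 1)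
    (upd (upd (upd s b (catrev (s a) (s b)))
              d (ncons (size (s a)) true (s d))) a [::]).
Proof.
move=> neq_ab neq_ad neq_bd.
move Ew: (s a) => w; elim: w s Ew => [|x w IHw] s Ew.
  by rewrite /= !upd_same -Ew upd_same; apply: takes_while_nil.
pose s1 := upd (upd (upd s a w) b (x :: s b)) d (true :: s d).
apply: (@takes_weaken _ _ (4 + (5 * size w + 1)).+1); first by rewrite /=; lia.
apply: (@takes_while_cons _ _ _ _ s1); first by rewrite Ew.
- apply: takes_case; rewrite Ew.
  have st y : takes (CSeq (CPop a) (CSeq (CPush b y) (CPush d true))) s 3
                (upd (upd (upd s a w) b (y :: s b)) d (true :: s d)).
    have := takes_seq (takes_pop a s) (takes_seq (takes_push b y _)
      (takes_push d true _)).
    by rewrite Ew /= ![upd _ _ _ b]upd_neq 1?eq_sym // ![upd _ _ _ d]upd_neq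
      1?eq_sym.
  by rewrite /s1; case: x {Ew s1}; apply: st.
have E1 : s1 a = w by rewrite /s1 2?upd_neq // upd_eq.
have E2 : s1 b = x :: s b by rewrite /s1 upd_neq // upd_eq.
have E3 : s1 d = true :: s d by rewrite /s1 upd_eq.
have := IHw _ E1; rewrite E2 E3.
set s2 := upd _ _ _; set s3 := upd _ _ _; suff -> : s2 = s3 by [].
apply: functional_extensionality => q; rewrite /s2 /s3 /s1 /upd.
case: (q =P a) => // _; case: (q =P d) => _; last by case: (q =P b).
exact: esym (iterSr _ (cons true) _).
Qed.

(** The scan reverses the input onto [t]; moving it back restores the original order, ready for the
    next clock. *)
Definition set_clock (t e : nat) : cmd :=
  CSeq (ctally 0 t e.*2.*2.+1) (cmove t 0).

Fixpoint set_clocks (t e : nat) : cmd :=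
  if e is e'.+1 then CSeq (set_clocks t e') (set_clock t e') else CSkip.

Definition clocks (e S : nat) : store :=
  fun r => if (r < e.*2) && ~~ odd r then nseq S true else [::].

Lemma takes_set_clocks D e s : e <= D ->
  takes (set_clocks D.*2.*2.+1 e) (low s (fun=> [::]))
    (e * (9 * size (s 0) + 2) + 1) (low s (clocks e (size (s 0)))).
Proof.
elim: e => [_|e IHe lt_eD]; first exact: takes_skip.
rewrite mulSn -addnA addnC; apply: takes_seq (IHe (ltnW lt_eD)) _.
set cl := clocks e _.
have low0 s' cl' v : upd (low s' cl') 0 v = low (upd s' 0 v) cl'.
  exact: (upd_low_even s' cl' 0).
have E0 : low s cl 0 = s 0 by [].
have E1 : cl D.*2 = [::].
  by rewrite /cl /clocks ltnNge leq_double (ltnW lt_eD).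
have E2 : cl e.*2 = [::] by rewrite /cl /clocks ltnn.
apply: (@takes_weaken _ _ ((5 * size (s 0) + 1) + (4 * size (s 0) + 1))).
  by lia.
apply: takes_seq.
  by rewrite -E0; apply: takes_tally; lia.
rewrite !low_odd E0 E1 E2 !upd_low_odd low0.
set cl' := upd _ e.*2 _.
have F1 : cl' D.*2 = rev (s 0).
  by rewrite /cl' upd_neq ?upd_eq ?catrevE ?cats0 //; lia.
have := @takes_move D.*2.*2.+1 0 (low (upd s 0 [::]) cl') isT.
rewrite low_odd F1 size_rev.
rewrite -[low _ _ 0]/[::] catrevE revK cats0.
rewrite low0 upd_upd upd_same upd_low_odd /cl'.
set c1 := upd (upd (upd _ _ _) _ _) _ _.
suff -> : c1 = clocks e.+1 (size (s 0)) by [].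
apply: functional_extensionality => q; rewrite /c1 /upd /cl /clocks.
case: (q =P D.*2) => [->|_].
  by rewrite ltnNge leq_double lt_eD.
case: (q =P e.*2) => [->|neq].
  by rewrite ltn_double ltnSn odd_double /= /ncons -/(nseq _ _).
case Eo: (odd q); first by rewrite !andbF.
have -> // : (q < e.+1.*2) = (q < e.*2).
by rewrite doubleS !ltnS; lia.
Qed.

(** Programs print by pushing on register 1, so the last symbol printed is on top; a final move to
    the output tape performs the [rev]. *)
Definition result (k : nat) (c : prog) (x : seq bool) : seq bool :=
  rev (run (size x ^ k) c (input_store x) 1).

Theorem polytime_result k c : polytime (result k c).
Proof.
(* The 2 makes [K] cover registers 0 and 1, the input and the output, even if the program does not
   mention them. *)
set c' := expand k c; set D := depth c'; set K := maxn (regs_bound c') 2.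
(* The first odd register above all clocks. It is scratch while the clocks are filled, empty again
   afterwards, and then serves as the nonzero output register. *)
pose w := D.*2.*2.+1.
pose P := CSeq (set_clocks w D) (CSeq (compile c') (cmove 2 w)).
pose M n := n + pushes c' n.
pose t n := (D * (9 * n + 2) + 1) + (cost c' n (M n) + (4 * M n + 1)).
(* The factor 2 is for the two machine steps per instruction. *)
have [p le_p] : poly_bounded (fun n => 2 * t n).
  have pM : poly_bounded M.
    exact: poly_bounded_add poly_bounded_id
      (poly_bounded_pushes _ poly_bounded_id).
  have pc := poly_bounded_cost c' poly_bounded_id pM.
  do ?[assumption | exact: poly_bounded_const | exact: poly_bounded_id
  | apply: poly_bounded_add => // | apply: poly_bounded_mul => //].
exists (graph_TM (@code P) (entry P) w), p => x.
set S := size x.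
have neq_2w : 2 != w.
  by apply/negP => /eqP /(congr1 odd); rewrite /= odd_double.
have total_in : total K (input_store x) <= S.
  have lt_K : 0 < K by rewrite leq_max orbT.
  rewrite /total (bigD1 (Ordinal lt_K)) //=; rewrite big1 ?addn0 // => i.
  by rewrite -val_eqE /input_store /= => /negbTE->.
have [n le_n En] : takes P (input_store x) (t S)
    (upd (upd (low (run S c' (input_store x)) (clocks D S))
            w (rev (run S c' (input_store x) 1))) 2 [::]).
  apply: takes_seq.
    have <- : low (input_store x) (fun=> [::]) = input_store x.
      apply: functional_extensionality => r; rewrite /low /input_store.
      case: ifP => //; first by case: r.
      by case: r => [|[|r]].
    exact: takes_set_clocks.
  apply: takes_seq.
    apply: (@takes_comp K S (M S)); first by rewrite leq_maxl.
      move=> e lt_e; rewrite /clocks ltn_double lt_e odd_double /=.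
      by rewrite odd_double andbF.
    by rewrite leq_add2r.
  set s := run S c' _.
  have := takes_move (low s (clocks D S)) neq_2w.
  rewrite -[low _ _ 2]/(s 1).
  have -> : low s (clocks D S) w = [::] by rewrite low_odd /clocks ltnn.
  apply: takes_weaken; rewrite leq_add2r leq_mul2l /=.
  have lt1 : 1 < K by rewrite leq_max orbT.
  apply: leq_trans (size_total s lt1) _.
  apply: leq_trans (total_run _ _ _) _; first by rewrite leq_maxl.
  by rewrite leq_add2r.
have le_m : n.*2 <= p.[size x]%R.
  by rewrite -muln2 mulnC (leq_trans _ (le_p _)) // leq_mul2l.
have [halted outE] := graph_TM_correct (isT : w != 0) En le_m.
split=> //; apply: etrans outE _; rewrite upd_neq 1?eq_sym // upd_eq /result.
by rewrite run_expand.
Qed.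

(** * Basic loop programs *)

(* Conventions for the registers: 0 is the input still to be read, and 3 the
   part that was read, in reverse order, so that [PMove 3 0] rewinds; 1 is the
   output, in reverse order; 2 and 6 are scratch; 4 and 5 are the arguments of a
   gate; 9 is an operand stack; 10 to 13 are the indices of a double loop.
   Numbers are in unary. *)

Lemma iter_fix (T : Type) (f : T -> T) n x : f x = x -> iter n f x = x.
Proof. by move=> E; elim: n => //= n ->. Qed.

Lemma nseq_cat_cons (T : Type) n (x : T) w :
  nseq n x ++ x :: w = x :: nseq n x ++ w.
Proof. by elim: n => //= n ->. Qed.

Lemma catrevK (T : Type) (u v : seq T) : catrev (catrev u [::]) v = u ++ v.
Proof. by rewrite catrevE -/(rev u) revK. Qed.

Definition pclear (r : nat) : prog := PLoop (PPop r).

Lemma run_clear L r s : size (s r) <= L -> run L (pclear r) s = upd s r [::].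
Proof.
move=> le_L; rewrite /pclear /=.
have -> n : iter n (run L (PPop r)) s = upd s r (drop n (s r)).
  elim: n => [|n IHn]; first by rewrite drop0 upd_same.
  by rewrite iterS IHn /= upd_eq upd_upd -drop1 drop_drop.
by rewrite drop_oversize.
Qed.

(** The copy arrives reversed, which is the right order for the reversed output in register 1; for
    unary numbers the order is immaterial. *)
Definition pcopy (a b t : nat) : prog :=
  PSeq (PLoop (PCase a PSkip
          (PSeq (PPop a) (PSeq (PPush t true) (PPush b true)))
          (PSeq (PPop a) (PSeq (PPush t false) (PPush b false)))))
       (PMove t a).

Lemma run_seq L c1 c2 s : run L (PSeq c1 c2) s = run L c2 (run L c1 s).
Proof. by []. Qed.

Lemma run_loop L c s : run L (PLoop c) s = iter L (run L c) s.
Proof. by []. Qed.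

Lemma run_case L r c0 c1 c2 s : run L (PCase r c0 c1 c2) s =
  match s r with
  | [::] => run L c0 s | true :: _ => run L c1 s | false :: _ => run L c2 s
  end.
Proof. by []. Qed.

Lemma run_copy L a b t s : uniq [:: a; b; t] -> s t = [::] ->
  size (s a) <= L ->
  run L (pcopy a b t) s = upd s b (catrev (s a) (s b)).
Proof.
move=> uniq_r Et le_L.
have [[[ab at'] bt] [[ba ta] tb]] :
  ((a == b = false) * (a == t = false) * (b == t = false)) *
  ((b == a = false) * (t == a = false) * (t == b = false)).
  rewrite ![b == a]eq_sym ![t == _]eq_sym; move: uniq_r.
  by rewrite /= !inE !negb_or !andbT => /andP[/andP[/negbTE-> /negbTE->] /negbTE->].
have ne := (ab, at', bt, ba, ta, tb, eqxx).
rewrite /pcopy run_seq run_loop; set body := run L (PCase _ _ _ _).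
have loop n w s' : s' a = w -> size w <= n -> iter n body s' =
    upd (upd (upd s' a [::]) t (catrev w (s' t))) b (catrev w (s' b)).
  elim: n w s' => [|n IHn] [|x w] s' Ew //= le_n.
  - by rewrite -{1}Ew !upd_same.
  - rewrite -iterS iter_fix; first by rewrite -{1}Ew !upd_same.
    by rewrite /body /= Ew.
  - rewrite -iterS iterSr.
    have -> : body s' =
        upd (upd (upd s' a w) t (x :: s' t)) b (x :: s' b).
      by rewrite /body run_case Ew; case: x Ew => Ew /=;
        rewrite /upd !ne Ew.
    rewrite (IHn w) //; last by rewrite /upd !ne.
    apply: functional_extensionality => q; rewrite /upd !ne.
    by case: (q == b); case: (q == t); case: (q == a).
rewrite (loop _ _ _ erefl le_L) /= ta Et.
apply: functional_extensionality => q; rewrite /upd !ne.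
have [->|_] := eqVneq q t; first by rewrite !ne Et.
have [->|_] := eqVneq q a; last by case: (q == b).
by rewrite !ne -![catrev _ [::]]/(rev _) revK.
Qed.

Fixpoint ppush (r : nat) (w : seq bool) : prog :=
  if w is b :: w' then PSeq (PPush r b) (ppush r w') else PSkip.

Lemma run_ppush L r w s : run L (ppush r w) s = upd s r (catrev w (s r)).
Proof.
elim: w s => [|b w IHw] s /=; first by rewrite upd_same.
by rewrite IHw upd_eq upd_upd.
Qed.

Fixpoint pemit (l : seq (seq bool + nat)) : prog :=
  match l with
  | [::] => PSkip
  | inl w :: l' => PSeq (ppush 1 w) (pemit l')
  | inr r :: l' => PSeq (pcopy r 1 2) (pemit l')
  end.

Definition item_value (s : store) (i : seq bool + nat) : seq bool :=
  match i with inl w => w | inr r => s r end.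

Lemma run_emit L l s : s 2 = [::] ->
  (forall r, inr r \in l -> r \notin [:: 1; 2] /\ size (s r) <= L) ->
  run L (pemit l) s = upd s 1 (catrev (flatten (map (item_value s) l)) (s 1)).
Proof.
elim: l s => [|[w|r] l IHl] s s2 Hl; first by rewrite /= upd_same.
- rewrite [pemit _]/= run_seq run_ppush IHl //; last first.
    move=> r r_l; have [|nr le] := Hl r; first by rewrite inE r_l orbT.
    by rewrite upd_neq //; move: nr; rewrite !inE negb_or => /andP[].
  rewrite upd_eq upd_upd /= catrev_catl.
  congr (upd _ _ (catrev (flatten _) _)); apply/eq_in_map => -[//|r] r_l.
  have [|nr le] := Hl r; first by rewrite inE r_l orbT.
  by rewrite /= upd_neq //; move: nr; rewrite !inE negb_or => /andP[].
- rewrite [pemit _]/= run_seq.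
  have [|nr le] := Hl r; first by rewrite inE eqxx.
  rewrite run_copy //; last by rewrite /= andbT.
  rewrite IHl //; last first.
    move=> r' r_l; have [|nr' le'] := Hl r'; first by rewrite inE r_l orbT.
    by rewrite upd_neq //; move: nr'; rewrite !inE negb_or => /andP[].
  rewrite upd_eq upd_upd /= catrev_catl.
  congr (upd _ _ (catrev (flatten _) _)); apply/eq_in_map => -[//|r'] r_l.
  have [|nr' le'] := Hl r'; first by rewrite inE r_l orbT.
  by rewrite /= upd_neq //; move: nr'; rewrite !inE negb_or => /andP[].
Qed.

Definition pscan_nat (r : nat) : prog :=
  PSeq (PLoop (PCase 0 PSkip
          (PSeq (PPop 0) (PSeq (PPush 3 true) (PPush r true))) PSkip))
       (PSeq (PPop 0) (PPush 3 false)).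

Lemma run_scan_nat L r i w s : r \notin [:: 0; 3] ->
  s 0 = enc_nat i ++ w -> i <= L ->
  run L (pscan_nat r) s =
    upd (upd (upd s 0 w) 3 (catrev (enc_nat i) (s 3)))
        r (nseq i true ++ s r).
Proof.
rewrite !inE negb_or => /andP[/negbTE r0 /negbTE r3] E0 le_iL.
rewrite /pscan_nat run_seq run_loop; set body := run L (PCase _ _ _ _).
have ne := (r0, r3, eqxx, etrans (eq_sym 0 r) r0, etrans (eq_sym 3 r) r3).
have loop n : i <= n -> iter n body s =
    upd (upd (upd s 0 (false :: w)) 3 (catrev (nseq i true) (s 3)))
        r (nseq i true ++ s r).
  elim: n i {le_iL} s E0 => [|n IHn] [|i] s E0 //= le_n.
  - by rewrite -[false :: w]/(enc_nat 0 ++ w) -E0 !upd_same.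
  - rewrite -iterS iter_fix; last by rewrite /body /= E0.
    by rewrite -[false :: w]/(enc_nat 0 ++ w) -E0 !upd_same.
  - rewrite -iterS iterSr.
    have -> : body s = upd (upd (upd s 0 (enc_nat i ++ w)) 3 (true :: s 3))
                         r (true :: s r).
      by rewrite /body run_case E0 /= /upd !ne E0.
    rewrite (IHn i) //; last by rewrite /upd !ne.
    apply: functional_extensionality => q; rewrite /upd !ne.
    case: (q == r) => //; last by case: (q == 3); case: (q == 0).
    by rewrite nseq_cat_cons.
rewrite {}loop //.
apply: functional_extensionality => q.
rewrite /enc_nat -cats1 catrev_catl /= /upd !ne.
have [->|_] := eqVneq q r; first by rewrite !ne.
by case: (q == 3); case: (q == 0).
Qed.

(** The skipped bits are kept in register 2 and the index in 6, so both can be put back. An index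
    past the end finds [a] empty and reads [false], the default used by [ceval]. *)
Definition pnth (a i r : nat) : prog :=
  PSeq (PLoop
    (let body := PSeq (PPop i) (PSeq (PPush 6 true)
       (PCase a PSkip (PSeq (PPop a) (PPush 2 true))
                      (PSeq (PPop a) (PPush 2 false)))) in
     PCase i PSkip body body))
  (PSeq (PCase a (PPush r false) (PPush r true) (PPush r false))
  (PSeq (PMove 2 a) (PMove 6 i))).

Lemma run_nth L a i r s : uniq [:: a; i; r; 2; 6] ->
  s 2 = [::] -> s 6 = [::] -> s i = nseq (size (s i)) true -> size (s i) <= L ->
  run L (pnth a i r) s = upd s r (nth false (s a) (size (s i)) :: s r).
Proof.
move=> uniq_r E2 E6 Ei le_L.
have ne : ((a == i = false) * (a == r = false) * (a == 2 = false) *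
   (a == 6 = false) * (i == r = false) * (i == 2 = false) * (i == 6 = false) *
   (r == 2 = false) * (r == 6 = false)) *
  ((i == a = false) * (r == a = false) * (2 == a = false) *
   (6 == a = false) * (r == i = false) * (2 == i = false) * (6 == i = false) *
   (2 == r = false) * (6 == r = false)).
  rewrite ![i == a]eq_sym ![r == a]eq_sym ![2 == _]eq_sym ![6 == _]eq_sym.
  rewrite ![r == i]eq_sym.
  move: uniq_r; rewrite /= !inE !negb_or !andbT -!andbA.
  by do ![case/andP=> /negbTE->]; move=> /negbTE->.
rewrite /pnth run_seq run_loop; set body := run L (PCase _ _ _ _).
have loop n k s' : s' i = nseq k true -> k <= n -> iter n body s' =
    upd (upd (upd (upd s' i [::]) 6 (nseq k true ++ s' 6))
             a (drop k (s' a))) 2 (catrev (take k (s' a)) (s' 2)).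
  elim: n k s' => [|n IHn] [|k] s' Ek //= le_n.
  - by rewrite take0 drop0 /= -[[::]]/(nseq 0 true) -Ek !upd_same.
  - rewrite -iterS iter_fix; last by rewrite /body /= Ek.
    by rewrite take0 drop0 /= -[[::]]/(nseq 0 true) -Ek !upd_same.
  - rewrite -iterS iterSr.
    have -> : body s' = upd (upd (upd (upd s' i (nseq k true))
        6 (true :: s' 6)) a (behead (s' a)))
        2 (if s' a is b :: _ then b :: s' 2 else s' 2).
      apply: functional_extensionality => q.
      rewrite /body run_case Ek /= /upd !ne /= Ek /=.
      case Ea: (s' a) => [|[] w]; rewrite /= ?ne ?Ea //=.
      have [->|_] := eqVneq q 2; first by rewrite !ne.
      by have [->|_] := eqVneq q a; first by rewrite !ne Ea.
    rewrite (IHn k) //; last by rewrite /upd !ne eqxx.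
    apply: functional_extensionality => q; rewrite /upd !ne !eqxx /=.
    have [_|_] := eqVneq q 2; first by case: (s' a) => [|b w].
    have [_|_] := eqVneq q a; first by case: (s' a) => [|b w].
    have [_|_] := eqVneq q 6; first by rewrite nseq_cat_cons.
    by case: (q == i).
rewrite (loop _ _ _ Ei le_L) {loop}; set k := size _.
set s1 := upd _ 2 _.
rewrite run_seq.
have -> : run L (PCase a (PPush r false) (PPush r true) (PPush r false)) s1 =
   upd s1 r (nth false (s a) k :: s r).
  rewrite /= -[k in nth _ _ k]addn0 -nth_drop.
  have -> : s1 a = drop k (s a) by rewrite /s1 /upd !ne eqxx.
  have -> : s1 r = s r by rewrite /s1 /upd !ne.
  by case: (drop k (s a)) => [|[] w].
apply: functional_extensionality => q.
rewrite /= !ne /upd /s1 /upd !ne !eqxx /=.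
have [->|_] := eqVneq q r; first by rewrite !ne.
have [->|_] := eqVneq q 6; first by rewrite E6.
have [->|_] := eqVneq q i.
  by rewrite E6 cats0 Ei -/(rev _) rev_nseq.
have [->|_] := eqVneq q 2; first by rewrite E2.
have [->|_] := eqVneq q a; first by rewrite E2 catrevK cat_take_drop.
by [].
Qed.

(** The loop combinators modify registers of their own between two runs of the body; an invariant
    has to be insensitive to these registers. *)
Definition frame (R : seq nat) (I : store -> Prop) : Prop :=
  forall s s' : store, (forall r, r \notin R -> s' r = s r) -> I s -> I s'.

Lemma frame_upd R I r v s : frame R I -> r \in R -> I s -> I (upd s r v).
Proof.
move=> fI r_R; apply: fI => q q_R; rewrite upd_neq //.
by apply: contraNneq q_R => ->.
Qed.

(** Register [a] holds the current index and [ra] what remains. The enclosing loop may run longer: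
    once [ra] is empty it idles. *)
Definition pfor (a ra : nat) (body : prog) : prog :=
  PLoop (PCase ra PSkip (PSeq (PPop ra) (PSeq body (PPush a true))) PSkip).

Lemma run_for L a ra body (I : nat -> store -> Prop) m s : a != ra ->
  (forall i, frame [:: a; ra] (I i)) ->
  (forall i s, i < m -> I i s -> s a = nseq i true ->
     [/\ I i.+1 (run L body s), run L body s a = s a
       & run L body s ra = s ra]) ->
  m <= L -> I 0 s -> s a = [::] -> s ra = nseq m true ->
  [/\ I m (run L (pfor a ra body) s), run L (pfor a ra body) s a = nseq m true
    & run L (pfor a ra body) s ra = [::]].
Proof.
move=> neq fI Ibody le_L I0 sa sra; rewrite /pfor run_loop.
set f := run L (PCase _ _ _ _).
have fE s' : f s' = if s' ra is true :: w then
    let s2 := run L body (upd s' ra w) in upd s2 a (true :: s2 a) else s'.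
  by rewrite /f run_case; case E: (s' ra) => [|[] w] //; rewrite /= E.
have loop n k s' : m <= n + k -> k <= m -> I k s' -> s' a = nseq k true ->
    s' ra = nseq (m - k) true ->
    [/\ I m (iter n f s'), iter n f s' a = nseq m true & iter n f s' ra = [::]].
  elim: n k s' => [|n IHn] k s' le_m le_k Ik Ea Era.
    have Ek : k = m by lia.
    by rewrite /= -Ek Ea Era -Ek subnn.
  rewrite iterSr.
  case Em: (m - k) => [|d].
    have -> : f s' = s' by rewrite fE Era Em.
    by apply: (IHn k) => //; lia.
  pose s2 := upd s' ra (nseq d true).
  have -> : f s' = upd (run L body s2) a (true :: run L body s2 a).
    by rewrite fE Era Em.
  have [|||I2 Ea2 Era2] := Ibody k s2; first lia.
  - by rewrite /s2; apply: (frame_upd _ (fI k)); rewrite ?inE ?eqxx ?orbT.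
  - by rewrite /s2 upd_neq.
  apply: (IHn k.+1); try lia.
  - by apply: (frame_upd _ (fI k.+1)); rewrite ?inE ?eqxx.
  - by rewrite upd_eq Ea2 /s2 upd_neq // Ea.
  - rewrite upd_neq 1?eq_sym // Era2 /s2 upd_eq.
    by congr (nseq _ _); lia.
by apply: (loop L 0 s); rewrite ?addn0 ?subn0.
Qed.

Definition pairs (k m : nat) : seq (nat * nat) :=
  [seq (i, j) | i <- iota 0 k, j <- iota 0 m].

Lemma pairsS k m : pairs k.+1 m = pairs k m ++ [seq (k, j) | j <- iota 0 m].
Proof.
by rewrite /pairs -addn1 iotaD add0n /= allpairs_cat /= cats0.
Qed.

Definition pfor2 (body : prog) : prog :=
  PSeq (pfor 10 11 (PSeq (pfor 12 13 body) (PMove 12 13))) (PMove 10 11).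

Lemma catrev_nseq n (x : bool) : catrev (nseq n x) [::] = nseq n x.
Proof. by rewrite -/(rev _) rev_nseq. Qed.

(** The equation [size l = i * m + j] tells the body how far the enumeration has come; the circuit
    writer uses it to bound its current wire number by the final one. *)
Lemma run_for2 L body (I : seq (nat * nat) -> store -> Prop) m s :
  (forall l, frame [:: 10; 11; 12; 13] (I l)) ->
  (forall l i j s, i < m -> j < m -> size l = i * m + j -> I l s ->
     s 10 = nseq i true -> s 12 = nseq j true ->
     I (rcons l (i, j)) (run L body s) /\
     forall r, r \in [:: 10; 11; 12; 13] -> run L body s r = s r) ->
  m <= L -> I [::] s -> s 10 = [::] -> s 11 = nseq m true ->
  s 12 = [::] -> s 13 = nseq m true ->
  let s' := run L (pfor2 body) s in
  [/\ I (pairs m m) s', s' 10 = [::], s' 11 = nseq m true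
    & s' 12 = [::] /\ s' 13 = nseq m true].
Proof.
move=> fI Ibody le_L I0 s10 s11 s12 s13 s'.
have fW R l : {subset R <= [:: 10; 11; 12; 13]} -> frame R (I l).
  move=> sub s1 s2 E; apply: fI => r r_R; apply: E.
  by apply: contra r_R; apply: sub.
pose J k s := [/\ I (pairs k m) s, s 12 = [::] & s 13 = nseq m true].
have [|||||||[IJ E12 E13] E10 E11] :=
    @run_for L 10 11 (PSeq (pfor 12 13 body) (PMove 12 13)) J m s;
  rewrite ?run_seq //.
- move=> k s1 s2 E [I1 E12 E13]; split; rewrite ?E //.
  by apply: fI I1 => r r_R; apply: E; apply: contra r_R; rewrite !inE;
    case/orP=> ->; rewrite ?orbT.
- move=> i s1 lt_i [I1 E12 E13] E10.
  pose K j s := [/\ I (pairs i m ++ [seq (i, j) | j <- iota 0 j]) s,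
    s 10 = nseq i true & s 11 = s1 11].
  rewrite run_seq.
  have [|||||||[IK K10 K11] K12 K13] := @run_for L 12 13 body K m s1; rewrite //.
  + move=> k s2 s3 E [I2 E10' E11]; split; rewrite ?E //.
    by apply: fI I2 => r r_R; apply: E; apply: contra r_R; rewrite !inE;
      case/orP=> ->; rewrite ?orbT.
  + move=> j s2 lt_j [I2 E10' E11] E12'.
    have sz : size (pairs i m ++ [seq (i, j0) | j0 <- iota 0 j]) = i * m + j.
      by rewrite size_cat size_allpairs size_map !size_iota.
    have [I3 E] := Ibody _ _ _ _ lt_i lt_j sz I2 E10' E12'.
    split; rewrite ?E //; split; rewrite ?E //.
    by rewrite -addn1 iotaD map_cat catA cats1.
  + by split=> //; rewrite /= cats0.
  set s2 := run L _ _ in IK K10 K11 K12 K13 *.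
  rewrite /= K13 K12 catrev_nseq; split; last 2 first.
  + by rewrite E10.
  + by [].
  split=> //; rewrite pairsS.
  by do 2 apply: (frame_upd _ (fI _)) => //.
rewrite /s' /pfor2 run_seq.
set s2 := run L _ s in IJ E12 E13 E10 E11 *.
rewrite /= E11 E10 catrev_nseq; split=> //.
by do 2 apply: (frame_upd _ (fI _)) => //.
Qed.

(** * Reading encoded circuits *)

Definition pread (c1 c0 : prog) : prog :=
  PCase 0 PSkip (PSeq (PPop 0) (PSeq (PPush 3 true) c1))
                (PSeq (PPop 0) (PSeq (PPush 3 false) c0)).

Definition consume (u w : seq bool) (s : store) : store :=
  upd (upd s 0 w) 3 (catrev u (s 3)).

Lemma consume_consume u v w w' s :
  consume v w (consume u w' s) = consume (u ++ v) w s.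
Proof.
apply: functional_extensionality => q; rewrite /consume /upd /= catrev_catl.
by case: (q == 3); case: (q == 0).
Qed.

Lemma run_read L c1 c0 b w s : s 0 = b :: w ->
  run L (pread c1 c0) s = run L (if b then c1 else c0) (consume [:: b] w s).
Proof. by move=> E; rewrite /pread run_case E; case: b E => E /=; rewrite E. Qed.

Lemma run_read1 L c1 c0 w s : s 0 = true :: w ->
  run L (pread c1 c0) s = run L c1 (consume [:: true] w s).
Proof. exact: run_read. Qed.

Lemma run_read0 L c1 c0 w s : s 0 = false :: w ->
  run L (pread c1 c0) s = run L c0 (consume [:: false] w s).
Proof. exact: run_read. Qed.

Lemma run_scan_nat_consume L r i w s : r \notin [:: 0; 3] ->
  s 0 = enc_nat i ++ w -> i <= L ->
  run L (pscan_nat r) s =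
    upd (consume (enc_nat i) w s) r (nseq i true ++ s r).
Proof. by move=> r03 E le_i; rewrite (run_scan_nat r03 E). Qed.

(** [item] also reads the flag [true] in front of its element, so on each round the next input bit
    is a flag; at [false] the loop idles, and the last read consumes that [false]. *)
Definition pscan_list (item : prog) : prog :=
  PSeq (PLoop (PCase 0 PSkip item PSkip)) (pread PSkip PSkip).

Lemma run_scan_list (T : Type) (enc : T -> seq bool) L item
    (I : seq T -> store -> Prop) (P : pred T) ts w s :
  (forall l, frame [:: 0; 3] (I l)) ->
  (forall l a v s, P a -> I l s -> s 0 = true :: enc a ++ v ->
     [/\ I (rcons l a) (run L item s), run L item s 0 = v
       & run L item s 3 = catrev (true :: enc a) (s 3)]) ->
  all P ts -> size ts <= L -> I [::] s -> s 0 = enc_list enc ts ++ w ->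
  [/\ I ts (run L (pscan_list item) s), run L (pscan_list item) s 0 = w
    & run L (pscan_list item) s 3 = catrev (enc_list enc ts) (s 3)].
Proof.
move=> fI Iitem Pts le_L I0 E0; rewrite /pscan_list run_seq run_loop.
set f := run L (PCase 0 PSkip item PSkip).
have loop n l ts' s' : size ts' <= n -> all P ts' -> I l s' ->
    s' 0 = enc_list enc ts' ++ w ->
    [/\ I (l ++ ts') (iter n f s'), iter n f s' 0 = false :: w &
      false :: iter n f s' 3 = catrev (enc_list enc ts') (s' 3)].
  elim: n l ts' s' => [|n IHn] l [|a ts'] s' //= le_n.
  - by move=> _ Il E; rewrite cats0.
  - move=> _ Il E; rewrite -iterS iter_fix ?cats0 //.
    by rewrite /f run_case E.
  - case/andP=> Pa Pts' Il E; rewrite -iterS iterSr.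
    have fE : f s' = run L item s' by rewrite /f run_case E.
    rewrite -catA in E.
    have [I1 E1 E3] := Iitem _ _ _ _ Pa Il E.
    rewrite fE -cat_rcons; have [I2 -> E4] := IHn _ _ _ le_n Pts' I1 E1.
    by split=> //; rewrite E4 E3 /= catrev_catl.
have [I1 E1 E3] := loop L [::] ts s le_L Pts I0 E0.
rewrite (run_read _ _ _ E1) /= /consume; split.
- by do 2 apply: (frame_upd _ (fI _)) => //.
- by [].
- by rewrite upd_eq.
Qed.

(** Wire indices are data and cannot occur in a program. A handler is selected by one of five
    representatives with the indices erased, and finds the actual indices in registers 4 and 5. *)
Definition gate_kind (g : gate) : gate :=
  match g with
  | GConst b => GConst b
  | GNot _ => GNot 0
  | GAnd _ _ => GAnd 0 0
  | GOr _ _ => GOr 0 0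
  end.

(** A decision tree on the list flag followed by the unary tag 0, 1, 2 or 3 of the gate; [PSkip]
    marks the prefixes that no encoded gate has. *)
Definition pgate (h : gate -> prog) : prog :=
  let scan2 := PSeq (pscan_nat 4) (pscan_nat 5) in
  PSeq
  (pread
    (pread
      (pread
        (pread (pread PSkip (PSeq scan2 (h (GOr 0 0))))
               (PSeq scan2 (h (GAnd 0 0))))
        (PSeq (pscan_nat 4) (h (GNot 0))))
      (pread (h (GConst true)) (h (GConst false))))
    PSkip)
  (PSeq (pclear 4) (pclear 5)).

Definition gate_arg (k : nat) (g : gate) : seq bool :=
  nseq (nth 0 (gate_wires g) k) true.

Definition bounded_gate (L : nat) (g : gate) : bool :=
  all (fun i => i <= L) (gate_wires g).

Lemma run_gate L h g v s : s 0 = true :: enc_gate g ++ v ->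
  s 4 = [::] -> s 5 = [::] -> bounded_gate L g ->
  run L (pgate h) s = run L (PSeq (pclear 4) (pclear 5))
    (run L (h (gate_kind g))
      (upd (upd (consume (true :: enc_gate g) v s) 4 (gate_arg 0 g))
           5 (gate_arg 1 g))).
Proof.
move=> E0 E4 E5 le_g; rewrite /pgate run_seq; congr (run L _ _).
rewrite (run_read1 _ _ _ E0).
case: g E0 le_g => [b|i|i j|i j] E0 le_g; rewrite [gate_kind _]/=.
- erewrite run_read0; last reflexivity.
  erewrite run_read; last reflexivity.
  rewrite !consume_consume.
  have -> : upd (upd (consume (true :: enc_gate (GConst b)) v s) 4 [::]) 5 [::] =
            consume [:: true; false; b] v s.
    apply: functional_extensionality => q; rewrite /consume /upd.
    by case: (q =P 5) => [->|_] //; case: (q =P 4) => [->|_].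
  by case: b {E0 le_g}.
- erewrite run_read1; last reflexivity.
  erewrite run_read0; last reflexivity.
  rewrite !consume_consume run_seq.
  case/andP: le_g => le_i _.
  erewrite run_scan_nat_consume; [|by []|reflexivity|by []].
  rewrite consume_consume; congr (run L _ _).
  apply: functional_extensionality => q; rewrite /consume /upd /= E4 cats0.
  by case: (q =P 5) => [->|_]; rewrite ?E5.
- erewrite run_read1; last reflexivity.
  erewrite run_read1; last reflexivity.
  erewrite run_read0; last reflexivity.
  rewrite !consume_consume 2!run_seq.
  case/and3P: le_g => le_i le_j _.
  rewrite (@run_scan_nat_consume L 4 i (enc_nat j ++ v)) //; last first.
    exact: esym (catA _ _ _).
  rewrite (@run_scan_nat_consume L 5 j v) //; congr (run L _ _).
  apply: functional_extensionality => q; rewrite /consume /upd /= E4 E5 !cats0.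
  rewrite !catrev_catl; case: (q =P 5) => // _; case: (q =P 3) => [->|_] //.
  by case: (q =P 0) => [->|_] //; case: (q =P 4).
- erewrite run_read1; last reflexivity.
  erewrite run_read1; last reflexivity.
  erewrite run_read1; last reflexivity.
  erewrite run_read0; last reflexivity.
  rewrite !consume_consume 2!run_seq.
  case/and3P: le_g => le_i le_j _.
  rewrite (@run_scan_nat_consume L 4 i (enc_nat j ++ v)) //; last first.
    exact: esym (catA _ _ _).
  rewrite (@run_scan_nat_consume L 5 j v) //; congr (run L _ _).
  apply: functional_extensionality => q; rewrite /consume /upd /= E4 E5 !cats0.
  rewrite !catrev_catl; case: (q =P 5) => // _; case: (q =P 3) => [->|_] //.
  by case: (q =P 0) => [->|_] //; case: (q =P 4).
Qed.

Lemma run_clear45 L s : size (s 4) <= L -> size (s 5) <= L ->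
  run L (PSeq (pclear 4) (pclear 5)) s = upd (upd s 4 [::]) 5 [::].
Proof. by move=> le4 le5; rewrite run_seq !run_clear. Qed.

Definition pgates (h : gate -> prog) : prog := pscan_list (pgate h).

Lemma run_gates L h (I : seq gate -> store -> Prop) gs w s :
  (forall l, frame [:: 0; 3; 4; 5] (I l)) ->
  (forall l g s, bounded_gate L g -> I l s ->
     s 4 = gate_arg 0 g -> s 5 = gate_arg 1 g ->
     let s' := run L (h (gate_kind g)) s in
     I (rcons l g) s' /\ forall r, r \in [:: 0; 3; 4; 5] -> s' r = s r) ->
  all (bounded_gate L) gs -> size gs <= L -> I [::] s ->
  s 0 = enc_list enc_gate gs ++ w -> s 4 = [::] -> s 5 = [::] ->
  let s' := run L (pgates h) s in
  [/\ I gs s', s' 0 = w, s' 3 = catrev (enc_list enc_gate gs) (s 3)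
    & s' 4 = [::] /\ s' 5 = [::]].
Proof.
move=> fI Ih bnd le_L I0 E0 E4 E5 s'.
pose J l s := [/\ I l s, s 4 = [::] & s 5 = [::]].
rewrite /s' /pgates.
have [|||[I1 E14 E15] -> ->] // :=
  run_scan_list (item := pgate h) (I := J) _ _ bnd le_L _ E0.
- move=> l s1 s2 E [I1 E14 E15]; split; rewrite ?E //.
  apply: fI I1 => r r_R; apply: E; apply: contra r_R; rewrite !inE.
  by case/orP=> ->; rewrite ?orbT.
- move=> l g v s1 bg [I1 E14 E15] E10; rewrite (run_gate _ E10 E14 E15 bg).
  set s2 := upd (upd _ _ _) _ _.
  have I2 : I l s2 by do 4 apply: (frame_upd _ (fI _)) => //.
  have [I3 E] := Ih _ _ _ bg I2 erefl erefl.
  have le k : size (gate_arg k g) <= L.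
    rewrite size_nseq; have [lt_k|le_k] := ltnP k (size (gate_wires g)).
      by move/(all_nthP 0): bg; apply.
    by rewrite nth_default.
  rewrite run_clear45 ?E //; try exact: le.
  split.
  + split; first by do 2 apply: (frame_upd _ (fI _)) => //.
    by []. by [].
  + by rewrite /upd /= E.
  + by rewrite /upd /= E.
Qed.

Definition pouts (h : prog) : prog :=
  pscan_list (pread (PSeq (pscan_nat 4) (PSeq h (pclear 4))) PSkip).

Lemma run_outs L h (I : seq nat -> store -> Prop) os w s :
  (forall l, frame [:: 0; 3; 4] (I l)) ->
  (forall l o s, o <= L -> I l s -> s 4 = nseq o true ->
     let s' := run L h s in
     I (rcons l o) s' /\ forall r, r \in [:: 0; 3; 4] -> s' r = s r) ->
  all (fun o => o <= L) os -> size os <= L -> I [::] s ->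
  s 0 = enc_list enc_nat os ++ w -> s 4 = [::] ->
  let s' := run L (pouts h) s in
  [/\ I os s', s' 0 = w, s' 3 = catrev (enc_list enc_nat os) (s 3)
    & s' 4 = [::]].
Proof.
move=> fI Ih bnd le_L I0 E0 E4 s'.
pose J l s := I l s /\ s 4 = [::].
rewrite /s' /pouts; set item := pread _ _.
have [|||[I1 E14] -> ->] // :=
  run_scan_list (item := item) (I := J) _ _ bnd le_L _ E0.
- move=> l s1 s2 E [I1 E14]; split; rewrite ?E //.
  apply: fI I1 => r r_R; apply: E; apply: contra r_R; rewrite !inE.
  by case/orP=> ->; rewrite ?orbT.
- move=> l o v s1 le_o [I1 E14] E10; rewrite (run_read1 _ _ _ E10) 2!run_seq.
  erewrite run_scan_nat_consume; [|by []|reflexivity|by []].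
  rewrite consume_consume; set s2 := upd _ _ _.
  have I2 : I l s2 by do 3 apply: (frame_upd _ (fI _)) => //.
  have E2 : s2 4 = nseq o true by rewrite /s2 upd_eq /consume /upd /= E14 cats0.
  have [I3 E] := Ih _ _ _ le_o I2 E2.
  rewrite run_clear ?E ?E2 ?size_nseq //; split.
  + by split=> //; apply: (frame_upd _ (fI _)).
  + by rewrite /upd /= E.
  + by rewrite /upd /= E.
Qed.

(** * The hash circuit and the program that writes it *)

Definition shift_gate (B : nat) (g : gate) : gate :=
  match g with
  | GConst b => GConst b
  | GNot i => GNot (B + i)
  | GAnd i j => GAnd (B + i) (B + j)
  | GOr i j => GOr (B + i) (B + j)
  end.

(* [W] is the number of wires before these gates; the last one computes
   (x_i and not y_j) or (y_i and not x_j). *)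
Definition mix_gates (n i j W : nat) : seq gate :=
  [:: GNot (n + n + j); GNot j; GAnd i W; GAnd (n + n + i) W.+1;
      GOr W.+2 W.+3].

(** An [and] of a wire with itself is the identity; it brings the outputs of C, which may be
    scattered, onto consecutive wires. *)
Definition copy_gates (B : nat) (os : seq nat) : seq gate :=
  [seq GAnd (B + o) (B + o) | o <- os].

(** The state u occupies the n wires from [B] on. The last mixing gate is q_ij and the copied
    outputs follow at once, so the next state q_ij C(u) again lies on n consecutive wires, where a
    shifted copy of C expects its input. *)
Definition block (n : nat) (C : circuit) (B : nat) (p : nat * nat) : seq gate :=
  map (shift_gate B) (gates C) ++ mix_gates n p.1 p.2 (B + n + size (gates C))
    ++ copy_gates B (outputs C).

(** The distance between consecutive bases: the old state, the gates of C, and four of the five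
    mixing gates, the fifth being the first wire of the new state. *)
Definition block_size (n : nat) (C : circuit) : nat := n + size (gates C) + 4.

Fixpoint blocks (n : nat) (C : circuit) (B : nat) (l : seq (nat * nat)) :
    seq gate :=
  if l is p :: l' then
    block n C B p ++ blocks n C (B + block_size n C) l'
  else [::].

Definition last_base (n : nat) (C : circuit) : nat :=
  n + n + (n + n) + size (pairs (n + n) (n + n)) * block_size n C.

(** The constant gates form the initial state 0^n. The first of them, wire 4n, is also the leading
    output bit 0. *)
Definition hash_circuit (n : nat) (C : circuit) : circuit :=
  let B := last_base n C in
  Circuit (nseq n (GConst false)
             ++ blocks n C (n + n + (n + n)) (pairs (n + n) (n + n))
             ++ map (shift_gate B) (gates C))
          (n + n + (n + n) :: [seq B + o | o <- outputs C]).

Definition repeat_bits (n : nat) (w : seq bool) : seq bool :=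
  flatten (nseq n w).

Definition hash_instance (I : wp_instance) : ws_instance :=
  let n := wp_n I in
  WSInstance n (hash_circuit n (wp_C I)) (repeat_bits n [:: false; false])
    (repeat_bits n [:: true; true]) (repeat_bits n [:: true; false]).

(** * Printing the encoded hash instance *)

Definition emit_gate (k : gate) : prog :=
  PSeq (pemit (match k with
    | GConst b => [:: inl [:: true; false; b]]
    | GNot _ =>
        [:: inl [:: true; true; false]; inr 8; inr 4; inl [:: false]]
    | GAnd _ _ => [:: inl [:: true; true; true; false];
        inr 8; inr 4; inl [:: false]; inr 8; inr 5; inl [:: false]]
    | GOr _ _ => [:: inl [:: true; true; true; true; false];
        inr 8; inr 4; inl [:: false]; inr 8; inr 5; inl [:: false]]
    end)) (PPush 9 true).

Lemma enc_natE a : enc_nat a = nseq a true ++ [:: false].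
Proof. by rewrite /enc_nat -cats1. Qed.

Lemma enc_listE (T : Type) (enc : T -> seq bool) ts :
  enc_list enc ts = flatten [seq true :: enc t | t <- ts] ++ [:: false].
Proof. by elim: ts => //= t ts ->; rewrite catA. Qed.

(** In unary, addition is concatenation: printing the base in register 8 just before the index in
    register 4 or 5 writes the shifted index. *)
Lemma run_emit_gate L g B s : s 2 = [::] -> s 8 = nseq B true -> B <= L ->
  bounded_gate L g -> s 4 = gate_arg 0 g -> s 5 = gate_arg 1 g ->
  run L (emit_gate (gate_kind g)) s =
  upd (upd s 1 (catrev (true :: enc_gate (shift_gate B g)) (s 1)))
      9 (true :: s 9).
Proof.
move=> E2 E8 le_B le_g E4 E5; rewrite /emit_gate run_seq.
have le4 : size (s 4) <= L.
  by rewrite E4; case: g le_g {E4 E5} => //= [i|i j|i j] /andP[le_i _];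
    rewrite size_nseq.
have le5 : size (s 5) <= L.
  rewrite E5; case: g le_g {E4 E5 le4} => //= [i j|i j] /and3P[_ le_i _];
    by rewrite size_nseq.
rewrite run_emit //.
  set w := flatten _; have -> : w = true :: enc_gate (shift_gate B g).
    rewrite /w; case: g le_g E4 E5 {le4 le5 w} => [b|i|i j|i j] _ E4 E5 //=;
    by rewrite E8 E4 ?E5 !enc_natE !nseqD /= -?catA.
  by [].
move=> r Hr; suff : r \in [:: 8; 4; 5].
  rewrite !inE => /or3P[] /eqP->; split=> //; by rewrite E8 size_nseq.
by case: g Hr {le_g E4 E5} => [b|i|i j|i j] /=; rewrite !inE /=;
  do ?[case/orP]; do ?[move/eqP=> [->]] => //.
Qed.

Definition prepeat (r : nat) (w : seq bool) : prog :=
  PSeq (PLoop (let b := PSeq (PPop 7) (PSeq (PPush 2 true) (ppush r w)) in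
               PCase 7 PSkip b b))
       (PMove 2 7).

Lemma run_repeat L n r w s : r \notin [:: 2; 7] ->
  s 7 = nseq n true -> s 2 = [::] -> n <= L ->
  run L (prepeat r w) s = upd s r (catrev (repeat_bits n w) (s r)).
Proof.
rewrite !inE negb_or => /andP[/negbTE r2 /negbTE r7] E7 E2 le_n.
have ne := (r2, r7, etrans (eq_sym 2 r) r2, etrans (eq_sym 7 r) r7, eqxx).
rewrite /prepeat run_seq run_loop; set f := run L (PCase _ _ _ _).
have loop k m s' : s' 7 = nseq m true -> m <= k -> iter k f s' =
    upd (upd (upd s' 7 [::]) 2 (nseq m true ++ s' 2))
        r (catrev (repeat_bits m w) (s' r)).
  elim: k m s' => [|k IHk] [|m] s' Em //= le_m.
  - by rewrite -[[::]]/(nseq 0 true) -Em !upd_same.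
  - rewrite -iterS iter_fix; last by rewrite /f /= Em.
    by rewrite -[[::]]/(nseq 0 true) -Em !upd_same.
  - rewrite -iterS iterSr.
    have -> : f s' = upd (upd (upd s' 7 (nseq m true)) 2 (true :: s' 2))
                         r (catrev w (s' r)).
      by rewrite /f run_case Em run_seq /= run_ppush /upd /= Em !ne.
    rewrite (IHk m) //; last by rewrite /upd !ne.
    apply: functional_extensionality => q.
    rewrite /upd /= !ne /= catrev_catl nseq_cat_cons.
    by case: (q == r); case: (q == 2); case: (q == 7).
rewrite (loop _ _ _ E7 le_n) /= upd_neq ?upd_eq ?E2 ?cats0 ?(eq_sym 2) ?r2 //.
rewrite upd_neq ?[upd _ 2 _ 7]upd_neq ?upd_eq ?(eq_sym 7) ?r7 // catrev_nseq.
apply: functional_extensionality => q; rewrite /upd.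
case: (q =P 7) => [->|_]; first by rewrite !ne.
by case: (q =P 2) => [->|_]; first by rewrite !ne.
Qed.

(** Register 9 holds W; additional [true]s in front of a closing [false] turn it into W+1, W+2 or
    W+3. Register 7 printed twice is the offset 2n of the second string. *)
Definition emit_mix : prog :=
  pemit [:: inl [:: true; true; false]; inr 7; inr 7; inr 12; inl [:: false];
    inl [:: true; true; false]; inr 12; inl [:: false];
    inl [:: true; true; true; false]; inr 10; inl [:: false];
      inr 9; inl [:: false];
    inl [:: true; true; true; false]; inr 7; inr 7; inr 10; inl [:: false];
      inr 9; inl [:: true; false];
    inl [:: true; true; true; true; false]; inr 9; inl [:: true; true; false];
      inr 9; inl [:: true; true; true; false]].

Definition emit_copy : prog :=
  pemit [:: inl [:: true; true; true; false];
    inr 8; inr 4; inl [:: false]; inr 8; inr 4; inl [:: false]].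

(** Register 9 counts wires: it starts at B + n, each gate of C adds one, and the four extra ticks
    give the next base, which replaces register 8. Moving 3 to 0 rewinds the text of C for the next
    block. *)
Definition emit_block : prog :=
  PSeq (pcopy 8 9 2) (PSeq (pcopy 7 9 2) (PSeq (pgates emit_gate)
  (PSeq emit_mix (PSeq (pouts emit_copy) (PSeq (PMove 3 0)
  (PSeq (ppush 9 [:: true; true; true; true]) (PSeq (pclear 8)
  (PMove 9 8)))))))).

Definition enc_gates (gs : seq gate) : seq bool :=
  flatten [seq true :: enc_gate g | g <- gs].

Definition gen_state (n : nat) (C : circuit) (gl : seq gate) (B : nat)
    (s : store) : Prop :=
  [/\ s 0 = enc_circuit C, s 1 = catrev (enc_nat n ++ enc_gates gl) [::],
      [/\ s 2 = [::], s 3 = [::], s 4 = [::] & s 5 = [::]]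
    & [/\ s 7 = nseq n true, s 8 = nseq B true & s 9 = [::]]].

Lemma enc_gates_cat gs gs' :
  enc_gates (gs ++ gs') = enc_gates gs ++ enc_gates gs'.
Proof. by rewrite /enc_gates map_cat flatten_cat. Qed.

Definition bounded_circuit (L : nat) (C : circuit) : Prop :=
  [/\ all (bounded_gate L) (gates C), size (gates C) <= L,
      all (fun o => o <= L) (outputs C) & size (outputs C) <= L].

Lemma run_emit_gates L C B W s w : bounded_circuit L C -> B <= L ->
  s 0 = enc_circuit C ++ w -> s 2 = [::] -> s 4 = [::] -> s 5 = [::] ->
  s 8 = nseq B true -> s 9 = nseq W true ->
  let s' := run L (pgates emit_gate) s in
  [/\ s' 0 = enc_list enc_nat (outputs C) ++ w,
      s' 1 = catrev (enc_gates (map (shift_gate B) (gates C))) (s 1),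
      s' 3 = catrev (enc_list enc_gate (gates C)) (s 3),
      s' 9 = nseq (W + size (gates C)) true
    & forall r, r \in [:: 2; 4; 5; 7; 8; 10; 11; 12; 13] -> s' r = s r].
Proof.
case=> bg sg bo so le_B E0 E2 E4 E5 E8 E9 s'.
pose I l (s' : store) :=
  [/\ s' 1 = catrev (enc_gates (map (shift_gate B) l)) (s 1),
      s' 9 = nseq (size l + W) true
    & forall r, r \in [:: 2; 7; 8; 10; 11; 12; 13] -> s' r = s r].
have fI l : frame [:: 0; 3; 4; 5] (I l).
  move=> s1 s2 E [I1 I9 Ir]; split; rewrite ?E // => r r_R.
  rewrite E ?Ir //; by move: r_R; rewrite !inE; do ?[case/orP]; move/eqP->.
have Ih l g s1 : bounded_gate L g -> I l s1 ->
    s1 4 = gate_arg 0 g -> s1 5 = gate_arg 1 g ->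
    let s2 := run L (emit_gate (gate_kind g)) s1 in
    I (rcons l g) s2 /\ forall r, r \in [:: 0; 3; 4; 5] -> s2 r = s1 r.
  move=> le_g [I1 I9 Ir] E14 E15.
  rewrite (run_emit_gate (etrans (Ir 2 isT) E2) (etrans (Ir 8 isT) E8) le_B
    le_g E14 E15); split; last first.
    by move=> r; rewrite !inE; do ?[case/orP]; move/eqP->.
  split=> //.
  + by rewrite /upd /= I1 map_rcons -cats1 enc_gates_cat catrev_catl
      /enc_gates /= cats0.
  + by rewrite /upd /= I9 size_rcons.
  + by move=> r r_R; rewrite /upd -(Ir r r_R); move: r_R; rewrite !inE;
      do ?[case/orP]; move/eqP->.
have I0 : I [::] s by split.
have E0' : s 0 = enc_list enc_gate (gates C) ++ enc_list enc_nat (outputs C) ++ w.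
  by rewrite E0 /enc_circuit -catA.
have [[I1 I9 Ir] {}I0 I3 [I4 I5]] := run_gates fI Ih bg sg I0 E0' E4 E5.
rewrite /s'; split; rewrite // 1?addnC //.
move=> r; rewrite !inE; do ?[case/orP]; move/eqP->; rewrite ?I4 ?I5 ?E4 ?E5 //;
exact: Ir.
Qed.

(** Stated for arbitrary items because the outputs of C are traversed for two purposes: to print the
    copying gates of a block, and to print the outputs of the final circuit. *)
Lemma run_emit_outs L items (val : nat -> seq bool) B C s w :
  bounded_circuit L C -> B <= L ->
  (forall r, inr r \in items -> r \in [:: 4; 8]) ->
  (forall s o, s 4 = nseq o true -> s 8 = nseq B true ->
     flatten (map (item_value s) items) = val o) ->
  s 0 = enc_list enc_nat (outputs C) ++ w -> s 2 = [::] -> s 4 = [::] ->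
  s 8 = nseq B true ->
  let s' := run L (pouts (pemit items)) s in
  [/\ s' 0 = w, s' 1 = catrev (flatten (map val (outputs C))) (s 1),
      s' 3 = catrev (enc_list enc_nat (outputs C)) (s 3)
    & forall r, r \in [:: 2; 4; 5; 7; 8; 9; 10; 11; 12; 13] -> s' r = s r].
Proof.
case=> bg sg bo so le_B items_reg valP E0 E2 E4 E8 s'.
pose I l (s' : store) :=
  s' 1 = catrev (flatten (map val l)) (s 1) /\
  forall r, r \in [:: 2; 5; 7; 8; 9; 10; 11; 12; 13] -> s' r = s r.
have fI l : frame [:: 0; 3; 4] (I l).
  move=> s1 s2 E [I1 Ir]; split; rewrite ?E // => r r_R.
  rewrite E ?Ir //; by move: r_R; rewrite !inE; do ?[case/orP]; move/eqP->.
have Ih l o s1 : o <= L -> I l s1 -> s1 4 = nseq o true ->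
    let s2 := run L (pemit items) s1 in
    I (rcons l o) s2 /\ forall r, r \in [:: 0; 3; 4] -> s2 r = s1 r.
  move=> le_o [I1 Ir] E14.
  rewrite run_emit; last 2 first.
    by rewrite Ir.
    move=> r /items_reg; rewrite !inE => /orP[] /eqP->; split=> //.
      by rewrite E14 size_nseq.
    by rewrite Ir // E8 size_nseq.
  rewrite (valP _ o E14 (etrans (Ir 8 isT) E8)); split; last first.
    by move=> r; rewrite !inE; do ?[case/orP]; move/eqP->.
  split; first by rewrite upd_eq I1 map_rcons -cats1 flatten_cat catrev_catl
    /= cats0.
  by move=> r r_R; rewrite -(Ir r r_R) upd_neq //; move: r_R; rewrite !inE;
      do ?[case/orP]; move/eqP->.
have I0 : I [::] s by split.
have [[I1 Ir] {}I0 I3 I4] := run_outs fI Ih bo so I0 E0 E4.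
rewrite /s'; split=> // r; rewrite !inE; do ?[case/orP]; move/eqP->;
rewrite ?I4 ?E4 //; exact: Ir.
Qed.

Lemma run_emit_block L n C B gl i j s : bounded_circuit L C ->
  i < n + n -> j < n + n -> n + n + B + block_size n C <= L ->
  gen_state n C gl B s -> s 10 = nseq i true -> s 12 = nseq j true ->
  gen_state n C (gl ++ block n C B (i, j)) (B + block_size n C)
    (run L emit_block s) /\
  forall r, r \in [:: 10; 11; 12; 13] -> run L emit_block s r = s r.
Proof.
move=> bC lt_i lt_j; rewrite /block_size => le_L.
case=> E0 E1 [E2 E3 E4 E5] [E7 E8 E9] E10 E12.
rewrite /emit_block run_seq run_copy ?E8 ?size_nseq //; last by lia.
rewrite E9 catrev_nseq run_seq.
have -> : run L (pcopy 7 9 2) (upd s 9 (nseq B true)) =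
          upd s 9 (nseq (B + n) true).
  rewrite run_copy //; last by rewrite /upd /= E7 size_nseq; lia.
  rewrite upd_upd /upd /= E7; apply: functional_extensionality => q.
  by rewrite catrevE rev_nseq -nseqD addnC.
set s1 := upd _ _ _; rewrite run_seq.
have le_B : B <= L by lia.
have F0 : s1 0 = enc_circuit C ++ [::] by rewrite cats0.
have [] := run_emit_gates bC le_B F0 E2 E4 E5 E8 (erefl : s1 9 = _).
set s2 := run L _ s1 => G0 G1 G3 G9 Gr.
rewrite run_seq run_emit; last 2 first.
- by rewrite Gr.
- case: bC => _ le_gs _ _ r; rewrite !inE /=.
  do ?[case/orP]; do ?[move=> //]; move/eqP => -[->]; split=> //;
  rewrite ?G9 ?Gr // /s1 /upd /= ?E7 ?E10 ?E12 size_nseq; lia.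
have V7 : s2 7 = nseq n true by rewrite Gr.
have V10 : s2 10 = nseq i true by rewrite Gr.
have V12 : s2 12 = nseq j true by rewrite Gr.
rewrite [flatten _](_ : _ = enc_gates (mix_gates n i j (B + n + size (gates C))));
  last first.
  rewrite /= V7 V10 V12 G9 /enc_gates /mix_gates.
  move: (B + n + size (gates C)) => W.
  rewrite -(addn3 W) -(addn2 W) -(addn1 W) /= !enc_natE !nseqD.
  by do ?rewrite -!catA /=.
set s3 := upd _ _ _; rewrite run_seq.
have items_reg r : inr r \in [:: inl [:: true; true; true; false];
    inr 8; inr 4; inl [:: false]; inr 8; inr 4; inl [:: false]] ->
    r \in [:: 4; 8].
  by rewrite !inE /=; do ?[case/orP]; do ?[move=> //]; move/eqP => -[->].
pose val o := true :: enc_gate (GAnd (B + o) (B + o)).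
have [|||||H0 H1 H3 Hr] := @run_emit_outs L _ val B C s3 [::] bC le_B items_reg.
- move=> s' o F4 F8; rewrite /= F4 F8 /val /= !enc_natE !nseqD.
  by do ?rewrite -!catA /=.
- by rewrite cats0 -[s3 0]/(s2 0) G0 cats0.
- by rewrite -[s3 2]/(s2 2) Gr.
- by rewrite -[s3 4]/(s2 4) Gr.
- by rewrite -[s3 8]/(s2 8) Gr.
rewrite -/emit_copy in H0 H1 H3 Hr; set s4 := run L _ s3 in H0 H1 H3 Hr *.
rewrite run_seq [run L (PMove 3 0) s4]/= H0.
have -> : s4 3 = catrev (enc_circuit C) [::].
  by rewrite H3 -[s3 3]/(s2 3) G3 -[s1 3]/(s 3) E3 -catrev_catl.
rewrite catrevK cats0 run_seq run_ppush run_seq.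
set s5 := upd _ 9 _; rewrite run_clear; last first.
  by rewrite -[s5 8]/(s4 8) Hr // -[s3 8]/(s2 8) Gr // -[s1 8]/(s 8) E8 size_nseq.
have V r : r \in [:: 2; 4; 5; 7; 8; 10; 11; 12; 13] -> s4 r = s r.
  move=> r_R; have neq1 : r != 1 by apply: contraTneq r_R => ->.
  have neq9 : r != 9 by apply: contraTneq r_R => ->.
  rewrite Hr; last by move: r_R; rewrite !inE; do ?[case/orP]; move/eqP->.
  by rewrite /s3 upd_neq // Gr // /s1 upd_neq.
have V9 : s4 9 = nseq (B + n + size (gates C)) true by rewrite Hr.
split; last first.
  by move=> r; rewrite !inE; do ?[case/orP]; move/eqP->;
    rewrite /= /s5 /upd /=; apply: V.
rewrite /= /s5 /upd /=; split=> //.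
- rewrite -[LHS]/(s4 1) H1 -[s3 1]/(catrev _ (s2 1)) G1 -[s1 1]/(s 1) E1.
  rewrite -!catrev_catl /block !enc_gates_cat -!catA /copy_gates.
  by rewrite [enc_gates (map _ (outputs C))]/enc_gates -map_comp.
- by split; rewrite /= ?V.
- split=> //; first by rewrite /= V.
  rewrite -[LHS]/(catrev (nseq 4 true ++ s4 9) [::]) V9 -nseqD catrev_nseq.
  by congr (nseq _ _); lia.
Qed.

Definition pseqs (l : seq prog) : prog := foldr PSeq PSkip l.

Lemma run_seqs L c l s : run L (pseqs (c :: l)) s = run L (pseqs l) (run L c s).
Proof. by []. Qed.

Lemma run_seqs_cat L l l' s :
  run L (pseqs (l ++ l')) s = run L (pseqs l') (run L (pseqs l) s).
Proof. by elim: l s => //= c l IHl s; rewrite IHl. Qed.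

(** Register 3 is cleared once n is read, so that later rewinds restore the circuit alone. The
    copies of n set the first base, 4n, in register 8 and the loop length 2n in registers 11 and
    13. *)
Definition hash_prefix : seq prog :=
  [:: pscan_nat 7; pclear 3; pemit [:: inr 7; inl [:: false]];
    prepeat 1 [:: true; false; false];
    pcopy 7 8 2; pcopy 7 8 2; pcopy 7 8 2; pcopy 7 8 2;
    pcopy 7 11 2; pcopy 7 11 2; pcopy 7 13 2; pcopy 7 13 2].

Definition emit_out : prog := pemit [:: inl [:: true]; inr 8; inr 4; inl [:: false]].

(** The literal [[:: false; true]] closes the list of gates and opens the first output, whose number
    4n is register 7 printed four times. In the repeated words the first and third bits are the
    flags of [enc_bits]. *)
Definition hash_suffix : seq prog :=
  [:: pgates emit_gate;
    pemit [:: inl [:: false; true]; inr 7; inr 7; inr 7; inr 7; inl [:: false]];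
    pouts emit_out; pemit [:: inl [:: false]];
    prepeat 1 [:: true; false; true; false]; pemit [:: inl [:: false]];
    prepeat 1 [:: true; true; true; true]; pemit [:: inl [:: false]];
    prepeat 1 [:: true; true; true; false]; pemit [:: inl [:: false]]].

Definition hash_prog : prog :=
  pseqs (hash_prefix ++ pfor2 emit_block :: hash_suffix).

Lemma enc_gates_const n b :
  enc_gates (nseq n (GConst b)) = repeat_bits n [:: true; false; b].
Proof. by rewrite /enc_gates map_nseq. Qed.

Lemma enc_bits_repeat n b b' :
  enc_bits (repeat_bits n [:: b; b']) =
  repeat_bits n [:: true; b; true; b'] ++ [:: false].
Proof.
by rewrite /enc_bits /repeat_bits; elim: n => //= n ->.
Qed.

#[local] Arguments run : simpl never.

Lemma run_hash_prefix L n C w : enc_nat n ++ enc_circuit C = w ->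
  n < L ->
  let s := run L (pseqs hash_prefix) (input_store w) in
  [/\ gen_state n C (nseq n (GConst false)) (n + n + (n + n)) s,
      s 10 = [::], s 11 = nseq (n + n) true, s 12 = [::]
    & s 13 = nseq (n + n) true].
Proof.
move=> Ew le_n; rewrite /hash_prefix run_seqs.
rewrite (run_scan_nat (i := n) (w := enc_circuit C)) //; last exact: ltnW.
rewrite run_seqs run_clear; last first.
  by rewrite /upd /= catrevE cats0 size_rev size_rcons size_nseq.
set s1 := upd _ 3 _.
have E7 : s1 7 = nseq n true by rewrite /s1 /upd /= cats0.
have E r : r \notin [:: 0; 7] -> s1 r = [::].
  rewrite !inE negb_or /s1 /upd /input_store => /andP[/negbTE-> /negbTE->].
  by case: eqP.
have E0 : s1 0 = enc_circuit C by [].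
move: s1 E7 E E0 => s1 E7 E E0.
rewrite run_seqs run_emit ?E //; last first.
  move=> r; rewrite !inE /=; do ?[case/orP]; do ?[move=> //].
  by move/eqP => -[->]; rewrite E7 size_nseq (ltnW le_n).
have F7 v : upd s1 1 v 7 = nseq n true by [].
have F2 v : upd s1 1 v 2 = [::] by rewrite upd_neq // E.
rewrite run_seqs (run_repeat (r := 1) _ isT (F7 _) (F2 _) (ltnW le_n)).
rewrite upd_upd upd_eq -catrev_catl; set o := catrev _ [::].
pose K a b d := upd (upd (upd (upd s1 1 o) 8 (nseq a true)) 11 (nseq b true))
                    13 (nseq d true).
have -> : upd s1 1 o = K 0 0 0.
  apply: functional_extensionality => q; rewrite /K /upd.
  case: (q =P 13) => [->|_]; first by rewrite E.
  case: (q =P 11) => [->|_]; first by rewrite E.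
  by case: (q =P 8) => [->|_]; first by rewrite E.
have cn a : catrev (nseq n true) (nseq a true) = nseq (n + a) true.
  by rewrite catrevE rev_nseq nseqD.
have K7 a b d : K a b d 7 = nseq n true by [].
have K2 a b d : K a b d 2 = [::] by rewrite -(E 2).
have le7 a b d : size (K a b d 7) <= L by rewrite K7 size_nseq ltnW.
have st8 a b d : run L (pcopy 7 8 2) (K a b d) = K (n + a) b d.
  rewrite run_copy // K7 -[K a b d 8]/(nseq a true) cn.
  by apply: functional_extensionality => q; rewrite /K /upd;
    do 3 case: eqP => [->|_] //.
have st11 a b d : run L (pcopy 7 11 2) (K a b d) = K a (n + b) d.
  rewrite run_copy // K7 -[K a b d 11]/(nseq b true) cn.
  by apply: functional_extensionality => q; rewrite /K /upd;
    do 3 case: eqP => [->|_] //.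
have st13 a b d : run L (pcopy 7 13 2) (K a b d) = K a b (n + d).
  rewrite run_copy // K7 -[K a b d 13]/(nseq d true) cn.
  by rewrite /K upd_upd.
rewrite !run_seqs !(st8, st11, st13) /= !addn0.
split; [|exact: (E 10)|by []|exact: (E 12)|by []].
split; first by [].
- rewrite -[LHS]/o /o; congr (catrev _ _); rewrite enc_gates_const enc_natE.
  by rewrite /= E7.
- by split; [exact: (E 2)|exact: (E 3)|exact: (E 4)|exact: (E 5)].
- by split; [|rewrite -[LHS]/(nseq _ true); congr (nseq _ _); lia|exact: (E 9)].
Qed.

Lemma blocks_cat n C B l l' :
  blocks n C B (l ++ l') =
  blocks n C B l ++ blocks n C (B + size l * block_size n C) l'.
Proof.
elim: l B => [|p l IHl] B /=; first by rewrite mul0n addn0.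
by rewrite IHl catA mulSn addnA.
Qed.

Lemma size_pairs k m : size (pairs k m) = k * m.
Proof. by rewrite size_allpairs !size_iota. Qed.

Lemma run_hash_prog L n C : bounded_circuit L C -> n < L ->
  n + n + last_base n C + block_size n C <= L ->
  run L hash_prog (input_store (enc_wp_instance (WPInstance n C))) 1 =
  catrev (enc_ws_instance (hash_instance (WPInstance n C))) [::].
Proof.
move=> bC lt_n le_L.
have Ew : enc_nat n ++ enc_circuit C = enc_wp_instance (WPInstance n C) by [].
rewrite /hash_prog run_seqs_cat.
have [] := run_hash_prefix Ew lt_n.
set s := run L _ _ => G E10 E11 E12 E13.
pose I l s' := gen_state n C
  (nseq n (GConst false) ++ blocks n C (n + n + (n + n)) l)
  (n + n + (n + n) + size l * block_size n C) s'.
have fI l : frame [:: 10; 11; 12; 13] (I l).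
  by move=> s1 s2 E [F0 F1 [F2 F3 F4 F5] [F7 F8 F9]]; split; [| |split|split];
    rewrite E.
have Ibody l i j s1 : i < n + n -> j < n + n -> size l = i * (n + n) + j ->
    I l s1 -> s1 10 = nseq i true -> s1 12 = nseq j true ->
    I (rcons l (i, j)) (run L emit_block s1) /\
    forall r, r \in [:: 10; 11; 12; 13] -> run L emit_block s1 r = s1 r.
  move=> lt_i lt_j sz Il F10 F12; rewrite /I size_rcons -cats1 blocks_cat catA.
  rewrite mulSnr (addnA (n + n + (n + n))) /= cats0; apply: run_emit_block => //.
  apply: leq_trans le_L; rewrite leq_add2r leq_add2l /last_base leq_add2l.
  rewrite leq_mul2r size_pairs sz; apply/orP; right.
  by apply: (@leq_trans (i.+1 * (n + n)));
    [rewrite mulSnr leq_add2l ltnW|rewrite leq_mul2r lt_i orbT].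
have le_2n : n + n <= L by lia.
have I0 : I [::] s by rewrite /I /= cats0 mul0n addn0.
rewrite run_seqs.
have [] := run_for2 fI Ibody le_2n I0 E10 E11 E12 E13.
rewrite -/(last_base n C).
set s1 := run L _ s => -[F0 F1 [F2 F3 F4 F5] [F7 F8 F9]] _ _ _.
set B := last_base n C in F8 le_L.
have le_B : B <= L by lia.
have F0' : s1 0 = enc_circuit C ++ [::] by rewrite cats0.
rewrite run_seqs.
have [] := run_emit_gates (W := 0) bC le_B F0' F2 F4 F5 F8 F9.
set s2 := run L _ s1 => G0 G1 _ _ Gr.
have G2 : s2 2 = [::] by rewrite Gr.
have G7 : s2 7 = nseq n true by rewrite Gr.
rewrite run_seqs run_emit //; last first.
  move=> r; rewrite !inE /=; do ?[case/orP]; do ?[move=> //];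
  by move/eqP => -[->]; rewrite G7 size_nseq (ltnW lt_n).
set s3 := upd s2 1 _; rewrite run_seqs.
have items_reg r : inr r \in [:: inl [:: true]; inr 8; inr 4; inl [:: false]] ->
    r \in [:: 4; 8].
  by rewrite !inE /=; do ?[case/orP]; do ?[move=> //]; move/eqP => -[->].
pose val o := true :: enc_nat (B + o).
have H0 : s3 0 = enc_list enc_nat (outputs C) ++ [::] by [].
have H4 : s3 4 = [::] by rewrite -[LHS]/(s2 4) Gr.
have H8 : s3 8 = nseq B true by rewrite -[LHS]/(s2 8) Gr.
have valP s' o : s' 4 = nseq o true -> s' 8 = nseq B true ->
    flatten (map (item_value s') [:: inl [:: true]; inr 8; inr 4; inl [:: false]])
      = val o.
  by move=> V4 V8; rewrite /= V4 V8 /val enc_natE nseqD -catA.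
have [] := run_emit_outs bC le_B items_reg valP H0 G2 H4 H8.
rewrite -/emit_out; set s4 := run L _ s3 => _ J1 _ Jr.
have J2 : s4 2 = [::] by rewrite Jr.
have J7 : s4 7 = nseq n true by rewrite Jr.
have st0 o : run L (pemit [:: inl [:: false]]) (upd s4 1 o) =
    upd s4 1 (catrev [:: false] o).
  by rewrite run_emit // upd_upd upd_eq.
have st1 o b b' : run L (prepeat 1 [:: true; b; true; b']) (upd s4 1 o) =
    upd s4 1 (catrev (repeat_bits n [:: true; b; true; b']) o).
  by rewrite (@run_repeat L n 1) ?upd_upd ?upd_eq // ltnW.
rewrite -(upd_same s4 1) !run_seqs !(st0, st1) -[run _ _ _]/(upd s4 1 _) upd_eq.
rewrite J1 -[s3 1]/(catrev _ (s2 1)) G1 F1 -!catrev_catl.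
congr (catrev _ _).
rewrite /enc_ws_instance /hash_instance /= /enc_circuit /=.
rewrite !enc_bits_repeat !enc_listE -/(enc_gates _) !enc_gates_cat.
rewrite G7 -map_comp /= enc_natE -!catA; do ?congr (_ ++ _).
rewrite /= /enc_nat -cats1 !nseqD -!catA.
by [].
Qed.

(** * Evaluating circuits and searching for a collision *)

Lemma run_push L r b s : run L (PPush r b) s = upd s r (b :: s r).
Proof. by []. Qed.

Lemma run_pop L r s : run L (PPop r) s = upd s r (behead (s r)).
Proof. by []. Qed.

Lemma run_move L a b s : a != b ->
  run L (PMove a b) s = upd (upd s b (catrev (s a) (s b))) a [::].
Proof. by rewrite /run => /negbTE->. Qed.

Definition pcopy_ord (a b : nat) : prog := PSeq (pcopy a 6 2) (PMove 6 b).

Lemma run_copy_ord L a b s : a \notin [:: 2; 6] -> b \notin [:: 2; 6] ->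
  a != b -> s 2 = [::] -> s 6 = [::] -> size (s a) <= L ->
  run L (pcopy_ord a b) s = upd s b (s a ++ s b).
Proof.
rewrite !inE !negb_or => /andP[a2 a6] /andP[b2 b6] ab E2 E6 le_L.
rewrite /pcopy_ord run_seq run_copy //; last by rewrite /= !inE negb_or a6 a2.
rewrite run_move 1?eq_sym // upd_eq E6 [upd s 6 _ b]upd_neq // catrevK.
apply: functional_extensionality => q; rewrite /upd.
case: (q =P 6) => [->|_] //; first by rewrite eq_sym (negbTE b6) E6.
Qed.

Definition pop1 (f : bool -> bool) : prog :=
  PCase 9 PSkip (PSeq (PPop 9) (PPush 9 (f true)))
                (PSeq (PPop 9) (PPush 9 (f false))).

(* The top of register 9 is the second argument. *)
Definition pop2 (f : bool -> bool -> bool) : prog :=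
  PCase 9 PSkip
    (PSeq (PPop 9) (pop1 (fun b => f b true)))
    (PSeq (PPop 9) (pop1 (fun b => f b false))).

Lemma run_op1 L f b r s : s 9 = b :: r ->
  run L (pop1 f) s = upd s 9 (f b :: r).
Proof.
move=> E; rewrite /pop1 run_case E.
by case: b E => E; rewrite run_seq run_pop run_push upd_eq upd_upd E.
Qed.

Lemma run_op2 L f b b' r s : s 9 = b' :: b :: r ->
  run L (pop2 f) s = upd s 9 (f b b' :: r).
Proof.
move=> E; rewrite /pop2 run_case E.
by case: b' E => E; rewrite run_seq run_pop E (@run_op1 _ _ b r) ?upd_eq ?upd_upd.
Qed.

(** Wire 0 is on top of register 8, so the value of a new wire has to be inserted at the bottom, by
    reversing twice. *)
Definition pappend : prog :=
  PSeq (PMove 8 2) (PSeq (PCase 9 PSkip (PSeq (PPop 9) (PPush 2 true))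
    (PSeq (PPop 9) (PPush 2 false))) (PMove 2 8)).

Lemma run_append L b r s : s 2 = [::] -> s 9 = b :: r ->
  run L pappend s = upd (upd s 8 (rcons (s 8) b)) 9 r.
Proof.
move=> E2 E9; rewrite /pappend run_seq run_move // run_seq run_case.
set s1 := upd _ 8 _; have -> : s1 9 = b :: r by [].
have st c : run L (PMove 2 8) (run L (PSeq (PPop 9) (PPush 2 c)) s1) =
    upd (upd s 8 (rcons (s 8) c)) 9 (behead (s 9)).
  rewrite run_seq run_pop run_push run_move // /s1 E2.
  apply: functional_extensionality => q; rewrite /upd /= catrevK cats1.
  by case: (q =P 2) => [->|_] //; case: (q =P 8) => [->|_].
by case: b E9 => E9; rewrite st E9.
Qed.

Definition eval_gate (k : gate) : prog :=
  PSeq (match k with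
    | GConst b => PPush 9 b
    | GNot _ => PSeq (pnth 8 4 9) (pop1 negb)
    | GAnd _ _ => PSeq (pnth 8 4 9) (PSeq (pnth 8 5 9) (pop2 andb))
    | GOr _ _ => PSeq (pnth 8 4 9) (PSeq (pnth 8 5 9) (pop2 orb))
    end) pappend.

Lemma run_eval_gate L g s : s 2 = [::] -> s 6 = [::] -> bounded_gate L g ->
  s 4 = gate_arg 0 g -> s 5 = gate_arg 1 g ->
  run L (eval_gate (gate_kind g)) s =
  upd s 8 (rcons (s 8) (gate_value (s 8) g)).
Proof.
move=> E2 E6 le_g E4 E5; rewrite /eval_gate run_seq.
set c := match gate_kind g with GConst _ => _ | _ => _ end.
have -> : run L c s = upd s 9 (gate_value (s 8) g :: s 9).
  have nth4 i s' : i <= L -> s' 2 = [::] -> s' 6 = [::] -> s' 4 = nseq i true ->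
      run L (pnth 8 4 9) s' = upd s' 9 (nth false (s' 8) i :: s' 9).
    by move=> le_i F2 F6 F4; rewrite run_nth ?F4 ?size_nseq.
  have nth5 i s' : i <= L -> s' 2 = [::] -> s' 6 = [::] -> s' 5 = nseq i true ->
      run L (pnth 8 5 9) s' = upd s' 9 (nth false (s' 8) i :: s' 9).
    by move=> le_i F2 F6 F5; rewrite run_nth ?F5 ?size_nseq.
  rewrite /c; case: g le_g E4 E5 {c} => [b|i|i j|i j] //= le_g E4 E5.
  - case/andP: le_g => le_i _; rewrite run_seq (nth4 i) //.
    by rewrite (@run_op1 _ _ (nth false (s 8) i) (s 9)) ?upd_upd.
  - case/and3P: le_g => le_i le_j _; rewrite 2!run_seq (nth4 i) // (nth5 j) //.
    by rewrite 
      (@run_op2 _ _ (nth false (s 8) i) (nth false (s 8) j) (s 9)) ?upd_upd.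
  - case/and3P: le_g => le_i le_j _; rewrite 2!run_seq (nth4 i) // (nth5 j) //.
    by rewrite 
      (@run_op2 _ _ (nth false (s 8) i) (nth false (s 8) j) (s 9)) ?upd_upd.
rewrite (@run_append _ (gate_value (s 8) g) (s 9)) // -[upd s 9 _ 8]/(s 8).
apply: functional_extensionality => q; rewrite /upd.
by case: (q =P 9) => [->|_].
Qed.

(** Output bits pile up on register 9 in reverse order, and the final move to [o] straightens
    them. *)
Definition peval (a o : nat) : prog :=
  pseqs [:: pcopy_ord a 8; pgates eval_gate; pouts (pnth 8 4 9); PMove 3 0;
    pclear 8; PMove 9 o].

Lemma wire_values_rcons gs g v :
  wire_values (rcons gs g) v =
  rcons (wire_values gs v) (gate_value (wire_values gs v) g).
Proof. by rewrite /wire_values foldl_rcons. Qed.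

Lemma size_wire_values gs v : size (wire_values gs v) = size v + size gs.
Proof.
elim/last_ind: gs => [|gs g IHgs]; first by rewrite addn0.
by rewrite wire_values_rcons !size_rcons IHgs addnS.
Qed.

Lemma run_eval L C a o s : bounded_circuit L C -> a > 9 -> o > 9 -> a != o ->
  s 0 = enc_circuit C -> (forall r, r \in [:: 2; 3; 4; 5; 6; 8; 9] -> s r = [::]) ->
  s o = [::] -> size (s a) + size (gates C) <= L ->
  run L (peval a o) s = upd s o (ceval C (s a)).
Proof.
case=> bg sg bo so gt_a gt_o neq E0 Er Eo le_L.
have big r b : r > 9 -> b <= 9 -> (r == b) = false by lia.
have a26 : a \notin [:: 2; 6] by rewrite !inE !big.
have a8 : a != 8 by rewrite big.
have le_a : size (s a) <= L by lia.
rewrite /peval run_seqs (run_copy_ord (b := 8) a26 isT a8 (Er 2 isT) (Er 6 isT) le_a).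
rewrite (Er 8) // cats0.
set s1 := upd s 8 _.
pose I l (s' : store) := [/\ s' 8 = wire_values l (s a), s' 2 = [::], s' 6 = [::]
  & forall r, r \notin [:: 0; 3; 4; 5; 8] -> s' r = s r].
have fI l : frame [:: 0; 3; 4; 5] (I l).
  move=> s2 s3 E [I8 I2 I6 Ir]; split; rewrite ?E // => r r_R.
  by rewrite E ?Ir //; move: r_R; rewrite !inE !negb_or; case/and5P=> -> -> -> ->.
have Ih l g s2 : bounded_gate L g -> I l s2 -> s2 4 = gate_arg 0 g ->
    s2 5 = gate_arg 1 g -> let s3 := run L (eval_gate (gate_kind g)) s2 in
    I (rcons l g) s3 /\ forall r, r \in [:: 0; 3; 4; 5] -> s3 r = s2 r.
  move=> le_g [I8 I2 I6 Ir] F4 F5; rewrite run_eval_gate // I8; split; last first.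
    by move=> r; rewrite !inE; do ?[case/orP]; move/eqP->.
  split=> //; first by rewrite wire_values_rcons upd_eq.
  by move=> r r_R; rewrite upd_neq ?Ir //; move: r_R; rewrite !inE !negb_or;
    case/and5P.
have I0 : I [::] s1.
  split; [exact: upd_eq|exact: (Er 2)|exact: (Er 6)|].
  by move=> r r_R; rewrite /s1 upd_neq //; move: r_R; rewrite !inE !negb_or;
    case/and5P.
have F0 : s1 0 = enc_list enc_gate (gates C) ++ enc_list enc_nat (outputs C) by [].
have F4 : s1 4 = [::] by rewrite /s1 upd_neq ?Er.
have F5 : s1 5 = [::] by rewrite /s1 upd_neq ?Er.
have [[I8 I2 I6 Ir] K0 I3 [I4 I5]] := run_gates fI Ih bg sg I0 F0 F4 F5.
rewrite run_seqs; set s2 := run L _ s1 in I8 I2 I6 Ir K0 I3 I4 I5 *.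
pose wv := wire_values (gates C) (s a).
pose J l (s' : store) := [/\ s' 9 = catrev [seq nth false wv i | i <- l] [::],
  s' 8 = wv & forall r, r \notin [:: 0; 3; 4; 8; 9] -> s' r = s2 r].
have fJ l : frame [:: 0; 3; 4] (J l).
  move=> s3 s4 E [J9 J8 Jr]; split; rewrite ?E // => r r_R.
  by rewrite E ?Jr //; move: r_R; rewrite !inE !negb_or; case/and5P=> -> -> ->.
have Jh l i s3 : i <= L -> J l s3 -> s3 4 = nseq i true ->
    let s4 := run L (pnth 8 4 9) s3 in
    J (rcons l i) s4 /\ forall r, r \in [:: 0; 3; 4] -> s4 r = s3 r.
  move=> le_i [J9 J8 Jr] G4.
  have G2 : s3 2 = [::] by rewrite Jr.
  have G6 : s3 6 = [::] by rewrite Jr.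
  rewrite run_nth ?G4 ?size_nseq // J8 J9.
  split; last by move=> r; rewrite !inE; do ?[case/orP]; move/eqP->.
  split; [|by rewrite upd_neq|].
    by rewrite upd_eq map_rcons -cats1 catrev_catl.
  by move=> r r_R; rewrite upd_neq ?Jr //; move: r_R; rewrite !inE !negb_or;
    case/and5P.
have J0 : J [::] s2 by split=> //; rewrite Ir // Er.
have G0 : s2 0 = enc_list enc_nat (outputs C) ++ [::] by rewrite K0 cats0.
have [[J9 J8 Jr] K1 J3 J4] := run_outs fJ Jh bo so J0 G0 I4.
rewrite run_seqs; set s3 := run L _ s2 in J9 J8 Jr K1 J3 J4 *.
rewrite run_seqs run_move // J3 K1 I3 /s1 [upd s 8 _ 3]upd_neq // (Er 3) //.
rewrite -catrev_catl catrevK cats0 run_seqs run_clear; last first.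
  by rewrite /upd /= J8 size_wire_values.
rewrite run_seqs run_move; last by rewrite eq_sym big.
apply: functional_extensionality => q.
have -> : run L (pseqs [::]) = id by [].
rewrite -[upd _ 8 _ 9]/(s3 9) J9.
have -> : upd (upd (upd s3 0 (enc_circuit C)) 3 [::]) 8 [::] o = [::].
  rewrite !upd_neq ?big //.
  rewrite Jr ?Ir ?Eo // !inE ?big //.
rewrite catrevK cats0 /upd.
case: (q =P 9) => [->|q9]; first by rewrite eq_sym big // Er.
case: (q =P o) => // qo.
case: (q =P 8) => [->|q8]; first by rewrite Er.
case: (q =P 3) => [->|q3]; first by rewrite Er.
case: (q =P 0) => [->|q0] //.
case: (q =P 4) => [->|q4]; first by rewrite J4 Er.
case: (q =P 5) => [->|q5]; first by rewrite Jr ?I5 ?Er.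
rewrite Jr ?Ir ?inE //; do ?[case: eqP => //].
Qed.

Lemma run_seqs0 L s : run L (pseqs [::]) s = s.
Proof. by []. Qed.

Definition pshift (a t : nat) : prog :=
  PCase a PSkip
    (PSeq (PPop a) (PSeq (PPush t true) (PPush 9 true)))
    (PSeq (PPop a) (PSeq (PPush t false) (PPush 9 false))).

Lemma run_shift L a t b w s : uniq [:: a; t; 9] -> s a = b :: w ->
  run L (pshift a t) s = upd (upd (upd s a w) t (b :: s t)) 9 (b :: s 9).
Proof.
rewrite /= !inE negb_or andbT => /andP[/andP[neq_at neq_a9] neq_t9] E.
rewrite /pshift run_case E.
by case: b E => E; rewrite 2!run_seq run_pop !run_push !upd_neq 1?eq_sym // E.
Qed.

(** Below the two bits just pushed on register 9 lies the verdict so far, which the last operation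
    combines with their comparison. *)
Definition peq_step (a b : nat) : prog :=
  pseqs [:: pshift a 2; pshift b 6; pop2 (fun x y => x == y); pop2 andb].

Definition peq (a b : nat) : prog :=
  pseqs [:: PPush 9 true; PLoop (PCase a PSkip (peq_step a b) (peq_step a b));
    PMove 2 a; PMove 6 b].

Lemma run_eq L a b s : a > 9 -> b > 9 -> a != b ->
  size (s a) = size (s b) -> size (s a) <= L -> s 2 = [::] -> s 6 = [::] ->
  run L (peq a b) s = upd s 9 ((s a == s b) :: s 9).
Proof.
move=> gt_a gt_b neq sz le_L E2 E6.
have ne : ((a == 2 = false) * (a == 6 = false) * (a == 9 = false) *
    (b == 2 = false) * (b == 6 = false) * (b == 9 = false) * (a == b = false)) *
   ((2 == a = false) * (6 == a = false) * (9 == a = false) *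
    (2 == b = false) * (6 == b = false) * (9 == b = false) * (b == a = false)).
  by do ?split; lia.
rewrite /peq run_seqs run_push run_seqs run_loop.
set f := run L (PCase a PSkip _ _).
have loop n u v c s' : size u = size v -> size u <= n -> s' a = u -> s' b = v ->
    s' 9 = c :: s 9 -> iter n f s' =
    upd (upd (upd (upd (upd s' a [::]) b [::]) 2 (catrev u (s' 2)))
      6 (catrev v (s' 6))) 9 (c && (u == v) :: s 9).
  have base s2 d : s2 a = [::] -> s2 b = [::] -> s2 9 = d :: s 9 ->
      s2 = upd (upd (upd (upd (upd s2 a [::]) b [::]) 2 (s2 2)) 6 (s2 6))
               9 (d && true :: s 9).
    move=> Ea Eb E9; rewrite andbT -E9.
    by apply: functional_extensionality => q; rewrite /upd;
      do ?[case: eqP => [->|_] //].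
  elim: n u v c s' => [|n IHn] [|x u] [|y v] c s' //= eq_sz le_n Ea Eb E9.
  - exact: base.
  - rewrite -iterS iter_fix; last by rewrite /f run_case Ea.
    exact: base.
  - rewrite -iterS iterSr.
    have -> : f s' = upd (upd (upd (upd (upd s' a u) b v) 2 (x :: s' 2))
        6 (y :: s' 6)) 9 ((c && (x == y)) :: s 9).
      have -> : f s' = run L (peq_step a b) s'.
        by rewrite /f run_case Ea; case: (x).
      rewrite /peq_step run_seqs (run_shift _ _ Ea); last first.
        by rewrite /= !inE !ne.
      rewrite run_seqs (@run_shift _ _ _ y v); last 2 first.
      + by rewrite /= !inE !ne.
      + by rewrite !upd_neq ?ne // Eb.
      rewrite run_seqs (@run_op2 _ _ x y (c :: s 9)); last first.
        by rewrite /upd /= E9.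
      rewrite run_seqs (@run_op2 _ _ c (x == y) (s 9)); last by rewrite upd_eq.
      rewrite run_seqs0; apply: functional_extensionality => q; rewrite /upd /= !ne //.
      case: (q =P 9) => // _; case: (q =P 6) => // _.
      have [->|_] := eqVneq q b; first by rewrite !ne.
      by case: (q == 2).
    rewrite (IHn u v (c && (x == y))) //; last 3 first.
    + by case: eq_sz.
    + by rewrite /upd !ne ?eqxx.
    + by rewrite /upd !ne ?eqxx.
    apply: functional_extensionality => q; rewrite /upd /= eqseq_cons andbA.
    by case: (q == 9); case: (q == 6); case: (q == 2); case: (q == b); case: (q == a).
rewrite (loop L (s a) (s b) true) // ?upd_neq ?ne //.
rewrite run_seqs run_move ?ne // run_seqs run_move ?ne //.
rewrite run_seqs0; apply: functional_extensionality => q.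
rewrite /upd /= !ne ?ne // E2 E6 !catrevK !eqxx ?cats0.
case: (q =P 6) => [->|_]; first by rewrite E6.
have [->|_] := eqVneq q b; first by rewrite !ne.
case: (q =P 2) => [->|_]; first by rewrite E2.
have [->|_] := eqVneq q a; first by rewrite !ne.
by case: (q == 9).
Qed.

Definition pemit_bits (a : nat) : prog :=
  pseqs [:: PLoop (PCase a PSkip
      (PSeq (PPop a) (PSeq (PPush 2 true) (ppush 1 [:: true; true])))
      (PSeq (PPop a) (PSeq (PPush 2 false) (ppush 1 [:: true; false]))));
    ppush 1 [:: false]; PMove 2 a].

Lemma run_emit_bits L a s : a > 9 -> size (s a) <= L -> s 2 = [::] ->
  run L (pemit_bits a) s = upd s 1 (catrev (enc_bits (s a)) (s 1)).
Proof.
move=> gt_a le_L E2.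
have ne : ((a == 1 = false) * (a == 2 = false)) *
          ((1 == a = false) * (2 == a = false)).
  by do ?split; lia.
rewrite /pemit_bits run_seqs run_loop; set f := run L (PCase _ _ _ _).
have loop n u s' : size u <= n -> s' a = u ->
    false :: iter n f s' 1 = catrev (enc_bits u) (s' 1) /\
    iter n f s' = upd (upd (upd s' a [::]) 2 (catrev u (s' 2)))
                      1 (iter n f s' 1).
  elim: n u s' => [|n IHn] [|x u] s' //= le_n Ea.
  - by rewrite -Ea !upd_same.
  - by rewrite -iterS iter_fix; [rewrite -Ea !upd_same|rewrite /f run_case Ea].
  - rewrite -iterS iterSr.
    have fE : f s' = upd (upd (upd s' a u) 2 (x :: s' 2)) 1 [:: x, true & s' 1].
      by rewrite /f run_case Ea; case: x Ea => Ea;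
        rewrite 2!run_seq run_pop run_push run_ppush !upd_neq ?ne // Ea.
    have [|H1 H2] := IHn u (f s') le_n.
      by rewrite fE /upd !ne eqxx.
    split; first by rewrite H1 fE upd_eq.
    rewrite {}H2; move: (iter n f (f s') 1) => o; rewrite fE.
    apply: functional_extensionality => q; rewrite /upd /= .
    by case: (q == 1); case: (q == 2); case: (q == a).
have [H1 H2] := loop L (s a) s le_L erefl.
rewrite H2 run_seqs run_ppush upd_eq upd_upd.
rewrite -[catrev [:: false] _]/(false :: _) H1 run_seqs run_move ?ne //.
rewrite run_seqs0; apply: functional_extensionality => q.
rewrite /upd /= !ne ?ne // eqxx E2 catrevK cats0.
case: (q =P 2) => [->|_]; first by rewrite E2.
by have [->|_] := eqVneq q a; first by rewrite !ne.
Qed.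

(** The stored answer is only ever replaced by a genuine collision, so the test may be applied to
    any pair and no success is lost. *)
Definition new_answer (C : circuit) (u v out : seq bool) : seq bool :=
  if (ceval C u == ceval C v) && (u != v) then enc_wp_solution (u, v) else out.

(** For [pop2] the top of the stack, here the equality of the two values of C, is the argument y.
    Registers 16 and 17 keep these values: they are the tails of the next two states. *)
Definition pcheck : prog :=
  pseqs [:: peval 14 16; peval 15 17; peq 14 15; peq 16 17;
    pop2 (fun x y => y && ~~ x);
    PCase 9 PSkip
      (pseqs [:: pclear 1; pemit_bits 14; pemit_bits 15; PPop 9]) (PPop 9)].

Lemma size_ceval C x : size (ceval C x) = size (outputs C).
Proof. by rewrite size_map. Qed.

Definition ready_store (C : circuit) (s : store) : Prop :=
  s 0 = enc_circuit C /\
  (forall r, r \in [:: 2; 3; 4; 5; 6; 8; 9; 16; 17] -> s r = [::]).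

Lemma run_check L C out s : bounded_circuit L C -> ready_store C s ->
  size (s 14) = size (s 15) -> size (s 14) + size (gates C) <= L ->
  s 1 = catrev out [::] -> size out <= L ->
  run L pcheck s =
  upd (upd (upd s 16 (ceval C (s 14))) 17 (ceval C (s 15)))
      1 (catrev (new_answer C (s 14) (s 15) out) [::]).
Proof.
move=> bC [E0 Er] sz le_L E1 le_out.
have le14 : size (s 14) <= L by lia.
have le_o x : size (ceval C x) <= L by rewrite size_ceval; case: bC.
rewrite /pcheck run_seqs (run_eval bC) //; try exact: Er; last first.
  by move=> r r_R; apply: Er; move: r_R; rewrite !inE; do ?[case/orP]; move/eqP->.
rewrite run_seqs; set s1 := upd s 16 _.
rewrite (run_eval (s := s1) bC) //; try exact: (Er 17); last 2 first.
- by move=> r r_R; rewrite -(Er r); [rewrite /s1 upd_neq //|];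
    move: r_R; rewrite !inE; do ?[case/orP]; move/eqP->.
- by rewrite -[s1 15]/(s 15) -sz.
rewrite -[s1 15]/(s 15) run_seqs; set s2 := upd s1 17 _.
rewrite (run_eq (s := s2)) //; try exact: (Er 2); try exact: (Er 6).
rewrite -[s2 14]/(s 14) -[s2 15]/(s 15) -[s2 9]/(s 9) (Er 9) //.
rewrite run_seqs; set s3 := upd s2 9 _.
rewrite (run_eq (s := s3)) //; try exact: (Er 2); try exact: (Er 6); last 2 first.
- by rewrite -[s3 16]/(ceval C _) -[s3 17]/(ceval C _) !size_ceval.
- exact: le_o.
rewrite -[s3 16]/(ceval C (s 14)) -[s3 17]/(ceval C (s 15)) -[s3 9]/[:: s 14 == s 15].
rewrite run_seqs (@run_op2 _ _ (s 14 == s 15) (ceval C (s 14) == ceval C (s 15)) [::]) //.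
rewrite /new_answer; set b := _ && _; rewrite run_seqs run_case upd_eq.
have -> : upd (upd s3 9 [:: ceval C (s 14) == ceval C (s 15); s 14 == s 15])
    9 [:: b] = upd s2 9 [:: b].
  by rewrite upd_upd /s3 upd_upd.
have F9 : upd s2 9 [::] = s2.
  apply: functional_extensionality => q; rewrite /upd.
  by case: (q =P 9) => // ->; rewrite -[RHS]/(s 9) Er.
case: b; last first.
  rewrite run_pop upd_eq upd_upd F9 -E1 -[s 1]/(s2 1) upd_same.
  by [].
rewrite run_seqs run_clear; last by rewrite -[upd _ _ _ 1]/(s 1) E1 catrevE cats0 size_rev.
set s4 := upd _ 1 _.
rewrite run_seqs run_emit_bits //; last exact: (Er 2).
rewrite -[s4 14]/(s 14) -[s4 1]/[::]; set s5 := upd s4 1 _.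
rewrite run_seqs run_emit_bits //; [|by rewrite -[s5 15]/(s 15) -sz|exact: (Er 2)].
rewrite -[s5 15]/(s 15) /s5 upd_eq upd_upd -catrev_catl.
rewrite run_seqs run_pop run_seqs0.
rewrite /enc_wp_solution [(_, _).1]/= [(_, _).2]/=.
rewrite /s4 upd_upd [upd _ 1 _ 9]upd_neq // upd_eq.
rewrite (updC _ _ _ (_ : 1 != 9)) // upd_upd F9.
by [].
Qed.

(** * Following two hash chains in parallel *)

Definition mix (x y : seq bool) (p : nat * nat) : bool :=
  (nth false x p.1 && ~~ nth false y p.2)
    || (nth false y p.1 && ~~ nth false x p.2).

Definition pmix (x y : nat) : prog :=
  let andN := pop2 (fun a b => a && ~~ b) in
  pseqs [:: pnth x 10 9; pnth y 12 9; andN; pnth y 10 9; pnth x 12 9; andN;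
    pop2 orb].

Lemma run_mix L x y i j r s : x \notin [:: 2; 6; 9; 10; 12] ->
  y \notin [:: 2; 6; 9; 10; 12] ->
  s 2 = [::] -> s 6 = [::] -> s 9 = r -> s 10 = nseq i true -> s 12 = nseq j true ->
  i <= L -> j <= L ->
  run L (pmix x y) s = upd s 9 (mix (s x) (s y) (i, j) :: r).
Proof.
move=> x_ y_ E2 E6 E9 E10 E12 le_i le_j.
have nth10 v t : v \notin [:: 2; 6; 9; 10; 12] ->
    run L (pnth v 10 9) (upd s 9 t) = upd s 9 (nth false (s v) i :: t).
  rewrite !inE !negb_or => /and5P[v2 v6 v9 v10 v12].
  rewrite run_nth //.
  - by rewrite -[upd s 9 t 10]/(s 10) E10 size_nseq upd_eq upd_upd upd_neq.
  - by rewrite /= !inE !negb_or v10 v9 v2 v6.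
  - by rewrite -[upd s 9 t 10]/(s 10) E10 size_nseq.
  - by rewrite -[upd s 9 t 10]/(s 10) E10 size_nseq.
have nth12 v t : v \notin [:: 2; 6; 9; 10; 12] ->
    run L (pnth v 12 9) (upd s 9 t) = upd s 9 (nth false (s v) j :: t).
  rewrite !inE !negb_or => /and5P[v2 v6 v9 v10 v12].
  rewrite run_nth //.
  - by rewrite -[upd s 9 t 12]/(s 12) E12 size_nseq upd_eq upd_upd upd_neq.
  - by rewrite /= !inE !negb_or v12 v9 v2 v6.
  - by rewrite -[upd s 9 t 12]/(s 12) E12 size_nseq.
  - by rewrite -[upd s 9 t 12]/(s 12) E12 size_nseq.
have op2 f b b' t : run L (pop2 f) (upd s 9 [:: b', b & t]) = upd s 9 (f b b' :: t).
  by rewrite (@run_op2 _ _ b b' t) ?upd_upd ?upd_eq.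
rewrite /pmix -{1}(upd_same s 9) E9.
by rewrite !run_seqs nth10 // nth12 // op2 nth10 // nth12 // op2 op2 run_seqs0.
Qed.

Definition pnext (a o : nat) : prog :=
  pseqs [:: pclear a; PMove o 2; PMove 2 a;
    PCase 9 PSkip (PSeq (PPop 9) (PPush a true)) (PSeq (PPop 9) (PPush a false))].

Lemma run_next L a o b r s : uniq [:: a; o; 2; 9] -> s 2 = [::] -> s 9 = b :: r ->
  size (s a) <= L ->
  run L (pnext a o) s = upd (upd (upd s a (b :: s o)) o [::]) 9 r.
Proof.
rewrite /= !inE !negb_or !andbT -!andbA.
case/and5P=> /negbTE ao /negbTE a2 /negbTE a9 /negbTE o2 /negbTE o9 E2 E9 le_a.
have ne := (ao, a2, a9, o2, o9, etrans (eq_sym o a) ao, etrans (eq_sym 2 a) a2,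
  etrans (eq_sym 9 a) a9, etrans (eq_sym 2 o) o2, etrans (eq_sym 9 o) o9).
rewrite /pnext run_seqs run_clear // run_seqs run_move ?o2 // run_seqs.
rewrite run_move ?ne // run_seqs run_case run_seqs0.
set s1 := upd _ 2 _; have F9 : s1 9 = b :: r.
  by rewrite /s1 !upd_neq ?ne.
rewrite F9.
have st c : run L (PSeq (PPop 9) (PPush a c)) s1 =
    upd (upd (upd s a (c :: s o)) o [::]) 9 r.
  rewrite run_seq run_pop run_push F9 /s1.
  apply: functional_extensionality => q; rewrite /upd !ne !eqxx /= E2 catrevK cats0.
  have [->|_] := eqVneq q a; first by rewrite !ne.
  have [_|_] := eqVneq q 9; first by [].
  have [->|_] := eqVneq q 2; first by rewrite !ne E2.
  by case: (q == o).
by case: b E9 F9 => _ _; apply: st.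
Qed.

(** The current states are tested before both chains advance. *)
Definition pstep : prog :=
  pseqs [:: pcheck; pmix 18 19; pnext 14 16; pmix 20 21; pnext 15 17].

Definition chain_step (C : circuit) (x y : seq bool) (u : seq bool)
    (p : nat * nat) : seq bool :=
  mix x y p :: ceval C u.

Definition search_step (C : circuit) (x y x' y' : seq bool)
    (t : seq bool * seq bool * seq bool) (p : nat * nat) :=
  (chain_step C x y t.1.1 p, chain_step C x' y' t.1.2 p,
   new_answer C t.1.1 t.1.2 t.2).

(** The test after the loop concerns the final states, to which C is applied once more to give the
    colour. *)
Definition search (n : nat) (C : circuit) (x y x' y' out : seq bool) :=
  let t := foldl (search_step C x y x' y')
    (nseq n false, nseq n false, out) (pairs (n + n) (n + n)) in
  new_answer C t.1.1 t.1.2 t.2.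

Definition psearch (x y x' y' : nat) : prog :=
  pseqs [:: pcopy_ord x 18; pcopy_ord y 19; pcopy_ord x' 20; pcopy_ord y' 21;
    prepeat 14 [:: false]; prepeat 15 [:: false]; pfor2 pstep; pcheck;
    pclear 14; pclear 15; pclear 16; pclear 17; pclear 18; pclear 19; pclear 20;
    pclear 21].

Definition idle (n : nat) (C : circuit) (out : seq bool) (s : store) : Prop :=
  [/\ s 0 = enc_circuit C, s 1 = catrev out [::], s 7 = nseq n true,
      s 11 = nseq (n + n) true /\ s 13 = nseq (n + n) true
    & forall r, r \in [:: 2; 3; 4; 5; 6; 8; 9; 10; 12; 14; 15; 16; 17; 18; 19;
        20; 21] -> s r = [::]].

Lemma size_repeat_bits n w : size (repeat_bits n w) = n * size w.
Proof. by rewrite /repeat_bits size_flatten /shape map_nseq sumn_nseq mulnC. Qed.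

Lemma size_enc_bits w : size (enc_bits w) = 2 * size w + 1.
Proof. by rewrite /enc_bits; elim: w => //= b w ->; lia. Qed.

Lemma size_new_answer C u v out k : size u <= k -> size v <= k ->
  size out <= (2 * k + 1) + (2 * k + 1) ->
  size (new_answer C u v out) <= (2 * k + 1) + (2 * k + 1).
Proof.
move=> le_u le_v le_out; rewrite /new_answer; case: ifP => // _.
by rewrite /enc_wp_solution size_cat !size_enc_bits /=; lia.
Qed.

Lemma run_step L n C V out u v i j s : bounded_circuit L C ->
  size (outputs C) = n.-1 -> 0 < n -> size u = n -> size v = n ->
  n + size (gates C) <= L -> size out <= L -> i <= L -> j <= L ->
  ready_store C s -> s 1 = catrev out [::] -> s 14 = u -> s 15 = v ->
  s 10 = nseq i true -> s 12 = nseq j true ->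
  [/\ s 18 = V 0, s 19 = V 1, s 20 = V 2 & s 21 = V 3] ->
  run L pstep s =
    upd (upd (upd s 1 (catrev (new_answer C u v out) [::]))
       14 (chain_step C (V 0) (V 1) u (i, j)))
       15 (chain_step C (V 2) (V 3) v (i, j)).
Proof.
move=> bC sz_o n_gt0 su sv le_L le_out le_i le_j rd E1 E14 E15 E10 E12.
case=> E18 E19 E20 E21.
rewrite /pstep run_seqs (run_check bC rd _ _ E1 le_out) ?E14 ?E15 ?su //.
set o := catrev _ _; set s1 := upd _ 1 _.
have [E0 Er] := rd.
rewrite run_seqs (run_mix (r := [::]) (s := s1) _ _ _ _ _ E10 E12) //;
  try exact: (Er 2); try exact: (Er 6); try exact: (Er 9).
rewrite -[s1 18]/(s 18) -[s1 19]/(s 19) E18 E19.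
rewrite run_seqs (@run_next L 14 16 (mix (V 0) (V 1) (i, j)) [::]) //; last 2 first.
- exact: (Er 2).
- by rewrite upd_neq // -[s1 14]/(s 14) E14 su; lia.
set s2 := upd _ 9 [::].
rewrite run_seqs (run_mix (r := [::]) (s := s2) _ _ _ _ _ E10 E12) //;
  try exact: (Er 2); try exact: (Er 6).
rewrite -[s2 20]/(s 20) -[s2 21]/(s 21) E20 E21.
rewrite run_seqs (@run_next L 15 17 (mix (V 2) (V 3) (i, j)) [::]) //; last 2 first.
- exact: (Er 2).
- by rewrite -[upd _ _ _ 15]/(s 15) E15 sv; lia.
rewrite run_seqs0 /chain_step.
apply: functional_extensionality => q; rewrite /upd /s2 /s1 /upd /=.
case: (q =P 9) => [->|_]; first by rewrite Er.
case: (q =P 17) => [->|_]; first by rewrite Er.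
case: (q =P 15) => // _; case: (q =P 16) => [->|_]; first by rewrite Er.
by case: (q == 14); case: (q == 1).
Qed.

Lemma run_search L n C x y x' y' out s : bounded_circuit L C ->
  size (outputs C) = n.-1 -> 0 < n -> n + size (gates C) <= L ->
  (2 * n + 1) + (2 * n + 1) <= L ->
  size out <= (2 * n + 1) + (2 * n + 1) ->
  x > 21 -> y > 21 -> x' > 21 -> y' > 21 ->
  (forall r, r \in [:: x; y; x'; y'] -> size (s r) <= L) ->
  idle n C out s ->
  idle n C (search n C (s x) (s y) (s x') (s y') out)
    (run L (psearch x y x' y') s) /\
  (forall r, r > 21 -> run L (psearch x y x' y') s r = s r).
Proof.
move=> bC sz_o n_gt0 le_L le_L' le_out gt_x gt_y gt_x' gt_y' le_v.
case=> E0 E1 E7 [E11 E13] Er.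
have big r c : r > 21 -> c <= 21 -> (r == c) = false by lia.
have out26 r : r > 21 -> r \notin [:: 2; 6] by move=> gt_r; rewrite !inE !big.
have cp a b v s' : a > 21 -> b \notin [:: 2; 6] -> b <= 21 -> s' 2 = [::] ->
    s' 6 = [::] -> s' b = [::] -> s' a = v -> size v <= L ->
    run L (pcopy_ord a b) s' = upd s' b v.
  move=> gt_a b26 le_b F2 F6 Fb Fa le_a.
  have ab : a != b by rewrite big.
  have le_a' : size (s' a) <= L by rewrite Fa.
  by rewrite (run_copy_ord (out26 _ gt_a) b26 ab F2 F6 le_a') Fb cats0 Fa.
have le_x : size (s x) <= L by apply: le_v; rewrite inE eqxx.
have le_y : size (s y) <= L by apply: le_v; rewrite !inE eqxx orbT.
have le_x' : size (s x') <= L by apply: le_v; rewrite !inE eqxx !orbT.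
have le_y' : size (s y') <= L by apply: le_v; rewrite !inE eqxx !orbT.
rewrite /psearch run_seqs (cp _ 18 (s x) s gt_x isT isT (Er 2 isT) (Er 6 isT)
  (Er 18 isT) erefl le_x); set s1 := upd s 18 _.
have S1 r : r > 21 -> s1 r = s r by move=> gt_r; rewrite /s1 upd_neq ?big.
rewrite run_seqs (cp _ 19 (s y) s1 gt_y isT isT (Er 2 isT) (Er 6 isT) (Er 19 isT)
  (S1 _ gt_y) le_y); set s2 := upd s1 19 _.
have S2 r : r > 21 -> s2 r = s r by move=> gt_r; rewrite /s2 upd_neq ?big ?S1.
rewrite run_seqs (cp _ 20 (s x') s2 gt_x' isT isT (Er 2 isT) (Er 6 isT) (Er 20 isT)
  (S2 _ gt_x') le_x'); set s3 := upd s2 20 _.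
have S3 r : r > 21 -> s3 r = s r by move=> gt_r; rewrite /s3 upd_neq ?big ?S2.
rewrite run_seqs (cp _ 21 (s y') s3 gt_y' isT isT (Er 2 isT) (Er 6 isT) (Er 21 isT)
  (S3 _ gt_y') le_y'); set s4 := upd s3 21 _.
have le_n : n <= L by lia.
have zeros : catrev (repeat_bits n [:: false]) [::] = nseq n false.
  rewrite /repeat_bits (_ : flatten _ = nseq n false) ?catrev_nseq //.
  by elim: (n) => //= m ->.
rewrite run_seqs (@run_repeat L n 14 _ s4) //; last exact: (Er 2).
rewrite -[s4 14]/(s 14) (Er 14) // zeros; set s5 := upd s4 14 _.
rewrite run_seqs (@run_repeat L n 15 _ s5) //; last exact: (Er 2).
rewrite -[s5 15]/(s 15) (Er 15) // zeros; set s6 := upd s5 15 _.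
pose V k := nth [::] [:: s x; s y; s x'; s y'] k.
pose t l := foldl (search_step C (s x) (s y) (s x') (s y'))
  (nseq n false, nseq n false, out) l.
pose I l (s' : store) := [/\ s' 1 = catrev (t l).2 [::], s' 14 = (t l).1.1,
  s' 15 = (t l).1.2, [/\ size (t l).1.1 = n, size (t l).1.2 = n &
    size (t l).2 <= (2 * n + 1) + (2 * n + 1)] &
  forall r, r \notin [:: 1; 10; 11; 12; 13; 14; 15] -> s' r = s6 r].
have fI l : frame [:: 10; 11; 12; 13] (I l).
  move=> s7 s8 E [I1 I14 I15 Isz Ir]; split; rewrite ?E // => r.
  rewrite !inE !negb_or; case/and5P=> r1 r10 r11 r12 /and3P[r13 r14 r15].
  by rewrite E ?Ir // !inE !negb_or ?r1 ?r10 ?r11 ?r12 ?r13 ?r14 ?r15.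
have readyI l s' : I l s' -> ready_store C s'.
  case=> _ _ _ _ Ir; split; first by rewrite Ir.
  by move=> r; rewrite !inE; do ?[case/orP]; move/eqP->; rewrite Ir //
    -[LHS]/(s _) Er.
have Ib l i j s' : i < n + n -> j < n + n -> size l = i * (n + n) + j -> I l s' ->
    s' 10 = nseq i true -> s' 12 = nseq j true ->
    I (rcons l (i, j)) (run L pstep s') /\
    forall r, r \in [:: 10; 11; 12; 13] -> run L pstep s' r = s' r.
  move=> lt_i lt_j _ Il F10 F12; have rd := readyI _ _ Il.
  case: Il => [I1 I14 I15 [sz1 sz2 sz3] Ir].
  rewrite (@run_step L n C V (t l).2 (t l).1.1 (t l).1.2 i j) //; try lia; last first.
    by rewrite !Ir.
  split; last by move=> r; rewrite !inE; do ?[case/orP]; move/eqP->.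
  have tS : t (rcons l (i, j)) =
      search_step C (s x) (s y) (s x') (s y') (t l) (i, j).
    by rewrite /t foldl_rcons.
  rewrite /I tS /search_step /=; split=> //.
    split; [by rewrite size_ceval sz_o prednK|by rewrite size_ceval sz_o prednK|].
    by apply: size_new_answer => //; rewrite ?sz1 ?sz2.
  move=> r r_R; rewrite !upd_neq ?Ir //; move: r_R; rewrite !inE !negb_or;
    by case/and5P=> ? ? ? ? /and3P[].
have I0 : I [::] s6.
  by split; [exact: E1|by []|by []|rewrite /= !size_nseq|].
have le_2n : n + n <= L by lia.
have [||||IJ E10' E11' [E12' E13']] := run_for2 fI Ib le_2n I0.
- exact: (Er 10).
- exact: E11.
- exact: (Er 12).
- exact: E13.
rewrite run_seqs; set s7 := run L _ s6 in IJ E10' E11' E12' E13' *.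
have rd := readyI _ _ IJ.
case: IJ => [I1 I14 I15 [sz1 sz2 sz3] Ir].
have le_out7 : size (t (pairs (n + n) (n + n))).2 <= L by apply: leq_trans sz3 _.
rewrite run_seqs (run_check bC rd _ _ I1 le_out7) ?I14 ?I15 ?sz1 ?sz2 //.
set s8 := upd _ 1 _.
have le_o u : size (ceval C u) <= L by rewrite size_ceval sz_o; lia.
have clr r l s' : size (s' r) <= L ->
    run L (pseqs (pclear r :: l)) s' = run L (pseqs l) (upd s' r [::]).
  by move=> le_r; rewrite run_seqs run_clear.
rewrite clr; last by rewrite -[s8 14]/(s7 14) I14 sz1.
rewrite clr; last by rewrite -[upd _ _ _ 15]/(s7 15) I15 sz2.
rewrite clr; last exact: le_o.
rewrite clr; last exact: le_o.
rewrite clr; last by rewrite -[upd _ _ _ 18]/(s7 18) Ir //; exact: le_x.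
rewrite clr; last by rewrite -[upd _ _ _ 19]/(s7 19) Ir //; exact: le_y.
rewrite clr; last by rewrite -[upd _ _ _ 20]/(s7 20) Ir //; exact: le_x'.
rewrite clr; last by rewrite -[upd _ _ _ 21]/(s7 21) Ir //; exact: le_y'.
rewrite run_seqs0; split; last first.
  move=> r gt_r; rewrite !upd_neq ?big // /s8 !upd_neq ?big // Ir ?inE ?big //.
  by rewrite /s6 /s5 /s4 !upd_neq ?big // S3.
split=> //.
- by rewrite -[LHS]/(s7 0) Ir.
- by rewrite -[LHS]/(s7 7) Ir.
- move=> r; rewrite !inE; do ?[case/orP]; move/eqP-> => //;
  by rewrite -[LHS]/(s7 _) ?E10' ?E12' ?Ir // -[LHS]/(s _) Er.
Qed.

(** * Decoding the answer and assembling the second map *)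

Definition pdecode (r : nat) : prog :=
  pseqs [:: PLoop (PCase 0 PSkip
      (PSeq (PPop 0) (PCase 0 PSkip (PSeq (PPop 0) (PPush 2 true))
                                    (PSeq (PPop 0) (PPush 2 false)))) PSkip);
    PPop 0; PMove 2 r].

Lemma run_decode L r w v s : s 0 = enc_bits w ++ v -> size w <= L ->
  r > 2 -> s 2 = [::] -> s r = [::] ->
  run L (pdecode r) s = upd (upd s 0 v) r w.
Proof.
move=> E0 le_L gt_r E2 Er.
rewrite /pdecode run_seqs run_loop; set f := run L (PCase _ _ _ _).
have loop n u s' : size u <= n -> s' 0 = enc_bits u ++ v -> iter n f s' =
    upd (upd s' 0 (false :: v)) 2 (catrev u (s' 2)).
  elim: n u s' => [|n IHn] [|b u] s' //= le_n F0.
  - by rewrite -F0 !upd_same.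
  - rewrite -iterS iter_fix; last by rewrite /f run_case F0.
    by rewrite -F0 !upd_same.
  - rewrite -iterS iterSr.
    have fE : f s' = upd (upd s' 0 (enc_bits u ++ v)) 2 (b :: s' 2).
      rewrite /f run_case F0 run_seq run_pop F0 run_case upd_eq /=.
      by case: b F0 => F0; rewrite run_seq run_pop upd_eq run_push upd_upd.
    rewrite fE (IHn u) //; apply: functional_extensionality => q.
    by rewrite /upd /=; case: (q == 2); case: (q == 0).
rewrite (loop L w s le_L E0) E2 run_seqs run_pop.
have neq2r : 2 != r by lia.
have neq0r : r == 0 = false by lia.
have neqr2 : r == 2 = false by lia.
rewrite run_seqs run_move // run_seqs0.
apply: functional_extensionality => q; rewrite /upd /= neq0r neqr2 Er catrevK cats0.
case: (q =P 2) => [->|_]; first by rewrite (negbTE neq2r) E2.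
by case: (q == r); case: (q == 0).
Qed.

(** Reading past the end is harmless. Six vertices can therefore be decoded from every kind of
    answer, missing ones becoming the empty string, which is also the default of [nth] in
    [pigeon_answer]. *)
Lemma run_decode_nil L r s : s 0 = [::] -> s 2 = [::] -> r > 2 ->
  run L (pdecode r) s = s.
Proof.
move=> E0 E2 gt_r; rewrite /pdecode run_seqs run_loop iter_fix; last first.
  by rewrite run_case E0.
have neq2r : 2 != r by lia.
rewrite run_seqs run_pop E0 run_seqs run_move // run_seqs0.
apply: functional_extensionality => q; rewrite /upd /= E2.
case: (q =P 2) => [->|_]; first by rewrite E2.
case: (q =P r) => [->|_]; first by case: (r =P 0) => [->|_].
by case: (q =P 0) => [->|_].
Qed.

Lemma run_decode_head L r vs s : s 0 = flatten (map enc_bits vs) ->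
  all (fun v => size v <= L) vs -> r > 2 -> s 2 = [::] -> s r = [::] ->
  run L (pdecode r) s =
  upd (upd s 0 (flatten (map enc_bits (behead vs)))) r (head [::] vs).
Proof.
case: vs => [|v vs] /= E0.
  move=> _ gt_r E2 Er; rewrite run_decode_nil //.
  apply: functional_extensionality => q; rewrite /upd.
  by case: (q =P r) => [->|_] //; case: (q =P 0) => [->|_].
by case/andP=> le_v _ gt_r E2 Er; apply: run_decode.
Qed.

Definition pload (r : nat) : prog := PSeq (PMove r 2) (PMove 2 0).

Lemma run_load L r s : r > 2 -> s 2 = [::] -> s 0 = [::] ->
  run L (pload r) s = upd (upd s 0 (s r)) r [::].
Proof.
move=> gt_r E2 E0.
have ne : ((r == 2 = false) * (2 == r = false)) *
          ((r == 0 = false) * (0 == r = false)) by do ?split; lia.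
have r2 : r != 2 by lia.
rewrite /pload run_seq run_move // run_move //.
apply: functional_extensionality => q; rewrite /upd /= !ne E2 E0 catrevK cats0.
case: (q =P 2) => [->|_]; first by rewrite ?ne E2.
by case: (q =P 0) => [->|_] //; rewrite ?ne.
Qed.

(** The tag of the answer is read and dropped. Register 30 first carries the answer and, once this
    is loaded, receives c. [prepeat] builds its word reversed, whence [[:: false; true]] for c =
    1010...10. *)
Definition decode_prefix : seq prog :=
  [:: pdecode 31; pdecode 30; pload 30; pscan_nat 4; pclear 3; pclear 4;
    pdecode 22; pdecode 23; pdecode 24; pdecode 25; pdecode 26; pdecode 27;
    pload 31; pscan_nat 7; pclear 3;
    prepeat 28 [:: false; false]; prepeat 29 [:: true; true];
    prepeat 30 [:: false; true];
    pcopy 7 11 2; pcopy 7 11 2; pcopy 7 13 2; pcopy 7 13 2].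

(** The first three searches compare corresponding edges of the two triangles in (iv), the fourth
    the edges xy and yz of (iii), the last the edges ab and ac of (i). *)
Definition search_prog : prog :=
  pseqs (decode_prefix ++
    [:: psearch 22 23 25 26; psearch 22 24 25 27; psearch 23 24 26 27;
      psearch 22 23 23 24; psearch 28 29 28 30]).

Definition answer_vertices (t : ws_answer) : seq (seq bool) :=
  match t with
  | WSZero => [::]
  | WSPair x y => [:: x; y]
  | WSTriple x y z => [:: x; y; z]
  | WSTwoTriples x y z x' y' z' => [:: x; y; z; x'; y'; z']
  end.

Definition answer_tag (t : ws_answer) : nat :=
  match t with
  | WSZero => 0
  | WSPair _ _ => 1
  | WSTriple _ _ _ => 2
  | WSTwoTriples _ _ _ _ _ _ => 3
  end.

Lemma enc_ws_answerE t : enc_ws_answer t =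
  enc_nat (answer_tag t) ++ flatten (map enc_bits (answer_vertices t)).
Proof. by case: t => *; rewrite /= ?cats0. Qed.

Definition pigeon_answer (n : nat) (C : circuit) (t : ws_answer) : seq bool :=
  let v k := nth [::] (answer_vertices t) k in
  let a := repeat_bits n [:: false; false] in
  let b := repeat_bits n [:: true; true] in
  let c := repeat_bits n [:: true; false] in
  search n C a b a c
    (search n C (v 0) (v 1) (v 1) (v 2)
      (search n C (v 1) (v 2) (v 4) (v 5)
        (search n C (v 0) (v 2) (v 3) (v 5)
          (search n C (v 0) (v 1) (v 3) (v 4) [::])))).

Lemma rev_repeat_bits n w : rev (repeat_bits n w) = repeat_bits n (rev w).
Proof.
rewrite /repeat_bits; elim: n => // n IHn.
by rewrite -addn1 nseqD !flatten_cat rev_cat IHn addnC nseqD flatten_cat /= !cats0.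
Qed.

Lemma nth_head_behead (T : Type) (x : T) k s :
  head x (iter k behead s) = nth x s k.
Proof. by elim: k s => [|k IHk] s; rewrite ?nth0 // iterSr IHk nth_behead. Qed.

Lemma run_decode_prefix L n C t :
  size (enc_wp_instance (WPInstance n C)) <= L -> size (enc_ws_answer t) <= L ->
  n + n <= L -> all (fun v => size v <= L) (answer_vertices t) ->
  let s := run L (pseqs decode_prefix) (input_store
    (pairing (enc_wp_instance (WPInstance n C)) (enc_ws_answer t))) in
  idle n C [::] s /\
  [/\ forall k, k < 6 -> s (22 + k) = nth [::] (answer_vertices t) k,
    s 28 = repeat_bits n [:: false; false], s 29 = repeat_bits n [:: true; true]
    & s 30 = repeat_bits n [:: true; false]].
Proof.
move=> le_x le_s le_n le_v.
have lt_tag : answer_tag t < L.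
  by move: le_s; rewrite enc_ws_answerE size_cat size_rcons size_nseq; lia.
have lt_n : n < L.
  by move: le_x; rewrite /enc_wp_instance size_cat size_rcons size_nseq /=; lia.
have le_n' : n <= L by lia.
set s0 := input_store _.
have E0 r : r != 0 -> s0 r = [::] by rewrite /s0 /input_store => /negbTE->.
rewrite /decode_prefix run_seqs.
rewrite (@run_decode _ _ (enc_wp_instance (WPInstance n C))
  (enc_bits (enc_ws_answer t))) //; set s1 := upd _ 31 _.
rewrite run_seqs (@run_decode _ _ (enc_ws_answer t) [::] s1) //; last first.
  by rewrite cats0.
set s2 := upd _ 30 _; rewrite run_seqs run_load //.
rewrite -[s2 30]/(enc_ws_answer t); set s3 := upd _ 30 _.
have F3 : s3 0 = enc_nat (answer_tag t) ++
    flatten (map enc_bits (answer_vertices t)) by exact: enc_ws_answerE.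
rewrite run_seqs (run_scan_nat (r := 4) isT F3 (ltnW lt_tag)).
rewrite -[s3 3]/[::] -[s3 4]/[::]; set s4 := upd _ 4 _.
rewrite run_seqs run_clear; last first.
  by rewrite -[s4 3]/(catrev _ [::]) catrevE cats0 size_rev size_rcons size_nseq.
rewrite run_seqs run_clear; last first.
  by rewrite -[upd _ _ _ 4]/(nseq _ true ++ [::]) cats0 size_nseq ltnW.
set s6 := upd _ 4 _; pose vs := answer_vertices t.
have E6 r : r \notin [:: 0; 31] -> s6 r = [::].
  rewrite !inE negb_or => /andP[r0 r31].
  have [->|r4] := eqVneq r 4; first by [].
  have [->|r3] := eqVneq r 3; first by [].
  have [->|r30] := eqVneq r 30; first by [].
  by rewrite /s6 /s4 /s3 /s2 /s1 !upd_neq ?E0.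
have E60 : s6 0 = flatten (map enc_bits vs) by [].
have E31 : s6 31 = enc_wp_instance (WPInstance n C) by [].
move: s6 E6 E60 E31 => s6 E6 E60 E31 {s1 s2 s3 F3 s4}.
have le_b k : all (fun v => size v <= L) (iter k behead vs).
  by elim: k => //= k; case: (iter k behead vs) => //= v l /andP[].
have dec k s' : s' 0 = flatten (map enc_bits (iter k behead vs)) ->
    s' 2 = [::] -> s' (22 + k) = [::] ->
    run L (pdecode (22 + k)) s' =
    upd (upd s' 0 (flatten (map enc_bits (iter k.+1 behead vs))))
        (22 + k) (nth [::] vs k).
  by move=> F0 F2 Fk; rewrite (run_decode_head F0 (le_b k)) // nth_head_behead.
pose F k := upd (foldl (fun s' i => upd s' (22 + i) (nth [::] vs i)) s6 (iota 0 k))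
   0 (flatten (map enc_bits (iter k behead vs))).
have FS k : k < 6 -> run L (pdecode (22 + k)) (F k) = F k.+1.
  move=> lt_k; rewrite dec //.
  - rewrite {2}/F -addn1 iotaD foldl_cat /= add0n /F upd_upd.
    by rewrite updC.
  - by case: k lt_k => [|[|[|[|[|[|k]]]]]] // _; rewrite -[LHS]/(s6 2) E6.
  - by case: k lt_k => [|[|[|[|[|[|k]]]]]] // _; rewrite -[LHS]/(s6 _) E6.
have -> : s6 = F 0 by rewrite /F /= -E60 upd_same.
rewrite run_seqs (FS 0) // run_seqs (FS 1) // run_seqs (FS 2) // run_seqs (FS 3) //.
rewrite run_seqs (FS 4) // run_seqs (FS 5) //.
have v6 : iter 6 behead vs = [::].
  by rewrite /vs; case: t {le_s le_v lt_tag s0 E0 vs E60 le_b dec F FS}.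
rewrite run_seqs run_load //; last 2 first.
- by rewrite -[LHS]/(s6 2) E6.
- by rewrite /F v6.
rewrite -[F 6 31]/(s6 31) E31.
set s7 := upd _ 31 _.
have G0 : s7 0 = enc_nat n ++ enc_circuit C by [].
have Gv k : k < 6 -> s7 (22 + k) = nth [::] vs k.
  by case: k => [|[|[|[|[|[|k]]]]]].
have Gr r : r \notin [:: 0; 22; 23; 24; 25; 26; 27] -> s7 r = [::].
  rewrite !inE !negb_or; case/and5P=> r0 r22 r23 r24 /and3P[r25 r26 r27].
  have [->|r31] := eqVneq r 31; first by [].
  by rewrite /s7 /F /= !upd_neq ?E6 // !inE negb_or r0.
move: s7 G0 Gv Gr => s7 G0 Gv Gr {F FS dec}.
rewrite run_seqs (run_scan_nat (r := 7) isT G0 le_n').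
rewrite (Gr 3) // (Gr 7) // cats0 run_seqs run_clear; last first.
  by rewrite /upd /= catrevE cats0 size_rev size_rcons size_nseq.
have -> : upd (upd (upd (upd s7 0 (enc_circuit C)) 3 (catrev (enc_nat n) [::]))
    7 (nseq n true)) 3 [::] = upd (upd s7 0 (enc_circuit C)) 7 (nseq n true).
  apply: functional_extensionality => q; rewrite /upd.
  by case: (q =P 3) => [->|_] //; rewrite /= Gr.
set s8 := upd _ 7 _.
have H7 : s8 7 = nseq n true by [].
rewrite run_seqs (run_repeat (r := 28) _ isT H7 (Gr 2 isT) le_n').
rewrite -[s8 28]/(s7 28) (Gr 28) // -/(rev _) rev_repeat_bits; set s9 := upd _ 28 _.
rewrite run_seqs (run_repeat (r := 29) (s := s9) _ isT H7 (Gr 2 isT) le_n').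
rewrite -[s9 29]/(s7 29) (Gr 29) // -/(rev _) rev_repeat_bits; set s10 := upd _ 29 _.
rewrite run_seqs (run_repeat (r := 30) (s := s10) _ isT H7 (Gr 2 isT) le_n').
rewrite -[s10 30]/(s7 30) (Gr 30) // -/(rev _) rev_repeat_bits; set s11 := upd _ 30 _.
have cn a : catrev (nseq n true) (nseq a true) = nseq (n + a) true.
  by rewrite catrevE rev_nseq nseqD.
have st r a s' : r \notin [:: 2; 7] -> s' 7 = nseq n true -> s' 2 = [::] ->
    run L (pcopy 7 r 2) (upd s' r (nseq a true)) = upd s' r (nseq (n + a) true).
  rewrite !inE negb_or => /andP[r2 r7] F7 F2.
  have G7 : upd s' r (nseq a true) 7 = nseq n true by rewrite upd_neq 1?eq_sym.
  rewrite run_copy ?G7 ?size_nseq //.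
  - by rewrite upd_eq upd_upd cn.
  - by rewrite /= !inE negb_or r2 eq_sym r7.
  - by rewrite upd_neq 1?eq_sym.
have -> : run L (pseqs [:: pcopy 7 11 2; pcopy 7 11 2; pcopy 7 13 2;
    pcopy 7 13 2]) s11 =
    upd (upd s11 11 (nseq (n + n) true)) 13 (nseq (n + n) true).
  have F11 : s11 = upd s11 11 (nseq 0 true).
    by rewrite (_ : nseq 0 true = s11 11) ?upd_same // -[RHS]/(s7 11) Gr.
  rewrite run_seqs {1}F11 st //; last exact: (Gr 2 isT).
  rewrite run_seqs st //; last exact: (Gr 2 isT).
  set s12 := upd s11 11 _.
  have F13 : s12 = upd s12 13 (nseq 0 true).
    by rewrite (_ : nseq 0 true = s12 13) ?upd_same // -[RHS]/(s7 13) Gr.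
  rewrite run_seqs {1}F13 st //; last exact: (Gr 2 isT).
  rewrite run_seqs st //; last exact: (Gr 2 isT).
  by rewrite /s12 run_seqs0 !addn0.
split.
  split=> //; first exact: (Gr 1).
  move=> r; rewrite !inE; do ?[case/orP]; move/eqP->; by rewrite -[LHS]/(s7 _) Gr.
split=> // k lt_k; rewrite -[nth _ _ _](Gv k lt_k).
by case: k lt_k => [|[|[|[|[|[|k]]]]]].
Qed.

Lemma search_sizes n C x y x' y' out l : size (outputs C) = n.-1 -> 0 < n ->
  size out <= (2 * n + 1) + (2 * n + 1) ->
  let t := foldl (search_step C x y x' y')
    (nseq n false, nseq n false, out) l in
  [/\ size t.1.1 = n, size t.1.2 = n & size t.2 <= (2 * n + 1) + (2 * n + 1)].
Proof.
move=> sz_o n_gt0 le_out; elim/last_ind: l => [|l p] /=.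
  by rewrite !size_nseq.
rewrite foldl_rcons; set t := foldl _ _ _ => -[sz1 sz2 sz3] /=.
rewrite !size_ceval sz_o prednK //; split=> //.
by apply: size_new_answer => //; rewrite ?sz1 ?sz2.
Qed.

Lemma size_search n C x y x' y' out : size (outputs C) = n.-1 -> 0 < n ->
  size out <= (2 * n + 1) + (2 * n + 1) ->
  size (search n C x y x' y' out) <= (2 * n + 1) + (2 * n + 1).
Proof.
move=> sz_o n_gt0 le_out.
have [sz1 sz2 sz3] := search_sizes x y x' y' (pairs (n + n) (n + n)) sz_o n_gt0 le_out.
by apply: size_new_answer => //; rewrite ?sz1 ?sz2.
Qed.

Lemma run_search_prog L n C t : bounded_circuit L C ->
  size (outputs C) = n.-1 -> 0 < n -> n + size (gates C) <= L ->
  (2 * n + 1) + (2 * n + 1) <= L ->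
  size (enc_wp_instance (WPInstance n C)) <= L -> size (enc_ws_answer t) <= L ->
  all (fun v => size v <= L) (answer_vertices t) ->
  run L search_prog (input_store
    (pairing (enc_wp_instance (WPInstance n C)) (enc_ws_answer t))) 1 =
  catrev (pigeon_answer n C t) [::].
Proof.
move=> bC sz_o n_gt0 le_L le_L' le_x le_s le_v.
rewrite /search_prog run_seqs_cat.
have le_2n : n + n <= L by lia.
have [id0 [Ev E28 E29 E30]] := run_decode_prefix le_x le_s le_2n le_v.
set s := run L _ _ in id0 Ev E28 E29 E30 *.
have sz_v r : r > 21 -> r < 31 -> size (s r) <= L.
  move=> gt_r lt_r; have [lt_r28|ge_r] := ltnP r 28.
    have -> : r = 22 + (r - 22) by lia.
    rewrite Ev; last by lia.
    have [lt_k|le_k] := ltnP (r - 22) (size (answer_vertices t)).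
      by move/(all_nthP [::]): le_v; apply.
    by rewrite nth_default.
  have : r \in [:: 28; 29; 30] by rewrite !inE; lia.
  by rewrite !inE; case/or3P=> /eqP->; rewrite ?E28 ?E29 ?E30 size_repeat_bits /=;
    lia.
have st x y x' y' out s' : idle n C out s' -> (forall r, r > 21 -> s' r = s r) ->
    size out <= (2 * n + 1) + (2 * n + 1) ->
    all (fun r => 21 < r < 31) [:: x; y; x'; y'] ->
    [/\ idle n C (search n C (s x) (s y) (s x') (s y') out)
          (run L (psearch x y x' y') s'),
        forall r, r > 21 -> run L (psearch x y x' y') s' r = s r &
        size (search n C (s x) (s y) (s x') (s y') out) <=
          (2 * n + 1) + (2 * n + 1)].
  move=> Is' Es' le_out rng; have [r1 r2 r3 r4] : [/\ 21 < x < 31, 21 < y < 31,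
    21 < x' < 31 & 21 < y' < 31] by case/and5P: rng.
  have le_r r : r \in [:: x; y; x'; y'] -> size (s' r) <= L.
    move=> /(allP rng) /andP[gt_r lt_r]; rewrite Es' //; exact: sz_v.
  case/andP: r1 => gx _; case/andP: r2 => gy _; case/andP: r3 => gx' _.
  case/andP: r4 => gy' _.
  have [] := run_search bC sz_o n_gt0 le_L le_L' le_out gx gy gx' gy' le_r Is'.
  rewrite !Es' // => H1 H2; split=> //; last exact: size_search.
  by move=> r gt_r; rewrite H2 // Es'.
have [id1 F1 sz1] := st 22 23 25 26 [::] s id0 (fun r _ => erefl) isT isT.
have [id2 F2 sz2] := st 22 24 25 27 _ _ id1 F1 sz1 isT.
have [id3 F3 sz3] := st 23 24 26 27 _ _ id2 F2 sz2 isT.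
have [id4 F4 sz4] := st 22 23 23 24 _ _ id3 F3 sz3 isT.
have [[_ E1 _ _ _] _ _] := st 28 29 28 30 _ _ id4 F4 sz4 isT.
rewrite 5!run_seqs run_seqs0 E1; congr (catrev _ _).
rewrite /pigeon_answer E28 E29 E30.
by rewrite (Ev 0) // (Ev 1) // (Ev 2) // (Ev 3) // (Ev 4) // (Ev 5).
Qed.

(** * Correctness of the reductions *)

Lemma wire_values_cat gs gs' v :
  wire_values (gs ++ gs') v = wire_values gs' (wire_values gs v).
Proof. exact: foldl_cat. Qed.

Lemma wire_values_cons g gs v :
  wire_values (g :: gs) v = wire_values gs (rcons v (gate_value v g)).
Proof. by []. Qed.

Lemma wire_values_const n b v :
  wire_values (nseq n (GConst b)) v = v ++ nseq n b.
Proof.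
elim: n v => [|n IHn] v; first by rewrite cats0.
by rewrite -[nseq n.+1 _]/(_ :: nseq n _) wire_values_cons IHn cat_rcons.
Qed.

Lemma nth_cat_shift (pre u : seq bool) i :
  nth false (pre ++ u) (size pre + i) = nth false u i.
Proof. by rewrite nth_cat ltnNge leq_addr /= addKn. Qed.

(** Shifted gates never look at the prefix, so a copy of C placed after other wires computes as it
    would on its own. *)
Lemma wire_values_shift gs pre u :
  wire_values (map (shift_gate (size pre)) gs) (pre ++ u) =
  pre ++ wire_values gs u.
Proof.
elim: gs u => // g gs IHgs u; rewrite [map _ _]/= !wire_values_cons rcons_cat -IHgs.
by congr (wire_values _ (_ ++ rcons _ _)); case: g => //= *;
  rewrite !nth_cat_shift.
Qed.

Lemma wire_values_copy os w B : all (fun o => B + o < size w) os ->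
  wire_values (copy_gates B os) w = w ++ [seq nth false w (B + o) | o <- os].
Proof.
elim: os w => [|o os IHos] w; first by rewrite cats0.
case/andP=> lt_o lt_os; rewrite [copy_gates _ _]/= wire_values_cons IHos.
  rewrite [gate_value _ _]/= andbb cat_rcons; congr (_ ++ _ :: _).
  apply/eq_in_map => o' o'_os.
  by rewrite nth_rcons (allP lt_os).
by apply: sub_all lt_os => o'; rewrite size_rcons => /ltnW.
Qed.

Lemma wire_values_mix n i j v : n + n + (n + n) <= size v ->
  i < n + n -> j < n + n ->
  let w k := nth false v k in
  let yj := ~~ w (n + n + j) in
  let xj := ~~ w j in
  wire_values (mix_gates n i j (size v)) v =
  v ++ [:: yj; xj; w i && yj; w (n + n + i) && xj;
           (w i && yj) || (w (n + n + i) && xj)].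
Proof.
move=> le_v lt_i lt_j w yj xj; rewrite /mix_gates !wire_values_cons /=.
have lt1 : i < size v by lia.
have lt2 : n + n + i < size v by lia.
have lt3 : j < size v by lia.
rewrite -!cats1 -!catA /=.
rewrite !nth_cat lt1 lt2 lt3 ltnn subnn.
do ?[rewrite ifF; last by lia].
have -> : (size v).+1 - size v = 1 by lia.
have -> : (size v).+2 - size v = 2 by lia.
have -> : (size v).+3 - size v = 3 by lia.
by [].
Qed.

Lemma nth_wire_values gs v k : k < size v ->
  nth false (wire_values gs v) k = nth false v k.
Proof.
elim: gs v => // g gs IHgs v lt_k; rewrite wire_values_cons IHgs.
  by rewrite nth_rcons lt_k.
by rewrite size_rcons ltnW.
Qed.

Definition chain (n : nat) (C : circuit) (x y : seq bool)
    (l : seq (nat * nat)) : seq bool :=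
  foldl (chain_step C x y) (nseq n false) l.

Section Hash.

Variables (n : nat) (C : circuit) (x y : seq bool).
Hypotheses (n_gt0 : 0 < n) (C_ok : is_circuit n n.-1 C).
Hypotheses (size_x : size x = n + n) (size_y : size y = n + n).

Lemma size_outputs_ok : size (outputs C) = n.-1.
Proof. by case/and3P: C_ok => _ _ /eqP. Qed.

(** The state is always the last n wires. A block absorbs the old state into the prefix, whose first
    4n wires must be remembered because the mixing gates read x and y there. *)
Lemma wire_values_block pre u i j : size u = n ->
  n + n + (n + n) <= size pre -> take (n + n + (n + n)) pre = x ++ y ->
  i < n + n -> j < n + n ->
  exists2 pre', size pre' = size pre + block_size n C /\
      take (n + n + (n + n)) pre' = x ++ y
    & wire_values (block n C (size pre) (i, j)) (pre ++ u) =
      pre' ++ chain_step C x y u (i, j).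
Proof.
move=> size_u le_pre take_pre lt_i lt_j.
pose w := wire_values (gates C) u.
have size_w : size w = n + size (gates C) by rewrite size_wire_values size_u.
have wx k : k < n + n -> nth false (pre ++ w) k = nth false x k.
  move=> lt_k; rewrite nth_cat ifT; last by lia.
  by rewrite -(nth_take _ (_ : k < n + n + (n + n))) ?take_pre ?nth_cat ?size_x
    ?lt_k //; lia.
have wy k : k < n + n -> nth false (pre ++ w) (n + n + k) = nth false y k.
  move=> lt_k; rewrite nth_cat ifT; last by lia.
  rewrite -(nth_take _ (_ : n + n + k < n + n + (n + n))); last by lia.
  by rewrite take_pre -{1}size_x nth_cat_shift.
have mixE := @wire_values_mix n i j (pre ++ w).
cbv zeta in mixE.
rewrite size_cat size_w (wx i) // (wx j) // (wy i) // (wy j) // in mixE.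
rewrite /block !wire_values_cat wire_values_shift -/w -(addnA (size pre)).
rewrite [(i, j).1]/= [(i, j).2]/=.
rewrite mixE //=; last by lia.
set h := [:: _; _; _; _; _].
(* Four mixing gates go into the prefix; the fifth is the head of the new state. *)
pose h4 := take 4 h; pose m := mix x y (i, j).
have hE : h = rcons h4 m by rewrite /h /h4 /m /mix.
exists (pre ++ w ++ h4).
  split; first by rewrite !size_cat size_w /block_size /=; lia.
  by rewrite takel_cat.
rewrite wire_values_copy; last first.
  rewrite -catA; case/and3P: C_ok => _ lt_o _; apply: sub_all lt_o => o lt_o.
  by rewrite !size_cat size_w; lia.
rewrite hE -cats1 -!catA; congr (_ ++ _ ++ _ ++ _).
rewrite /chain_step /= -/m; congr (_ :: _).
apply/eq_in_map => o o_C; rewrite nth_cat_shift nth_cat size_w.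
by case/and3P: C_ok => _ /allP/(_ o o_C) -> _.
Qed.

Lemma size_chain l : size (chain n C x y l) = n.
Proof.
elim/last_ind: l => [|l p _]; first by rewrite size_nseq.
by rewrite /chain foldl_rcons /= size_ceval size_outputs_ok prednK.
Qed.

Lemma wire_values_blocks l pre u : size u = n ->
  n + n + (n + n) <= size pre -> take (n + n + (n + n)) pre = x ++ y ->
  all (fun p => (p.1 < n + n) && (p.2 < n + n)) l ->
  exists2 pre', size pre' = size pre + size l * block_size n C
    & wire_values (blocks n C (size pre) l) (pre ++ u) =
      pre' ++ foldl (chain_step C x y) u l.
Proof.
elim: l pre u => [|[i j] l IHl] pre u size_u le_pre take_pre.
  by move=> _; exists pre; rewrite ?addn0.
case/andP=> /andP[lt_i lt_j] lt_l.
have [pre1 [size1 take1] E1] := wire_values_block size_u le_pre take_pre lt_i lt_j.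
have [||pre2 size2 E2] := IHl pre1 (chain_step C x y u (i, j)) _ _ take1 lt_l.
- by rewrite /= size_ceval size_outputs_ok prednK.
- by rewrite size1; lia.
exists pre2; first by rewrite size2 size1 /= mulSn addnA.
by rewrite [blocks _ _ _ _]/= wire_values_cat E1 -size1 E2.
Qed.

Lemma all_pairs :
  all (fun p => (p.1 < n + n) && (p.2 < n + n)) (pairs (n + n) (n + n)).
Proof.
apply/allP => -[i j] /allpairsP[[i' j'] [/= i_ j_ [-> ->]]].
by move: i_ j_; rewrite !mem_iota /= !add0n => -> ->.
Qed.

Lemma ceval_hash_circuit : ceval (hash_circuit n C) (x ++ y) =
  false :: ceval C (chain n C x y (pairs (n + n) (n + n))).
Proof.
have size_xy : size (x ++ y) = n + n + (n + n) by rewrite size_cat size_x size_y.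
rewrite /hash_circuit /ceval /=; set l := pairs _ _.
rewrite !wire_values_cat wire_values_const.
have [|||pre size_pre E] :=
  @wire_values_blocks l (x ++ y) (nseq n false) _ _ _ all_pairs.
- by rewrite size_nseq.
- by rewrite size_xy.
- by rewrite -size_xy take_size.
have baseE : last_base n C = size pre by rewrite size_pre size_xy.
(* Wire 4n is the first wire after the inputs, a constant [false], and later gates do not alter
   it. *)
have first_wire gs : nth false (wire_values gs ((x ++ y) ++ nseq n false))
    (n + n + (n + n)) = false.
  rewrite nth_wire_values; last by rewrite size_cat size_xy size_nseq; lia.
  by rewrite -size_xy -[X in nth _ _ X]addn0 nth_cat_shift nth_nseq if_same.
rewrite -!wire_values_cat first_wire wire_values_cat -size_xy E baseE.
rewrite wire_values_shift -map_comp; congr (_ :: _); apply: eq_map => o /=.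
by rewrite nth_cat_shift.
Qed.

End Hash.

Lemma wf_gates_cat k gs gs' :
  wf_gates k (gs ++ gs') = wf_gates k gs && wf_gates (k + size gs) gs'.
Proof.
elim: gs k => [|g gs IHgs] k /=; first by rewrite addn0.
by rewrite IHgs andbA addSnnS.
Qed.

Lemma wf_gates_shift B k gs : wf_gates k gs ->
  wf_gates (B + k) (map (shift_gate B) gs).
Proof.
elim: gs k => //= g gs IHgs k /andP[ok_g /IHgs]; rewrite addnS => ->.
by rewrite andbT; case: g ok_g => //= *; rewrite !ltn_add2l.
Qed.

Lemma wf_gates_copy k B os : all (fun o => B + o < k) os ->
  wf_gates k (copy_gates B os).
Proof.
elim: os k => //= o os IHos k /andP[-> /= lt_os]; apply: IHos.
by apply: sub_all lt_os => o' /ltnW.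
Qed.

Lemma wf_gates_const k n b : wf_gates k (nseq n (GConst b)).
Proof. by elim: n k => //= n IHn k. Qed.

Lemma size_block n C B p : size (outputs C) = n.-1 -> 0 < n ->
  size (block n C B p) = block_size n C.
Proof.
move=> sz n_gt0; rewrite /block /block_size !size_cat !size_map sz /=; lia.
Qed.

Lemma wf_gates_blocks n C B l : is_circuit n n.-1 C -> 0 < n ->
  n + n + (n + n) <= B ->
  all (fun p => (p.1 < n + n) && (p.2 < n + n)) l ->
  wf_gates (B + n) (blocks n C B l) /\
  size (blocks n C B l) = size l * block_size n C.
Proof.
case/and3P=> wf_C lt_o /eqP sz_o n_gt0.
elim: l B => //= -[i j] l IHl B le_B /andP[/andP[/= lt_i lt_j] lt_l].
have [|wf_l sz_l] := IHl (B + block_size n C) _ lt_l; first by lia.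
split; last by rewrite size_cat size_block // sz_l mulSn.
rewrite wf_gates_cat size_block //.
rewrite -addnA [n + _]addnC addnA wf_l andbT /block !wf_gates_cat.
rewrite wf_gates_shift //= !size_map.
rewrite wf_gates_copy; first by lia.
by apply: sub_all lt_o => o; lia.
Qed.

Lemma hash_circuit_ok n C : 0 < n -> is_circuit n n.-1 C ->
  is_circuit (2 * n + 2 * n) n (hash_circuit n C).
Proof.
move=> n_gt0 C_ok; have [wf_C lt_o /eqP sz_o] := and3P C_ok.
rewrite !mul2n -!addnn; set N := n + n + (n + n).
have le_N : N <= N by [].
have [wf_b sz_b] := wf_gates_blocks C_ok n_gt0 le_N (all_pairs n).
have sz : size (gates (hash_circuit n C)) =
    n + size (pairs (n + n) (n + n)) * block_size n C + size (gates C).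
  by rewrite !size_cat size_nseq size_map sz_b addnA.
have szo : size (outputs (hash_circuit n C)) = n.
  by rewrite /= size_map sz_o prednK.
rewrite /is_circuit szo eqxx andbT sz; apply/andP; split.
  rewrite !wf_gates_cat wf_gates_const size_nseq wf_b sz_b /=.
  rewrite addnAC -/(last_base n C); exact: wf_gates_shift.
rewrite /=; apply/andP; split; first by lia.
rewrite all_map; apply: sub_all lt_o => o /=.
by rewrite /last_base -/N; lia.
Qed.

(** * From equal colours to a collision of C *)

Lemma mixC x y p : mix x y p = mix y x p.
Proof. by rewrite /mix orbC. Qed.

(** The diagonal bit at (p, p) is the exclusive or of x_p and y_p. As x and y differ, some p has
    diagonal bit 1, and then x' and y' differ at p too. Row and column p reveal both strings; which
    of them has a 1 at p decides between the two orders. *)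
Lemma mix_inj m x y x' y' : size x = m -> size y = m -> size x' = m ->
  size y' = m -> x <> y -> x' <> y' ->
  (forall p, p \in pairs m m -> mix x y p = mix x' y' p) ->
  (x = x' /\ y = y') \/ (x = y' /\ y = x').
Proof.
move=> sx sy sx' sy' neq neq' E.
have {}E i j : i < m -> j < m -> mix x y (i, j) = mix x' y' (i, j).
  by move=> lt_i lt_j; apply: E; apply/allpairsP; exists (i, j);
    rewrite /= !mem_iota.
have [p lt_p neq_p] : exists2 p, p < m & nth false x p != nth false y p.
  have [/hasP[p p_m neq_p]|/hasPn no] :=
    boolP (has (fun p => nth false x p != nth false y p) (iota 0 m)).
    by exists p => //; move: p_m; rewrite mem_iota.
  case: neq; apply: (@eq_from_nth _ false) => [|k lt_k]; first by rewrite sx.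
  by apply/eqP; have := no k; rewrite mem_iota -sx negbK; apply.
(* With x_p = 1 and y_p = 0, the bits of the pairs (j, p) are those of x and
   the bits of the pairs (p, j) are the negations of those of y. *)
have aux u v u' v' : size u = m -> size v = m -> size u' = m -> size v' = m ->
    nth false u p -> ~~ nth false v p -> nth false u' p -> ~~ nth false v' p ->
    (forall i j, i < m -> j < m -> mix u v (i, j) = mix u' v' (i, j)) ->
    u = u' /\ v = v'.
  move=> su sv su' sv' up vp up' vp' Euv; split.
    apply: (@eq_from_nth _ false) => [|k]; rewrite su ?su' // => lt_k.
    have := Euv k p lt_k lt_p; rewrite /mix /= up up' (negbTE vp) (negbTE vp').
    by rewrite !andbT !andbF !orbF.
  apply: (@eq_from_nth _ false) => [|k]; rewrite sv ?sv' // => lt_k.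
  have := Euv p k lt_p lt_k; rewrite /mix /= up up' (negbTE vp) (negbTE vp').
  by rewrite !orbF /= => /negb_inj.
have EC i j (lt_i : i < m) (lt_j : j < m) : mix y x (i, j) = mix x' y' (i, j).
  by rewrite mixC; apply: E.
have ED i j (lt_i : i < m) (lt_j : j < m) : mix x y (i, j) = mix y' x' (i, j).
  by rewrite [RHS]mixC; apply: E.
have EE i j (lt_i : i < m) (lt_j : j < m) : mix y x (i, j) = mix y' x' (i, j).
  by rewrite mixC [RHS]mixC; apply: E.
have yp : nth false y p = ~~ nth false x p.
  by move: neq_p; case: (nth false x p); case: (nth false y p).
(* Read off from the diagonal bit at p. *)
have yp' : nth false y' p = ~~ nth false x' p.
  have := E p p lt_p lt_p; rewrite /mix /= yp.
  by case: (nth false x p); case: (nth false x' p); case: (nth false y' p).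
case xp: (nth false x p) yp => yp; case xp': (nth false x' p) yp' => yp'.
- by have [] := aux x y x' y'; rewrite ?yp ?xp ?yp' ?xp' //; left.
- by have [] := aux x y y' x'; rewrite ?yp ?xp ?yp' ?xp' //; right.
- by have [] := aux y x x' y'; rewrite ?yp ?xp ?yp' ?xp' //; right.
- by have [] := aux y x y' x'; rewrite ?yp ?xp ?yp' ?xp' //; left.
Qed.

Definition pigeon_pair (n : nat) (C : circuit) (o : seq bool) : Prop :=
  exists2 t, o = enc_wp_solution t & wp_solution (WPInstance n C) t.

Lemma new_answer_pair n C u v out : size u = n -> size v = n ->
  pigeon_pair n C out \/ u != v /\ ceval C u = ceval C v ->
  pigeon_pair n C (new_answer C u v out).
Proof.
move=> su sv H; rewrite /new_answer; case: ifP => [/andP[/eqP E neq]|].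
  by exists (u, v) => //; split=> //; apply/eqP.
by case: H => // -[neq E]; rewrite E eqxx neq.
Qed.

Section Search.

Variables (n : nat) (C : circuit) (x y x' y' : seq bool).
Hypotheses (n_gt0 : 0 < n) (C_ok : is_circuit n n.-1 C).

Let run_search_steps out l := foldl (search_step C x y x' y')
  (nseq n false, nseq n false, out) l.

Lemma search_steps_chain out l :
  (run_search_steps out l).1 = (chain n C x y l, chain n C x' y' l).
Proof.
elim/last_ind: l => // l p IHl.
by rewrite /run_search_steps /chain !foldl_rcons -/(run_search_steps _ _)
  /search_step IHl.
Qed.

(** Nothing is assumed about the four strings: a state consists of one bit and a value of C, so it
    always has length n, and every replacement of the answer is a valid one. *)
Lemma search_pair out :
  pigeon_pair n C out -> pigeon_pair n C (search n C x y x' y' out).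
Proof.
move=> pair_out; rewrite /search -/(run_search_steps _ _) search_steps_chain.
apply: new_answer_pair; rewrite ?size_chain //; left.
elim/last_ind: (pairs _ _) => // l p IHl.
rewrite /run_search_steps foldl_rcons -/(run_search_steps _ _) /search_step.
rewrite search_steps_chain; apply: new_answer_pair; rewrite ?size_chain //.
by left.
Qed.

(** The chains are peeled from the end: as long as the states are equal, so are the last bits q_ij
    and the preceding values of C. Since the q_ij do not all agree, unequal states with equal values
    of C must turn up, and the search tests them. *)
Lemma search_collision out :
  let l := pairs (n + n) (n + n) in
  ceval C (chain n C x y l) = ceval C (chain n C x' y' l) ->
  ~ (forall p, p \in l -> mix x y p = mix x' y' p) ->
  pigeon_pair n C (search n C x y x' y' out).
Proof.
move=> l E neq; rewrite /search -/(run_search_steps _ _) search_steps_chain.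
rewrite -/l; apply: new_answer_pair; rewrite ?size_chain //=.
have [[sol|eq_mix]|neq_uv] :
    (pigeon_pair n C (run_search_steps out l).2 \/
      forall p, p \in l -> mix x y p = mix x' y' p) \/
    chain n C x y l != chain n C x' y' l; last first.
- by right.
- by case: neq.
- by left.
have [eq_uv|] := eqVneq (chain n C x y l) (chain n C x' y' l); last by right.
(* Induction on prefixes of the enumeration with equal end states: either the answer is already
   valid or all bits so far agree. *)
left; elim/last_ind: l eq_uv {E neq} => [|l p IHl] eq_uv; first by right.
move: eq_uv; rewrite /chain !foldl_rcons -!/(chain _ _ _ _ _) => -[eq_p eq_o].
have solS : pigeon_pair n C (run_search_steps out l).2 \/
    chain n C x y l != chain n C x' y' l ->
    pigeon_pair n C (run_search_steps out (rcons l p)).2.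
  move=> H; rewrite /run_search_steps foldl_rcons -/(run_search_steps _ _).
  rewrite /search_step search_steps_chain.
  by apply: new_answer_pair; rewrite ?size_chain //; case: H; [left|right].
have [eq_uv|neq] := eqVneq (chain n C x y l) (chain n C x' y' l); last first.
  by left; apply: solS; right.
have [sol|eq_l] := IHl eq_uv; first by left; apply: solS; left.
by right=> q; rewrite mem_rcons inE => /predU1P[->|/eq_l].
Qed.

End Search.

Section Reduction.

Variables (n : nat) (C : circuit).
Hypotheses (n_gt0 : 0 < n) (C_ok : is_circuit n n.-1 C).

Let H := hash_instance (WPInstance n C).

Lemma hash_instance_valid : ws_valid H.
Proof.
have n0 : n = n.-1.+1 by rewrite prednK.
split; [by []|exact: hash_circuit_ok| |].
  by split; rewrite /ws_vertex /= size_repeat_bits mulnC.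
by split; rewrite /= n0.
Qed.

Lemma hash_color x y : ws_vertex H x -> ws_vertex H y ->
  ws_color H x y = false :: ceval C (chain n C x y (pairs (n + n) (n + n))).
Proof.
rewrite /ws_vertex /ws_color /= mul2n -addnn => sx sy.
exact: ceval_hash_circuit.
Qed.

Lemma hash_colorC x y : ws_vertex H x -> ws_vertex H y ->
  ws_color H x y = ws_color H y x.
Proof.
move=> vx vy; rewrite !hash_color //; congr (_ :: ceval C _).
rewrite /chain; elim/last_ind: (pairs _ _) => // l p IHl.
by rewrite !foldl_rcons IHl /chain_step mixC.
Qed.

Lemma search_hash_collision x y x' y' out :
  ws_vertex H x -> ws_vertex H y -> ws_vertex H x' -> ws_vertex H y' ->
  x <> y -> x' <> y' -> ws_color H x y = ws_color H x' y' ->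
  ~ ((x = x' /\ y = y') \/ (x = y' /\ y = x')) ->
  pigeon_pair n C (search n C x y x' y' out).
Proof.
move=> vx vy vx' vy' neq neq'; rewrite !hash_color // => -[E] neq_xy.
apply: search_collision => // eq_mix; apply: neq_xy.
move: vx vy vx' vy'; rewrite /ws_vertex /= mul2n -addnn => sx sy sx' sy'.
exact: mix_inj eq_mix.
Qed.

(** Kind (ii) contradicts the symmetry of the colour; the others supply two different unordered
    pairs of the same colour. Searches performed after the successful one preserve its answer by
    [search_pair]. *)
Lemma pigeon_answer_correct t : wsc_solution H t ->
  pigeon_pair n C (pigeon_answer n C t).
Proof.
have [_ _ [va vb vc] [ab ac bc]] := hash_instance_valid.
case: t => [|x y|x y z|x y z x' y' z']; rewrite /pigeon_answer.
- move=> /= E; apply: search_hash_collision => //.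
  by case=> [[_ /bc]|[/ac]].
- by case=> vx vy; rewrite hash_colorC.
- case=> -[[vx vy vz] [xy xz yz]] E _; apply: search_pair => //.
  apply: search_hash_collision => //.
  by case=> [[/xy]|[/xz]].
- case=> -[[vx vy vz] [xy xz yz]] [[vx' vy' vz'] [xy' xz' yz']] neq [E1 E2 E3].
  have [e1|n1] := boolP ((x == x') && (y == y') || (x == y') && (y == x')); last first.
    do 4 apply: search_pair => //; apply: search_hash_collision => // -[] [/= d1 d2];
    by move: n1; rewrite d1 d2 !eqxx ?orbT.
  have [e2|n2] := boolP ((x == x') && (z == z') || (x == z') && (z == x')); last first.
    do 3 apply: search_pair => //; apply: search_hash_collision => // -[] [/= d1 d2];
    by move: n2; rewrite d1 d2 !eqxx ?orbT.
  have [_|n3] := boolP ((y == y') && (z == z') || (y == z') && (z == y')); last first.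
    do 2 apply: search_pair => //; apply: search_hash_collision => // -[] [/= d1 d2];
    by move: n3; rewrite d1 d2 !eqxx ?orbT.
  (* The edges now agree as unordered pairs. Either x = x', y = y', z = z', so the vertex sets
     coincide, or two distinct vertices of one triangle get identified. *)
  case: neq => w; rewrite !inE.
  case/orP: e1 => /andP[/eqP d1 /eqP d2]; case/orP: e2 => /andP[/eqP d3 /eqP d4];
  solve [by rewrite d1 d2 d4 | exfalso; congruence].
Qed.

End Reduction.

(** * Loop bounds from input sizes, and the three reductions *)

Lemma size_enc_list_ge (T : Type) (enc : T -> seq bool) ts :
  size ts < size (enc_list enc ts).
Proof. by elim: ts => //= t ts IHts; rewrite size_cat; lia. Qed.

Lemma bounded_enc_list (T : Type) (enc : T -> seq bool) (P : pred T) L ts :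
  (forall t, size (enc t) <= L -> P t) -> size (enc_list enc ts) <= L -> all P ts.
Proof.
move=> HP; elim: ts => //= t ts IHts; rewrite size_cat => le_L.
by rewrite HP ?IHts //; lia.
Qed.

(** Wire numbers are written in unary, so each is at most the length of the text; this lets loop
    counts be measured by the input size. *)
Lemma bounded_enc_circuit L C : size (enc_circuit C) <= L -> bounded_circuit L C.
Proof.
rewrite /enc_circuit size_cat => le_L.
have lt1 := size_enc_list_ge enc_gate (gates C).
have lt2 := size_enc_list_ge enc_nat (outputs C).
split; try lia.
- apply: (bounded_enc_list (enc := enc_gate) (L := L)); last by lia.
  by case=> [b|i|i j|i j]; rewrite /bounded_gate /= ?size_cat /enc_nat ?size_rcons
    ?size_nseq => le; rewrite ?andbT; lia.
- apply: (bounded_enc_list (enc := enc_nat) (L := L)); last by lia.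
  by move=> i; rewrite size_rcons size_nseq; lia.
Qed.

Lemma bounded_answer t :
  all (fun v => size v <= size (enc_ws_answer t)) (answer_vertices t).
Proof.
rewrite enc_ws_answerE size_cat; elim: (answer_vertices t) => //= v vs IHvs.
rewrite size_cat size_enc_bits; apply/andP; split; first by lia.
by apply: sub_all IHvs => u; lia.
Qed.

Lemma weak_pigeon_reducible : reducible weak_Pigeon Ward_Szabo_Collisions.
Proof.
exists (result 5 hash_prog), (fun x s => result 5 search_prog (pairing x s)).
split; [exact: polytime_result| |].
  by exists (result 5 search_prog); split=> //; apply: polytime_result.
move=> x s HS [n C] [/= n_gt0 C_ok] Ex.
have sz_o := size_outputs_ok C_ok.
have szx : size x = n + 1 + size (enc_circuit C).
  by rewrite Ex /enc_wp_instance size_cat size_rcons size_nseq addn1.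
have lt1 := size_enc_list_ge enc_gate (gates C).
have lt2 := size_enc_list_ge enc_nat (outputs C).
have le_C : size (gates C) + 2 <= size (enc_circuit C).
  by rewrite /enc_circuit size_cat; lia.
(* A valid input has at least 4 bits: at least two for [enc_nat n], as n > 0, and one terminator for
   each of the two lists of the circuit. From S = 4 on, S^2 absorbs the constant 16. *)
have pow S : 4 <= S -> 16 * S ^ 3 <= S ^ 5 /\ 16 * S <= S ^ 3.
  move=> le_S; rewrite -[5]/(2 + 3) expnD -[3]/(2 + 1) expnD expn1.
  have le16 : 16 <= S ^ 2 by rewrite -[16]/(4 ^ 2) leq_exp2r.
  by split; rewrite !leq_mul2r le16 ?orbT.
have [|p5 p3] := pow (size x); first by lia.
have bC5 k : size x <= k -> bounded_circuit k C.
  by move=> le_k; apply: bounded_enc_circuit; lia.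
have Efx : result 5 hash_prog x = enc_ws_instance (hash_instance (WPInstance n C)).
  rewrite /result Ex run_hash_prog -?Ex; first exact: revK.
  - by apply: bC5; lia.
  - by lia.
  (* The exponent 5 comes from here. The circuit has (2n)^2 blocks of at most 2S wires each, so at
     most 8 S^3 wires in blocks; the remaining terms are linear, and 16 S^3 is at most S^5. *)
  - rewrite /last_base size_pairs; move: p5 p3; rewrite /block_size.
    set S := size x in szx *.
    have E3 : S ^ 3 = S * S * S by rewrite !expnS expn0 muln1 mulnA.
    have le_n : n + n <= 2 * S by lia.
    have le_bs : n + size (gates C) + 4 <= 2 * S by lia.
    have := leq_mul (leq_mul le_n le_n) le_bs.
    have -> : 2 * S * (2 * S) * (2 * S) = 8 * (S * S * S) by lia.
    by rewrite -E3; lia.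
have [t [Es sol]] := HS _ (hash_instance_valid n_gt0 C_ok) Efx.
have [u Eu solu] := pigeon_answer_correct n_gt0 C_ok sol.
exists u; split=> //; rewrite -Eu Es Ex.
set z := pairing _ _.
have szz : size z = 2 * size x + 1 + (2 * size (enc_ws_answer t) + 1).
  by rewrite size_cat !size_enc_bits -Ex.
have [|q5 q3] := pow (size z); first by lia.
rewrite /result run_search_prog; first exact: revK.
- by apply: bC5; lia.
- by [].
- by [].
- by lia.
- by lia.
- by rewrite -Ex; lia.
- by lia.
- by apply: sub_all (bounded_answer t) => v; lia.
Qed.

Definition second_prog : prog := pseqs [:: pdecode 3; pdecode 4; PMove 4 1].

(** Moving the input to register 1 reverses it, and [result] reverses it back. *)
Lemma polytime_id : polytime id.
Proof.
have [M [p Mp]] := polytime_result 0 (PMove 0 1).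
exists M, p => x; have [halted outE] := Mp x; split=> //.
by apply: etrans outE _; rewrite /result run_move //; apply: revK.
Qed.

Lemma polytime2_second : polytime2 (fun x s => s).
Proof.
exists (result 1 second_prog); split; first exact: polytime_result.
move=> x s; set z := pairing x s.
have szz : size z = 2 * size x + 1 + (2 * size s + 1).
  by rewrite size_cat !size_enc_bits.
have le_x : size x <= size z by lia.
have le_s : size s <= size z by lia.
rewrite /result expn1 /second_prog run_seqs.
rewrite (@run_decode _ 3 x (enc_bits s)) // run_seqs.
rewrite (@run_decode _ 4 s [::]) //; last by rewrite cats0.
by rewrite run_seqs run_move // run_seqs0; apply: revK.
Qed.

(** The instance stays the same and the solution is passed on, by the second projection of the
    pairing. *)
Lemma reducible_sub (R S : search_problem) :
  (forall x s, S x s -> R x s) -> reducible R S.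
Proof.
by exists id, (fun x s => s); split; [exact: polytime_id|exact: polytime2_second|].
Qed.

Theorem theorem7p4 :
  reducible weak_Pigeon Ward_Szabo_Collisions /\
  reducible Ward_Szabo_Collisions Ward_Szabo_Colorful_Collisions /\
  reducible Ward_Szabo_Colorful_Collisions Ward_Szabo.
Proof.
split; first exact: weak_pigeon_reducible.
(* Only pairs of triples are treated differently by the three notions of solution: dropping the
   trichromatic condition gives the second reduction, and Ward-Szabo admits no such answer, which
   gives the third. *)
split; apply: reducible_sub => x s Sxs i vi Ex; have [t [Et sol]] := Sxs i vi Ex;
  exists t; split=> //; case: t sol {Et} => //.
by move=> ? ? ? ? ? ? [].
Qed.
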